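(* Let $\mathcal X,\mathcal Y$ be real separable Hilbert spaces, $B>0$, $\sigma>0$, $k\in\mathbb N$, $0<\alpha\le1$, $1\le p<\infty$, let $\mu$ be a probability measure on $\mathcal X$ satisfying conditions (i), (ii), (iii-L), (iii-U) of the context, and suppose the noise is Hilbert-valued Gaussian noise. Suppose that the eigenvalues of the covariance operator of $\mu$ are $\lambda_i=\exp(-\tau i^\omega)$, $i\in\mathbb N$, for some $\tau>0$ and $\omega\ge1$. Then $$\mathcal L_m(\mathcal F^{k,\alpha}_B;L^p_\mu)\asymp_{k,\alpha,\tau,\omega,\iota,p}\bigl(\log(m/\sigma^2)\bigr)^{\frac{\omega}{\omega+1}},\qquad m\to\infty,$$ where $\mathcal L_m(\mathcal F^{k,\alpha}_B;L^p_\mu)=-\log(\mathcal M_m(\mathcal F^{k,\alpha}_B;L^p_\mu))$ and $\mathcal M_m$ is either the fixed-design or the random-design minimax risk.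
   Context: Conditions on $\mu$ (a Borel probability measure on $\mathcal X$): (i) $\mu$ has mean zero and $\int_{\mathcal X}\|X\|_{\mathcal X}^2\,d\mu(X)<\infty$. (ii) Let $\lambda_1\ge\lambda_2\ge\cdots>0$ and $\{\phi_i\}_i\subset\mathcal X$ be the eigenvalues and an orthonormal basis of eigenvectors of the covariance operator of $\mu$. The real random variables $\xi_i=\langle X,\phi_i\rangle_{\mathcal X}/\sqrt{\lambda_i}$, $X\sim\mu$, are independent. (iii-L) Each $\xi_i$ has a density $\nu_i$ with respect to Lebesgue measure, and there are constants $a,b>0$ (independent of $i$) with $\nu_i(x)\ge b$ for all $|x|\le a$ and all $i$. Put $\iota=2ab\le1$. (iii-U) With $p'=\max\{p,2\}$, $\sup_i(\mathbb E|\xi_i|^{p'})^{1/p'}<\infty$. Observations: $Y_i=F(X_i)+\sigma E_i$, $i=1,\dots,m$. Hilbert-valued Gaussian noise: $E_1,\dots,E_m$ are i.i.d. mean-zero Gaussian random elements of $\mathcal Y$ with covariance operator $\Upsilon$, $\mathrm{Tr}(\Upsilon)=1$. Class: $\mathcal L^j(\mathcal X;\mathcal Y)$ is the space of continuous $j$-linear maps from $\mathcal X$ to $\mathcal Y$ with the operator norm ($\mathcal L^0=\mathcal Y$), and $D^jF(X)\in\mathcal L^j(\mathcal X;\mathcal Y)$ is the $j$th Fréchet derivative ($D^0F=F$). $C^{k,\alpha}(\mathcal X;\mathcal Y)$ is the space of $k$-times differentiable $F:\mathcal X\to\mathcal Y$ whose $k$th derivative is $\alpha$-Hölder continuous, with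 norm $\|F\|_{C^{k,\alpha}}=\sum_{j=0}^k\sup_{X\in\mathcal X}\|D^jF(X)\|_{\mathcal L^j(\mathcal X;\mathcal Y)}+[D^kF]_\alpha$, where $[D^kF]_\alpha=\sup_{X\ne X'}\|D^kF(X)-D^kF(X')\|_{\mathcal L^k(\mathcal X;\mathcal Y)}/\|X-X'\|_{\mathcal X}^\alpha$. $\mathcal F^{k,\alpha}_B=\{F\in C^{k,\alpha}(\mathcal X;\mathcal Y):\|F\|_{C^{k,\alpha}}\le B\}$. Norm: $\|F\|_{L^p_\mu(\mathcal X;\mathcal Y)}=(\int_{\mathcal X}\|F(X)\|_{\mathcal Y}^p\,d\mu(X))^{1/p}$. Minimax risks: an estimator $\widehat F$ is a mapping from the data to $L^p_\mu(\mathcal X;\mathcal Y)$. Fixed design: $\mathcal M_m(\mathcal F;L^p_\mu)=\inf_{\mathcal D}\inf_{\widehat F}\sup_{F\in\mathcal F}\mathbb E\|F-\widehat F\|_{L^p_\mu(\mathcal X;\mathcal Y)}$, with infimum over designs $\mathcal D=\{X_1,\dots,X_m\}\subset\mathcal X$ and expectation over the $E_i$. Random design: $\mathcal M_m(\mathcal F;L^p_\mu)=\inf_\nu\inf_{\widehat F}\sup_{F\in\mathcal F}\mathbb E\|F-\widehat F\|_{L^p_\mu(\mathcal X;\mathcal Y)}$, with infimum over probability measures $\nu$ on $\mathcal X$, $X_1,\dots,X_m$ i.i.d. from $\nu$ independent of the $E_i$, and expectation over the $X_i$ and $E_i$. Asymptotic notation: $A(m)\lesssim_r A'(m)$ as $m\to\infty$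 means there is a constant $c(r)>0$ depending only on the parameters $r$ such that $A(m)\le c(r)A'(m)$ for all sufficiently large $m$ (the threshold may depend on all fixed data); $A\asymp_r A'$ means $A\lesssim_r A'$ and $A'\lesssim_r A$. *)

(* Defs.v *)
From HB Require Import structures.
From mathcomp Require Import all_boot all_order all_algebra.
From mathcomp Require Import all_classical all_reals all_analysis.
Set Implicit Arguments.
Unset Strict Implicit.
Unset Printing Implicit Defensive.
Import Order.TTheory GRing.Theory Num.Theory.
Import numFieldNormedType.Exports.
Local Open Scope classical_set_scope.
Local Open Scope ring_scope.

HB.mixin Record isHilbert (R : realType) X of CompleteNormedModule R X := {
  inner : {dot X for (@idfun R)};
  inner_norm : forall x : X, inner x x = `|x| ^+ 2 }.

#[short(type="hilbertType")]
HB.structure Definition Hilbert (R : realType) :=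
  {X of isHilbert R X & CompleteNormedModule R X}.

Notation "''<' x , y '>'" := (inner x y)
  (at level 0, x at level 69, y at level 69, format "''<' x ,  y '>'").

Definition separable (T : topologicalType) : Prop :=
  exists2 D : set T, countable D & dense D.

Definition borel (T : ptopologicalType) := g_sigma_algebraType (@open T).

Section multilinear.
Context {R : realType} {X Y : hilbertType R}.

Definition continuous_multilinear j (T : ('I_j -> X) -> Y) : Prop :=
  continuous (T : {ptws 'I_j -> X} -> Y) /\
  forall (v : 'I_j -> X) i a x y,
    T [eta v with i |-> a *: x + y] =
    a *: T [eta v with i |-> x] + T [eta v with i |-> y].

Definition opnorm j (T : ('I_j -> X) -> Y) : \bar R :=
  ereal_sup [set `|T v|%:E | v in [set v | forall i, `|v i| <= 1]].

Definition vcons j (h : X) (v : 'I_j -> X) : 'I_j.+1 -> X :=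
  fun i => if unlift ord0 i is Some l then v l else h.

(* [G'] is the Frechet derivative of [G : X -> L^j], where L(X; L^j) is
   identified with L^(j+1) through T h v = T (h, v). *)
Definition is_frechet_derivative j (G : X -> ('I_j -> X) -> Y)
    (G' : X -> ('I_j.+1 -> X) -> Y) : Prop :=
  forall (x : X) (e : R), 0 < e -> \forall h \near (0 : X),
    (opnorm (fun v => (G (x + h) v - G x v - G' x (vcons h v))%R)
      <= (e * `|h|)%:E)%E.

Definition frechet_derivatives (F : X -> Y) k
    (D : forall j, X -> ('I_j -> X) -> Y) : Prop :=
  [/\ forall x v, D 0%N x v = F x,
      forall j x, (j <= k)%N -> continuous_multilinear (D j x) &
      forall j, (j < k)%N -> is_frechet_derivative (D j) (D j.+1)].

Definition holder_seminorm j (alpha : R) (G : X -> ('I_j -> X) -> Y) : \bar R :=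
  ereal_sup [set (opnorm (fun v => (G z.1 v - G z.2 v)%R)
                   * ((`|z.1 - z.2| `^ alpha)^-1)%:E)%E
            | z in [set z : X * X | z.1 != z.2]].

(* [D] lists the derivatives D^0 F = F, ..., D^k F. *)
Definition C_norm k (alpha : R) (D : forall j, X -> ('I_j -> X) -> Y) : \bar R :=
  (\sum_(j < k.+1) ereal_sup [set opnorm (D j x) | x in setT]
    + holder_seminorm alpha (D k))%E.

Definition C_ball k (alpha B : R) : set (X -> Y) :=
  [set F | exists2 D : forall j, X -> ('I_j -> X) -> Y,
     frechet_derivatives F k D & (C_norm k alpha D <= B%:E)%E].

End multilinear.

Section hilbert_measure.
Context {R : realType} {X : hilbertType R}.
Variable mu : probability (borel X) R.

(* A family indexed by a set S of naturals, so that finite-dimensional spaces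
   are covered as well. *)
Definition orthonormal_basis (S : set nat) (e : nat -> X) : Prop :=
  (forall i j, S i -> S j -> '<e i, e j> = (i == j)%:R) /\
  forall x : X, (\sum_(i < n | (i : nat) \in S) '<x, e i> *: e i) @[n --> \oo] --> x.

(* Weak form of the Bochner integral of the identity. *)
Definition has_mean (m : X) : Prop :=
  forall h : X, mu.-integrable setT (fun x : borel X => '<x, h>%:E) /\
    (\int[mu]_x '<x, h>%:E = '<m, h>%:E)%E.

Definition finite_second_moment : Prop :=
  (\int[mu]_x (`|x : X| ^+ 2)%:E < +oo)%E.

(* For a measure of mean zero: C h is the weak integral of <x, h> x. *)
Definition is_covariance_operator (C : X -> X) : Prop :=
  forall h g : X, (\int[mu]_x ('<x, h> * '<x, g>)%:E = '<C h, g>%:E)%E.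

(* On a separable space bases of this form exist, and for a covariance operator
   the sum does not depend on the basis. *)
Definition has_trace (C : X -> X) (t : \bar R) : Prop :=
  forall S e, orthonormal_basis S e -> (\esum_(i in S) '<C (e i), e i>%:E = t)%E.

(* The normal law with standard deviation [s]; degenerate when s = 0, a case in
   which [normal_prob] is a uniform law. *)
Definition gaussian_real (m s : R) (A : set R) : \bar R :=
  if s == 0 then \d_m A else normal_prob m s A.

Definition is_gaussian : Prop :=
  forall h : X, exists m s : R, forall A : set R, measurable A ->
    mu ((fun x => '<x, h>) @^-1` A) = gaussian_real m s A.

Definition mutually_independent (xi : nat -> X -> R) : Prop :=
  forall (s : seq nat) (A : nat -> set R), uniq s ->
    (forall i, measurable (A i)) ->
    (mu (\bigcap_(i in [set` s]) xi i @^-1` A i) =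
     \prod_(i <- s) mu (xi i @^-1` A i))%E.

Definition has_density (xi : X -> R) (nu : R -> R) : Prop :=
  [/\ measurable_fun setT nu, forall x, 0 <= nu x &
      forall A : set R, measurable A ->
        (mu (xi @^-1` A) = \int[lebesgue_measure]_(x in A) (nu x)%:E)%E].

(* Eigenvalues and eigenvectors are numbered from 0: [lambda i] and [phi i] are
   the (i+1)-st ones. *)
Definition coordinate (lambda : nat -> R) (phi : nat -> X) (i : nat) (x : X) : R :=
  '<x, phi i> / Num.sqrt (lambda i).

Definition condition_i : Prop := has_mean 0 /\ finite_second_moment.

Definition condition_ii (lambda : nat -> R) (phi : nat -> X) : Prop :=
  [/\ forall i, 0 < lambda i,
      forall i, lambda i.+1 <= lambda i,
      orthonormal_basis setT phi,
      exists2 C : X -> X, is_covariance_operator C &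
        forall i, C (phi i) = lambda i *: phi i &
      mutually_independent (coordinate lambda phi)].

Definition condition_iiiL lambda phi (a b : R) : Prop :=
  [/\ 0 < a, 0 < b &
      exists nu : nat -> R -> R, forall i,
        has_density (coordinate lambda phi i) (nu i) /\
        forall x, `|x| <= a -> b <= nu i x].

Definition condition_iiiU lambda phi (p : R) : Prop :=
  (ereal_sup [set Lnorm mu (Num.max p 2)%:E (EFin \o coordinate lambda phi i)
             | i in setT] < +oo)%E.

End hilbert_measure.

Definition gaussian_noise {R : realType} {Y : hilbertType R}
    (gamma : probability (borel Y) R) : Prop :=
  [/\ is_gaussian gamma, has_mean gamma 0 &
      exists2 U : Y -> Y, is_covariance_operator gamma U & has_trace U 1%E].

Section iid.
Context d (T : measurableType d) (R : realType) (P : probability T R).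

Definition tuple_cons n (z : T * n.-tuple T) : n.+1.-tuple T :=
  [the n.+1.-tuple T of z.1 :: z.2].

Lemma measurable_tuple_cons n : measurable_fun setT (@tuple_cons n).
Proof. exact: measurable_cons. Qed.

HB.instance Definition _ n :=
  isMeasurableFun.Build _ _ _ _ (@tuple_cons n) (@measurable_tuple_cons n).

Fixpoint iid_law n : probability (n.-tuple T) R :=
  if n is n'.+1 return probability (n.-tuple T) R
  then distribution (P \x iid_law n')%E (@tuple_cons n')
  else \d_([tuple] : 0.-tuple T).

End iid.

Section minimax.
Context {R : realType} {X Y : hilbertType R}.
Variables (mu : probability (borel X) R) (gamma : probability (borel Y) R).
Variables (sigma p : R).

Definition Lp_norm (F : X -> Y) : \bar R :=
  Lnorm mu p%:E (fun x : borel X => `|F x|%:E).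

(* Y being separable, Borel measurability is strong measurability. *)
Definition Lp : set (X -> Y) :=
  [set F | measurable_fun setT (F : borel X -> borel Y) /\ (Lp_norm F < +oo)%E].

Definition Lp_open (U : set (X -> Y)) : Prop :=
  forall F, Lp F -> U F -> exists2 e : R, 0 < e &
    forall G, Lp G -> (Lp_norm (G - F)%R < e%:E)%E -> U G.

(* Measurable maps from the data to L^p_mu with its Borel sigma-algebra;
   measurability gives the expectations below their meaning. *)
Definition estimator d (T : measurableType d) : set (T -> X -> Y) :=
  [set Fhat | (forall t, Lp (Fhat t)) /\
    forall U, Lp_open U -> measurable (Fhat @^-1` U)].

Definition observation (F : X -> Y) (x : X) (e : Y) : Y := F x + sigma *: e.

(* The noise enters only through the law [gamma] of each E_i: expectations are
   integrals against product laws. *)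
Definition fixed_design_risk m (D : m.-tuple (borel X))
    (Fhat : m.-tuple (borel Y) -> X -> Y) (F : X -> Y) : \bar R :=
  (\int[iid_law gamma m]_E
    Lp_norm (F - Fhat [tuple observation F (tnth D i) (tnth E i) | i < m])%R)%E.

Definition fixed_design_minimax (class : set (X -> Y)) m : \bar R :=
  ereal_inf [set ereal_inf [set ereal_sup [set fixed_design_risk D Fhat F
                                          | F in class]
                           | Fhat in @estimator _ (m.-tuple (borel Y))]
            | D in [set: m.-tuple (borel X)]].

Definition random_design_risk m (nu : probability (borel X) R)
    (Fhat : m.-tuple (borel X * borel Y)%type -> X -> Y) (F : X -> Y) : \bar R :=
  (\int[iid_law nu m \x iid_law gamma m]_z
    Lp_norm (F - Fhat [tuple (tnth z.1 i,
                              observation F (tnth z.1 i) (tnth z.2 i)) | i < m])%R)%E.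

Definition random_design_minimax (class : set (X -> Y)) m : \bar R :=
  ereal_inf [set ereal_inf [set ereal_sup [set random_design_risk nu Fhat F
                                          | F in class]
                           | Fhat in @estimator _ (m.-tuple (borel X * borel Y)%type)]
            | nu in [set: probability (borel X) R]].

End minimax.

(* Main.v *)
Require Import Defs.
From mathcomp Require Import all_boot all_order all_algebra.
From mathcomp Require Import all_classical all_reals all_analysis.
From mathcomp Require Import measurable_realfun.
From mathcomp Require Import zify ring lra.
Set Implicit Arguments.
Unset Strict Implicit.
Unset Printing Implicit Defensive.
Import Order.TTheory GRing.Theory Num.Theory.
Import numFieldNormedType.Exports.
Local Open Scope classical_set_scope.
Local Open Scope ring_scope.

(* Lower bound. Cut the first n coordinates into N^n >= 2m cells. Whatever the
   design, at least half of the cells contain no design point; flipping the sign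
   of bumps supported on these cells leaves the data unchanged, so no estimator
   beats half the L^p norm of the flipped part. With
   n ~ (log m)^(1/(omega+1)) and log N ~ (log m)^(omega/(omega+1)), both the
   height that the C^{k,alpha} ball allows to the bumps and the mass of the cells
   are exp(-O(log m)^(omega/(omega+1))).

   Upper bound. Sample the centers of a cubic grid in the first n coordinates
   uniformly, and estimate F on each cell by the inverse-probability weighted sum
   of the responses observed at its center. The bias is governed by the variance
   of the discarded coordinates, at most a constant times exp(-(tau/2) n^omega),
   and by the mesh; the stochastic error is at most (number of cells)^2 / sqrt m, which is
   negligible when the number of cells is a small power of m. The rate is
   logarithmic in the risk, so such crude exponents suffice. *)

(** * Hilbert spaces, Borel measurability, Gaussian noise *)

(** The theorem sees only [-ln] of the risk. With D = (ln m)^(omega/(omega+1)), any factor exp(O(D))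
    may be wasted, and it is: maxima over cells become sums, and moments beyond the second are
    avoided. The real restriction is on what may enter an exponent. The constants are fixed before
    [B], [sigma], [a], [b] and the spaces, so these may occur only in prefactors, which a large m
    absorbs; [iota], which is raised to the power n, does enter the exponent.

    The exponent omega/(omega+1) is a balance. In the n-th direction a bump has width about
    exp(-(tau/2) n^omega) / N, and there are N^n cells. Setting ln N ~ n^omega and n ln N ~ ln m
    gives n^(omega+1) ~ ln m. The height of the bumps is a fixed power of their width, hence
    exp(-O(D)).

    The recurrent obstacle is measurability. Sums of [Y]-valued maps are handled through a countable
    dense subset of [Y], the loss through open balls of L^p, and the estimator by letting it take
    countably many values. *)

Section hilbert.
Context {R : realType} {X : hilbertType R}.
Implicit Types x y z : X.

Lemma innerC x y : '<x, y> = '<y, x>.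
Proof. by rewrite (@hermitian_subproof _ _ _ _ inner) /= expr0 mul1r. Qed.

Lemma innerBl x y z : '<x - y, z> = '<x, z> - '<y, z>.
Proof. exact: (@zmod_morphisml_subproof _ _ _ _ _ _ inner z x y). Qed.

Lemma innerZl a x z : '<a *: x, z> = a * '<x, z>.
Proof. exact: (@linearl_subproof _ _ _ _ _ _ inner z a x). Qed.

Lemma inner0l z : '<0, z> = 0.
Proof. by rewrite -(subrr z) innerBl subrr. Qed.

Lemma innerNl x z : '<- x, z> = - '<x, z>.
Proof. by rewrite -(sub0r x) innerBl inner0l sub0r. Qed.

Lemma innerDl x y z : '<x + y, z> = '<x, z> + '<y, z>.
Proof. by rewrite -{1}[y]opprK innerBl innerNl opprK. Qed.

Lemma innerDr x y z : '<z, x + y> = '<z, x> + '<z, y>.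
Proof. by rewrite innerC innerDl !(innerC z). Qed.

Lemma innerZr a x z : '<z, a *: x> = a * '<z, x>.
Proof. by rewrite innerC innerZl innerC. Qed.

Lemma inner0r z : '<z, 0> = 0.
Proof. by rewrite innerC inner0l. Qed.

Lemma inner_suml I (r : seq I) (P : pred I) (f : I -> X) z :
  '<\sum_(i <- r | P i) f i, z> = \sum_(i <- r | P i) '<f i, z>.
Proof.
by apply: (big_morph (fun x => '<x, z>)) => [x y|]; [exact: innerDl|exact: inner0l].
Qed.

Lemma inner_sumr I (r : seq I) (P : pred I) (f : I -> X) z :
  '<z, \sum_(i <- r | P i) f i> = \sum_(i <- r | P i) '<z, f i>.
Proof. by rewrite innerC inner_suml; apply: eq_bigr => i _; rewrite innerC. Qed.

Lemma sqr_normD x y : `|x + y| ^+ 2 = `|x| ^+ 2 + 2 * '<x, y> + `|y| ^+ 2.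
Proof. by rewrite -!inner_norm innerDl !innerDr (innerC y x); ring. Qed.

Lemma cauchy_schwarz x y : `|'<x, y>| <= `|x| * `|y|.
Proof.
have [->|y0] := eqVneq y 0; first by rewrite inner0r !normr0 mulr0.
have y2 : 0 < `|y| ^+ 2 by rewrite exprn_gt0// normr_gt0.
have := exprn_ge0 2 (normr_ge0 (x - ('<x, y> / `|y| ^+ 2) *: y)).
rewrite -scaleNr sqr_normD innerZr normrZ exprMn normrN real_normK ?num_real//.
set s := '<x, y> => h.
have {}h : s ^+ 2 <= (`|x| * `|y|) ^+ 2.
  rewrite exprMn -subr_ge0.
  have -> : `|x| ^+ 2 * `|y| ^+ 2 - s ^+ 2 =
    `|y| ^+ 2 * (`|x| ^+ 2 + 2 * (- (s / `|y| ^+ 2) * s)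
      + (s / `|y| ^+ 2) ^+ 2 * `|y| ^+ 2).
    by field; rewrite normr_eq0.
  by rewrite mulr_ge0// ltW.
by rewrite -ler_sqr ?nnegrE ?mulr_ge0// real_normK ?num_real.
Qed.

Lemma inner_continuousl z : continuous (fun x => '<x, z>).
Proof.
move=> x; apply/cvgrPdist_lt => e e0.
near=> t.
rewrite -innerBl (le_lt_trans (cauchy_schwarz _ _))//.
have z0 : 0 < `|z| + 1 by rewrite ltr_wpDl.
rewrite (@le_lt_trans _ _ (`|x - t| * (`|z| + 1)))//.
  by rewrite ler_wpM2l// lerDl.
rewrite -ltr_pdivlMr//; near: t.
by apply: cvgr_dist_lt; [exact: cvg_id|exact: divr_gt0].
Unshelve. all: by end_near. Qed.

Lemma borel_open (U : set X) : open U -> measurable (U : set (borel X)).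
Proof. by move=> oU; exact: sub_sigma_algebra. Qed.

Lemma continuous_borel_measurable (f : X -> R) :
  continuous f -> measurable_fun setT (f : borel X -> R).
Proof.
move=> /continuousP cf; apply: (measurability _ (RGenOpens.measurableE R)).
move=> _ [_ [u [v ->]] <-]; rewrite setTI; apply: borel_open.
by apply: cf; exact: interval_open.
Qed.

End hilbert.

Lemma separable_dense_seq (R : realType) (X : hilbertType R) : separable X ->
  exists d : nat -> X, forall x (e : R), 0 < e -> exists n, `|x - d n| < e.
Proof.
move=> [D cD dD].
have hD x (e : R) : 0 < e -> exists2 y, D y & `|x - y| < e.
  move=> e0; have [|y [xy Dy]] := dD (ball x e) _ (ball_open x e).
    by exists x; exact: ballxx.
  by exists y => //; move: xy; rewrite -ball_normE.
have [y0 Dy0 _] := hD 0 1 ltr01.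
have /countable_injP[f fI] := cD.
(* [f] is injective on [D]; the sequence inverts it and takes the default value [y0] off its
   range. *)
exists (fun n => xget y0 [set y | D y /\ f y = n]) => x e e0.
have [y Dy xy] := hD x e e0; exists (f y).
case: (xgetPex y0 (ex_intro _ y (conj Dy erefl) :
  exists z, [set y' | D y' /\ f y' = f y] z)) => Dz fz.
by have -> : xget y0 [set y' | D y' /\ f y' = f y] = y by apply: fI; rewrite ?inE.
Qed.

(** * Measurable maps into a separable Hilbert space *)

Section borel_measurability.
Context {R : realType} {Y : hilbertType R}.
Context d {T : measurableType d}.

Lemma measurable_fun_borel (f : T -> Y) :
  (forall U, open U -> measurable (f @^-1` U)) ->
  measurable_fun setT (f : T -> borel Y).
Proof.
move=> h; apply: (@measurability _ _ _ (borel Y) setT f open) => //.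
by move=> _ [U oU <-]; rewrite setTI; exact: h.
Qed.

Lemma measurable_fun_borel_open (f : T -> borel Y) : measurable_fun setT f ->
  forall U : set Y, open U -> measurable (f @^-1` U).
Proof.
by move=> mf U oU; rewrite -[X in measurable X]setTI; apply: mf => //; exact: borel_open.
Qed.

(** Separability replaces uncountably many rectangles by countably many: the preimage of [U] is the
    union, over dense points [c n] and radii [r q], of the events that [f] is within [r q] of [c n]
    and [g] lies in [V n q]. The set [V n q] of translations carrying that ball into [U] is closed,
    since its complement is a union of balls. *)
Lemma borel_measurableD (f g : T -> borel Y) : separable Y ->
  measurable_fun setT f -> measurable_fun setT g ->
  measurable_fun setT ((fun t => (f t : Y) + (g t : Y)) : T -> borel Y).
Proof.
move=> /separable_dense_seq[c hc] mf mg; apply: measurable_fun_borel => U oU.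
pose r (q : nat) : R := q.+1%:R^-1.
have r0 q : 0 < r q by rewrite invr_gt0.
pose V n q : set Y := [set z | forall w : Y, `|w - c n| < r q -> U (w + z)].
have mV n q : measurable (V n q : set (borel Y)).
  rewrite -[X in measurable X]setCK; apply: measurableC; apply: borel_open.
  have -> : ~` V n q = \bigcup_(w in ~` U) ball (w - c n) (r q).
    apply/seteqP; split=> z /=.
      move=> /existsNP[w /not_implyP[wr nU]]; exists (w + z) => //=.
      by rewrite -ball_normE /= addrAC addrK.
    move=> [w nUw]; rewrite -ball_normE /= => wr; apply/existsNP; exists (w - z).
    by apply/not_implyP; split; [rewrite addrAC|rewrite subrK].
  by apply: bigcup_open => w _; exact: ball_open.
have -> : (fun t => (f t : Y) + (g t : Y)) @^-1` U =
  \bigcup_n \bigcup_q ((f @^-1` ball (c n) (r q)) `&` (g @^-1` V n q)).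
  apply/seteqP; split=> t /=; last first.
    by move=> [n _ [q _ [/= h1 h2]]]; apply: h2; move: h1; rewrite -ball_normE /= distrC.
  move=> Ut; have /nbhs_ballP[e /= e0 eU] := open_nbhs_nbhs (conj oU Ut).
  pose q := Num.trunc (2 / e).
  have qe : r q < e / 2.
    rewrite /r invf_plt ?posrE ?divr_gt0// invf_div.
    exact: truncnS_gt.
  have [n hn] := hc (f t) (r q) (r0 q).
  exists n => //; exists q => //; split => /=.
    by rewrite -ball_normE /= distrC.
  move=> w wr; apply: eU; rewrite -ball_normE /= opprD addrACA subrr addr0.
  rewrite -[f t](subrK (c n)) -addrA (le_lt_trans (ler_normD _ _))//.
  rewrite (splitr e) ltrD//; first exact: lt_trans qe.
  by rewrite distrC; exact: lt_trans qe.
apply: bigcup_measurable => n _; apply: bigcup_measurable => q _; apply: measurableI.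
  by apply: measurable_fun_borel_open => //; exact: ball_open.
by rewrite -[X in measurable X]setTI; exact: mg.
Qed.

Lemma continuous_borel_comp (h : Y -> Y) (f : T -> borel Y) : continuous h ->
  measurable_fun setT f -> measurable_fun setT ((h \o f) : T -> borel Y).
Proof.
move=> /continuousP ch mf; apply: measurable_fun_borel => U oU.
by rewrite comp_preimage; apply: measurable_fun_borel_open => //; exact: ch.
Qed.

Lemma borel_measurableZ a (f : T -> borel Y) :
  measurable_fun setT f -> measurable_fun setT ((fun t => a *: (f t : Y)) : T -> borel Y).
Proof. by apply: continuous_borel_comp; exact: scaler_continuous. Qed.

Lemma borel_measurableB (f g : T -> borel Y) : separable Y ->
  measurable_fun setT f -> measurable_fun setT g ->
  measurable_fun setT ((fun t => (f t : Y) - (g t : Y)) : T -> borel Y).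
Proof.
move=> sY mf mg; apply: borel_measurableD => //.
by apply: (continuous_borel_comp (h := fun y : Y => - y)) => //; exact: oppr_continuous.
Qed.

Lemma borel_measurable_sum I (s : seq I) (f : I -> T -> borel Y) : separable Y ->
  (forall i, measurable_fun setT (f i)) ->
  measurable_fun setT ((fun t => \sum_(i <- s) (f i t : Y)) : T -> borel Y).
Proof.
move=> sY mf; elim: s => [|i s IH].
  by under eq_fun do rewrite big_nil; exact: measurable_cst.
by under eq_fun do rewrite big_cons; exact: borel_measurableD.
Qed.

Lemma borel_measurable_norm (f : T -> borel Y) : measurable_fun setT f ->
  measurable_fun setT (fun t => `|f t : Y|).
Proof.
by apply: measurableT_comp; apply: continuous_borel_measurable; exact: norm_continuous.
Qed.

End borel_measurability.

(** Every preimage is a countable union of fibres of [kap], whatever the set [U]. This covers the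
    cellwise constant functions on [X] and the estimator, whose values lie in a function space. *)
Lemma measurable_countable_factor d (T : measurableType d) (C : countType) (Z : Type)
    (kap : T -> C) (Phi : C -> Z) (U : set Z) :
  (forall c, measurable (kap @^-1` [set c])) -> measurable ((Phi \o kap) @^-1` U).
Proof.
move=> mk.
have -> : (Phi \o kap) @^-1` U = \bigcup_(c in Phi @^-1` U) (kap @^-1` [set c]).
  by apply/seteqP; split=> t /=; [move=> h; exists (kap t)|move=> [c ? ->]].
rewrite bigcup_mkcond; apply: countable_bigcupT_measurable.
  exact: countableP.
by move=> c; case: ifPn.
Qed.

(** * Orthonormal systems and Gram-Schmidt *)

Section orthonormal.
Context {R : realType} {X : hilbertType R}.
Variable e : nat -> X.

(* Zero vectors are allowed, so that Gram-Schmidt needs no reindexing. *)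
Definition orthonormal_or_zero : Prop :=
  forall i j, '<e i, e j> = ((i == j) && (e i != 0))%:R.

Definition partial_proj n x : X := \sum_(i < n) '<x, e i> *: e i.

Hypothesis eo : orthonormal_or_zero.

Lemma inner_partial_proj n x i : (i < n)%N -> '<partial_proj n x, e i> = '<x, e i>.
Proof.
move=> ni; rewrite inner_suml (bigD1 (Ordinal ni))//= big1 => [|j ji].
  rewrite addr0 innerZl eo eqxx /=.
  by have [->|] := eqVneq (e i) 0; rewrite ?inner0r ?mul0r ?mulr1.
rewrite innerZl eo; case: eqP => [ij|]; last by rewrite mulr0.
by move: ji; rewrite -val_eqE /= ij eqxx.
Qed.

Lemma sqr_norm_partial_proj n x :
  `|partial_proj n x| ^+ 2 = \sum_(i < n) '<x, e i> ^+ 2.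
Proof.
rewrite -inner_norm {2}/partial_proj inner_sumr; apply: eq_bigr => i _.
by rewrite innerZr inner_partial_proj// expr2.
Qed.

Lemma sqr_norm_sub_partial_proj n x :
  `|x - partial_proj n x| ^+ 2 = `|x| ^+ 2 - \sum_(i < n) '<x, e i> ^+ 2.
Proof.
rewrite -scaleN1r sqr_normD innerZr normrZ exprMn normrN1 expr1n mul1r.
rewrite sqr_norm_partial_proj.
have -> : '<x, partial_proj n x> = \sum_(i < n) '<x, e i> ^+ 2.
  by rewrite inner_sumr; apply: eq_bigr => i _; rewrite innerZr expr2.
ring.
Qed.

Lemma bessel n x : `|x - partial_proj n x| <= `|x|.
Proof.
rewrite -ler_sqr ?nnegrE// sqr_norm_sub_partial_proj lerBlDr lerDl.
by apply: sumr_ge0 => i _; exact: sqr_ge0.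
Qed.

Lemma partial_projB n x y :
  partial_proj n (x - y) = partial_proj n x - partial_proj n y.
Proof.
rewrite /partial_proj -sumrB; apply: eq_bigr => i _.
by rewrite innerBl scalerBl.
Qed.

Lemma parseval_eseries : (forall x, partial_proj n x @[n --> \oo] --> x) ->
  forall x, (\sum_(i <oo) ('<x, e i> ^+ 2)%:E = (`|x| ^+ 2)%:E)%E.
Proof.
move=> cv x; apply/cvg_lim => //.
have -> : (fun n => \sum_(0 <= i < n) ('<x, e i> ^+ 2)%:E)%E =
    EFin \o (fun n => `|partial_proj n x| ^+ 2).
  by apply/funext => n; rewrite /= sqr_norm_partial_proj sumEFin big_mkord.
apply: cvg_EFin; first by apply: nearW.
by apply: cvgM; apply: cvg_norm; exact: cv.
Qed.

End orthonormal.

Section gram_schmidt.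
Context {R : realType} {X : hilbertType R}.
Variable d : nat -> X.

Definition normalized (x : X) : X := `|x|^-1 *: x.

(** Each vector depends on all earlier ones; carrying their list keeps the recursion structural.
    Since [normalized 0 = 0], a vector in the span of its predecessors yields a zero entry. *)
Fixpoint gs_seq n : seq X :=
  if n is m.+1 then
    rcons (gs_seq m) (normalized (d m - \sum_(b <- gs_seq m) '<d m, b> *: b))
  else [::].

Definition gs n : X := normalized (d n - \sum_(b <- gs_seq n) '<d n, b> *: b).

Lemma sum_gs_seq n x : \sum_(b <- gs_seq n) '<x, b> *: b = partial_proj gs n x.
Proof.
rewrite /partial_proj; elim: n => [|n IH] /=; first by rewrite big_nil big_ord0.
by rewrite big_rcons /= big_ord_recr /= -IH addrC.
Qed.

Lemma gsE n : gs n = normalized (d n - partial_proj gs n (d n)).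
Proof. by rewrite /gs sum_gs_seq. Qed.

Lemma norm_normalized (x : X) : x != 0 -> `|normalized x| = 1.
Proof. by move=> x0; rewrite normrZ ger0_norm ?invr_ge0// mulVf ?normr_eq0. Qed.

Lemma normalized_unit_or0 (x : X) : '<normalized x, normalized x> = (normalized x != 0)%:R.
Proof.
rewrite inner_norm; have [->|x0] := eqVneq x 0.
  by rewrite /normalized scaler0 normr0 expr0n eqxx.
by rewrite norm_normalized// expr1n -normr_eq0 norm_normalized ?oner_eq0.
Qed.

Lemma gs_orthonormal_or_zero : orthonormal_or_zero gs.
Proof.
have h n : forall i, (i < n)%N -> '<gs n, gs i> = 0.
  elim/ltn_ind: n => n IH i ni.
  rewrite gsE innerZl innerBl inner_suml (bigD1 (Ordinal ni))//= big1 => [|j ji].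
    rewrite addr0 innerZl [X in _ - _ * X](_ : _ = (gs i != 0)%:R).
      by have [->|] := eqVneq (gs i) 0; rewrite ?inner0r ?mulr1 ?mul0r subrr mulr0.
    exact: normalized_unit_or0.
  rewrite innerZl; have [ij|ij|ij] := ltngtP j i.
  - by rewrite (innerC (gs j)) IH ?mulr0.
  - by rewrite IH ?mulr0.
  - by move: ji; rewrite -val_eqE /= ij eqxx.
move=> i j; have [ij|ji|->] := ltngtP i j; rewrite ?andFb.
- by rewrite innerC h.
- by rewrite h.
- by rewrite normalized_unit_or0.
Qed.

(** By construction [d m] is a combination of [gs 0], ..., [gs m], so its coefficients against later
    vectors vanish. *)
Lemma partial_proj_gs m n : (m < n)%N -> partial_proj gs n (d m) = d m.
Proof.
have dE : d m = partial_proj gs m (d m) + `|d m - partial_proj gs m (d m)| *: gs m.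
  rewrite gsE /normalized scalerA.
  have [/eqP|h] := eqVneq (d m - partial_proj gs m (d m)) 0.
    by rewrite subr_eq0 => /eqP <-; rewrite subrr normr0 mul0r scale0r addr0.
  by rewrite divff ?normr_eq0// scale1r addrC subrK.
move=> mn.
have h i : '<d m, gs i> *: gs i = if (i < m)%N then '<d m, gs i> *: gs i else
    if (i == m)%N then `|d m - partial_proj gs m (d m)| *: gs m else 0.
  case: ltnP => // mi; rewrite {1}dE innerDl inner_suml innerZl big1 => [|j _].
    rewrite add0r gs_orthonormal_or_zero eq_sym; case: eqP => [->|_] /=.
      by have [->|] := eqVneq (gs m) 0; rewrite ?scaler0 ?mulr1.
    by rewrite mulr0 scale0r.
  rewrite innerZl gs_orthonormal_or_zero; case: eqP => [ji|]; last by rewrite mulr0.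
  by move: (ltn_ord j); rewrite ji ltnNge mi.
rewrite [RHS]dE; move: (`|_|) h => c h.
rewrite /partial_proj -!(big_mkord predT (fun i => '<d m, gs i> *: gs i)).
rewrite (big_cat_nat (n := m))//=; last exact: ltnW.
congr (_ + _); rewrite big_ltn// h ltnn eqxx big_nat big1 ?addr0// => i /andP[mi _].
by rewrite h ltnNge (ltnW mi) /= gtn_eqF.
Qed.

Hypothesis dd : forall x (eps : R), 0 < eps -> exists n, `|x - d n| < eps.

(** Once [n > m] the projection fixes [d m], so the error at [x] equals the error at [x - d m],
    which Bessel bounds by the distance to the dense point. *)
Lemma gs_complete x : partial_proj gs n x @[n --> \oo] --> x.
Proof.
apply/cvgrPdist_lt => eps eps0; have [m xm] := dd x eps0.
exists m.+1 => // n /= mn.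
have -> : x - partial_proj gs n x = x - d m - partial_proj gs n (x - d m).
  by rewrite partial_projB partial_proj_gs// opprB addrA subrK.
by apply: le_lt_trans xm; apply: bessel; exact: gs_orthonormal_or_zero.
Qed.

End gram_schmidt.

(** [has_trace] applies to genuine bases only, so the zeros left by Gram-Schmidt are excluded
    through the index set; the padded system is kept for Parseval. *)
Lemma separable_orthonormal_basis (R : realType) (X : hilbertType R) : separable X ->
  exists e : nat -> X, [/\ orthonormal_or_zero e,
    forall x, partial_proj e n x @[n --> \oo] --> x &
    orthonormal_basis [set i | e i != 0] e].
Proof.
move=> /separable_dense_seq[d dd]; exists (gs d).
have go := gs_orthonormal_or_zero d; have gc := gs_complete dd.
split => //; split => [i j /= Si Sj|x]; first by rewrite go Si andbT.
have -> : (fun n => \sum_(i < n | (i : nat) \in [set i | gs d i != 0])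
    '<x, gs d i> *: gs d i) = fun n => partial_proj (gs d) n x; last exact: gc.
apply/funext => n; rewrite /partial_proj big_mkcond /=; apply: eq_bigr => i _.
case: ifPn => //; rewrite notin_setE => /= /negP; rewrite negbK => /eqP ->.
by rewrite scaler0.
Qed.

(** * Second moments of the noise and of independent sums *)

Section noise.
Context {R : realType} {Y : hilbertType R}.
Variable gamma : probability (borel Y) R.
Hypothesis sY : separable Y.
Hypothesis hg : gaussian_noise gamma.

(** Parseval and termwise integration turn the second moment into the trace of the covariance
    operator. *)
Lemma noise_second_moment : (\int[gamma]_x (`|x : Y| ^+ 2)%:E = 1)%E.
Proof.
have [e [eo ec eb]] := separable_orthonormal_basis sY.
case: hg => _ _ [U cU tU].
rewrite -(tU _ _ eb) -[in RHS]nneseries_esum; last first.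
  move=> i _; rewrite -cU; apply: integral_ge0 => x _.
  by rewrite lee_fin -expr2 sqr_ge0.
rewrite [RHS]eseries_mkcond.
under eq_integral => x _ do rewrite -(parseval_eseries eo ec).
rewrite integral_nneseries//; last 2 first.
- move=> n; apply/measurable_EFinP; apply: measurable_funX.
  by apply: continuous_borel_measurable; exact: inner_continuousl.
- by move=> n x _; rewrite lee_fin sqr_ge0.
apply: eq_eseriesr => i _; rewrite -cU.
case: ifPn => [//|]; rewrite negbK => /eqP ->.
by under eq_integral => x _ do rewrite inner0r expr0n; rewrite integral0.
Qed.

Lemma noise_mean0 (h : Y) : gamma.-integrable setT (fun x : borel Y => '<x, h>%:E) /\
  (\int[gamma]_x '<x, h>%:E = 0)%E.
Proof. by case: hg => _ /(_ h) [? ->] _; rewrite inner0l. Qed.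

(** In a trivial space the empty family is an orthonormal basis, and the trace would be 0 instead of
    1. The unit vector carries the bumps of the lower bound, and it lets real sums be treated as
    [Y]-valued ones. *)
Lemma noise_unit_vector : exists u : Y, `|u| = 1.
Proof.
case: (pselect (exists y : Y, y != 0)) => [[y y0]|].
  by exists (normalized y); exact: norm_normalized.
move=> /forallNP Y0; case: hg => _ _ [U _ /(_ set0 (fun=> 0))].
rewrite esum_set0 => tU.
suff /tU /eqP : orthonormal_basis set0 (fun=> 0 : Y).
  by rewrite eq_sym onee_eq0.
split => // x; have -> : x = 0 by apply: contrapT => /eqP /Y0.
under eq_fun do rewrite big1 ?scaler0//.
exact: cvg_cst.
Qed.

End noise.

(** The integral of a nonnegative function is a supremum over the nonnegative simple functions below
    it, and this set grows with the function. Risks can thus be compared before their integrands are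
    known to be measurable. *)
Lemma ge0_le_integral_nomeas d (T : measurableType d) (R : realType)
    (mu : {measure set T -> \bar R}) (f g : T -> \bar R) :
  (forall x, 0 <= f x)%E -> (forall x, f x <= g x)%E ->
  (\int[mu]_x f x <= \int[mu]_x g x)%E.
Proof.
move=> f0 fg; have g0 x : (0 <= g x)%E by exact: le_trans (fg x).
have rT (h : T -> \bar R) : h \_ setT = h by apply/funext => x; rewrite patchE in_setT.
rewrite !ge0_integralE// !rT.
apply: ge_ereal_sup => _ [h /= hf <-]; apply: ereal_sup_ubound; exists h => //= x.
exact: le_trans (fg x).
Qed.

Lemma integral_cst_probability d (T : measurableType d) (R : realType)
    (P : probability T R) (r : \bar R) : (\int[P]_x r = r)%E.
Proof.
rewrite integral_cst//; have /= -> := @probability_setT _ _ _ P.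
by rewrite mule1.
Qed.

Section iid_second_moment.
Context {R : realType} {Y : hilbertType R} (sY : separable Y).
Context d {T : measurableType d} (P : probability T R).

Lemma measurable_sum_tnth n (g : nat -> T -> borel Y) :
  (forall i, measurable_fun setT (g i)) ->
  measurable_fun setT ((fun t : n.-tuple T =>
     \sum_(i < n) (g i (tnth t i) : Y)) : _ -> borel Y).
Proof.
move=> mg; apply: (@borel_measurable_sum _ _ _ _ _ _ (fun (i : 'I_n) t => g i (tnth t i))) => // i.
by apply: measurableT_comp => //; exact: measurable_tnth.
Qed.

Lemma sum_tnth_cons n (g : nat -> T -> borel Y) (z : T * n.-tuple T) :
  \sum_(i < n.+1) (g i (tnth (tuple_cons z) i) : Y) =
  (g 0%N z.1 : Y) + \sum_(i < n) (g i.+1 (tnth z.2 i) : Y).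
Proof. by rewrite big_ord_recl; congr (_ + _); apply: eq_bigr => i _; rewrite /= tnthS. Qed.

Lemma ge0_integral_iid_cons n (f : n.+1.-tuple T -> \bar R) :
  measurable_fun setT f -> (forall t, 0 <= f t)%E ->
  (\int[iid_law P n.+1]_t f t =
   \int[iid_law P n]_t \int[P]_x f (tuple_cons (x, t)))%E.
Proof.
move=> mf f0; rewrite [LHS]ge0_integral_pushforward//=.
rewrite fubini_tonelli2//.
by apply: measurableT_comp => //; exact: measurable_tuple_cons.
Qed.

Lemma integral_sqr_normD (g : T -> borel Y) (V : R) (s : Y) :
  measurable_fun setT g ->
  (\int[P]_t (`|g t : Y| ^+ 2)%:E <= V%:E)%E ->
  P.-integrable setT (fun t => '<g t : Y, s>%:E) ->
  (\int[P]_t '<g t : Y, s>%:E = 0)%E ->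
  (\int[P]_t (`|(g t : Y) + s| ^+ 2)%:E <= V%:E + (`|s| ^+ 2)%:E)%E.
Proof.
move=> mg gV ig g0.
have i1 : P.-integrable setT (fun t => (`|g t : Y| ^+ 2)%:E).
  apply/integrableP; split.
    by apply/measurable_EFinP/measurable_funX; exact: borel_measurable_norm.
  under eq_integral do rewrite gee0_abs ?lee_fin ?sqr_ge0//.
  exact: le_lt_trans gV (ltry _).
have i2 : P.-integrable setT (fun t => 2%:E * '<g t : Y, s>%:E)%E.
  exact: integrableZl.
under eq_integral do rewrite sqr_normD !EFinD (EFinM 2).
rewrite integralD//=; last 2 first.
- by apply: (@integrableD _ _ _ P _ measurableT).
- exact: finite_measure_integrable_cst.
rewrite integralD// integralZl// g0 mule0 adde0 integral_cst_probability.
exact: leeD2r.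
Qed.

(** Additivity of variances, by induction: with the remaining coordinates frozen and their sum equal
    to [s], the cross term [2 * '<g, s>] integrates to 0 in the first coordinate. The summand may
    depend on the index, so that the noise can be summed over the design points at one center. *)
Lemma iid_second_moment n (g : nat -> T -> borel Y) (V : R) :
  (forall i, measurable_fun setT (g i)) ->
  (forall i, (\int[P]_t (`|g i t : Y| ^+ 2)%:E <= V%:E)%E) ->
  (forall i h, P.-integrable setT (fun t => '<g i t : Y, h>%:E) /\
     (\int[P]_t '<g i t : Y, h>%:E = 0)%E) ->
  (\int[iid_law P n]_t (`|\sum_(i < n) (g i (tnth t i) : Y)| ^+ 2)%:E
     <= (n%:R * V)%:E)%E.
Proof.
elim: n g => [|n IH] g mg gV g0.
  under eq_integral do rewrite big_ord0 normr0 expr0n.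
  by rewrite integral0 mul0r.
rewrite ge0_integral_iid_cons; last 2 first.
- apply/measurable_EFinP/measurable_funX/borel_measurable_norm.
  exact: measurable_sum_tnth.
- by move=> t; rewrite lee_fin sqr_ge0.
apply: (@le_trans _ _ (\int[iid_law P n]_t
   (V%:E + (`|\sum_(i < n) (g i.+1 (tnth t i) : Y)| ^+ 2)%:E))%E).
  apply: ge0_le_integral_nomeas => t.
    by apply: integral_ge0 => x _; rewrite lee_fin sqr_ge0.
  under eq_integral do rewrite sum_tnth_cons/=.
  by apply: integral_sqr_normD => //; case: (g0 0%N (\sum_(i < n) (g i.+1 (tnth t i) : Y))).
have V0 : 0 <= V.
  rewrite -lee_fin; apply: le_trans (gV 0%N).
  by apply: integral_ge0 => x _; rewrite lee_fin sqr_ge0.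
rewrite ge0_integralD//; last first.
  apply/measurable_EFinP/measurable_funX/borel_measurable_norm.
  exact: (@measurable_sum_tnth _ (fun i => g i.+1)).
rewrite integral_cst_probability -[n.+1]add1n natrD mulrDl mul1r EFinD.
by apply: leeD2l; exact: (IH (fun i => g i.+1)).
Qed.

End iid_second_moment.

(** * Smooth bumps and cylindrical functions in the C^{k,alpha} ball *)

Section bump.
Context {R : realType}.
Implicit Types (p q : {poly R}) (s t u : R).

(** The three bounds are carried together through the Horner step [p * 'X + c%:P]: by the product
    rule, each bound for the new polynomial is a combination of those for [p]. *)
Lemma poly_taylor_bound p : exists2 K : R, 0 <= K & forall s t,
  0 <= s <= 1 -> 0 <= t <= 1 ->
  [/\ `|p.[t]| <= K, `|p.[t] - p.[s]| <= K * `|t - s| &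
      `|p.[t] - p.[s] - p^`().[s] * (t - s)| <= K * (t - s) ^+ 2].
Proof.
elim/poly_ind: p => [|p c [K K0 IH]].
  exists 0 => // s t _ _; rewrite deriv0 !horner0 !(mul0r, subr0) normr0.
  by split.
exists (2 * K + `|c|); first by rewrite addr_ge0// mulr_ge0.
move=> s t s01 t01; have [b1 b2 b3] := IH s t s01 t01.
have ns : `|s| <= 1 by case/andP: s01 => ? ?; rewrite ger0_norm.
have nt : `|t| <= 1 by case/andP: t01 => ? ?; rewrite ger0_norm.
have hE x : (p * 'X + c%:P).[x] = p.[x] * x + c by rewrite !hornerE.
have dE x : (p * 'X + c%:P)^`().[x] = p^`().[x] * x + p.[x].
  by rewrite derivD derivM derivX derivC !hornerE.
rewrite !hE dE; have c0 := normr_ge0 c; have d0 := normr_ge0 (t - s).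
have bt : `|p.[t]| * `|t| <= K.
  by rewrite (le_trans _ b1)// ler_piMr.
split.
- apply: le_trans (ler_normD _ _) _; rewrite normrM lerD2r.
  by rewrite (le_trans bt)//; lra.
- have -> : p.[t] * t + c - (p.[s] * s + c) = p.[t] * (t - s) + (p.[t] - p.[s]) * s by ring.
  apply: le_trans (ler_normD _ _) _; rewrite !normrM.
  have h1 : `|p.[t]| * `|t - s| <= K * `|t - s| by rewrite ler_wpM2r.
  have h2 : `|p.[t] - p.[s]| * `|s| <= K * `|t - s|.
    by rewrite (le_trans _ b2)// ler_piMr.
  have h3 : 0 <= `|c| * `|t - s| by rewrite mulr_ge0.
  lra.
- have -> : p.[t] * t + c - (p.[s] * s + c) - (p^`().[s] * s + p.[s]) * (t - s) =
    (p.[t] - p.[s] - p^`().[s] * (t - s)) * s + (p.[t] - p.[s]) * (t - s) by ring.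
  apply: le_trans (ler_normD _ _) _; rewrite !normrM.
  have h1 : `|p.[t] - p.[s] - p^`().[s] * (t - s)| * `|s| <= K * (t - s) ^+ 2.
    by rewrite (le_trans _ b3)// ler_piMr.
  have h2 : `|p.[t] - p.[s]| * `|t - s| <= K * (t - s) ^+ 2.
    by rewrite -[(t - s) ^+ 2]real_normK ?num_real// expr2 mulrA ler_wpM2r.
  have h3 : 0 <= `|c| * (t - s) ^+ 2 by rewrite mulr_ge0// sqr_ge0.
  lra.
Qed.

Definition clamp01 t : R := Num.max 0 (Num.min t 1).

Definition bump_poly k : {poly R} := ('X * (1 - 'X)) ^+ k.+1.

(** The j-th derivative of the bump (t(1-t))^(k+1) on [0, 1], extended by 0. The power k+1 makes all
    derivatives up to order k vanish at both endpoints, so clamping the argument is extension by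
    zero for [j <= k]. *)
Definition hbump k j t : R := (bump_poly k)^`(j).[clamp01 t].

Lemma clamp01_itv t : 0 <= clamp01 t <= 1.
Proof. by rewrite /clamp01 le_max lexx ge_max ler01 ge_min lexx orbT. Qed.

Variant clamp01_spec t : R -> Type :=
| Clamp01Neg of t <= 0 : clamp01_spec t 0
| Clamp01In of 0 <= t <= 1 : clamp01_spec t t
| Clamp01Pos of 1 <= t : clamp01_spec t 1.

Lemma clamp01P t : clamp01_spec t (clamp01 t).
Proof.
rewrite /clamp01; have [t0|t0] := leP t 0.
  rewrite min_l ?(le_trans t0)// max_l//; exact: Clamp01Neg.
have [t1|t1] := leP t 1.
  by rewrite max_r 1?ltW//; apply: Clamp01In; rewrite ltW.
by rewrite max_r//; apply: Clamp01Pos; exact: ltW.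
Qed.

Lemma clamp01_lipschitz s t : `|clamp01 t - clamp01 s| <= `|t - s|.
Proof.
by case: clamp01P => ht; case: clamp01P => hs; rewrite ler_norml; apply/andP;
  case: (lerP 0 (t - s)) => h; rewrite ?(ger0_norm h) ?(ltr0_norm h); split; lra.
Qed.

Lemma derivn_exp_mul (a r : {poly R}) j n : (j <= n)%N ->
  exists r', (a ^+ n * r)^`(j) = a ^+ (n - j) * r'.
Proof.
elim: j => [|j IH] jn; first by exists r; rewrite derivn0 subn0.
have [r' rE] := IH (ltnW jn); rewrite derivnS rE.
have -> : (n - j = (n - j.+1).+1)%N by rewrite subnSK.
rewrite derivM deriv_exp exprS.
by exists (a^`() *+ (n - j.+1).+1 * r' + a * r'^`()); rewrite /=; ring.
Qed.

Lemma bump_polyn_root k j t : (j <= k)%N -> t = 0 \/ t = 1 -> (bump_poly k)^`(j).[t] = 0.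
Proof.
move=> jk t01.
have [r' rE] := @derivn_exp_mul ('X * (1 - 'X)) 1 j k.+1 (leqW jk).
rewrite mulr1 -/(bump_poly k) in rE.
rewrite rE subSn// exprS !hornerE.
by case: t01 => ->; rewrite ?subrr ?mul0r ?mulr0 ?mul0r.
Qed.

Lemma bump_eq0 k j t : (j <= k)%N -> ~~ (0 < t < 1) -> hbump k j t = 0.
Proof.
move=> jk nt; apply: bump_polyn_root => //.
case: clamp01P => h; [by left| |by right].
have [->|t0] := eqVneq t 0; first by left.
have [->|t1] := eqVneq t 1; first by right.
by case/andP: h => h0 h1; move: nt; rewrite !lt_neqAle eq_sym t0 t1 h0 h1.
Qed.

(** On the middle half of [0, 1] the product t(1-t) is least at the ends, where it equals 3/16. *)
Lemma bump0_ge k t : 1 / 4 <= t <= 3 / 4 -> (3 / 16) ^+ k.+1 <= hbump k 0 t.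
Proof.
move=> /andP[t1 t2]; rewrite /hbump /clamp01 min_l ?max_r; try lra.
rewrite derivn0 horner_exp !hornerE lerXn2r ?nnegrE; try nra.
Qed.

(** [K] depends on [k] alone, as it must: its power [K ^+ n] ends up in the exponent of the lower
    bound. The Lipschitz bound at order [k] will control the Hölder seminorm, the Taylor bound the
    differentiability. *)
Lemma bump_bounds k : exists2 K : R, 1 <= K & forall j t u, (j <= k)%N ->
  [/\ `|hbump k j t| <= K, `|hbump k j (t + u) - hbump k j t| <= K * `|u| &
      (j < k)%N -> `|hbump k j (t + u) - hbump k j t - hbump k j.+1 t * u| <= K * u ^+ 2].
Proof.
have H n : exists2 K : R, 0 <= K & forall j, (j <= n)%N -> forall s t,
  0 <= s <= 1 -> 0 <= t <= 1 -> let p := (bump_poly k)^`(j) in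
  [/\ `|p.[t]| <= K, `|p.[t] - p.[s]| <= K * `|t - s| &
      `|p.[t] - p.[s] - p^`().[s] * (t - s)| <= K * (t - s) ^+ 2].
  elim: n => [|m [K K0 IH]].
    have [K K0 hK] := poly_taylor_bound (bump_poly k)^`(0).
    by exists K => // j; rewrite leqn0 => /eqP ->.
  have [K' K'0 hK] := poly_taylor_bound (bump_poly k)^`(m.+1).
  exists (K + K'); first exact: addr_ge0.
  have h a : 0 <= a -> K * a <= (K + K') * a /\ K' * a <= (K + K') * a.
    by move=> a0; rewrite !ler_wpM2r// ?lerDl ?lerDr.
  move=> j; rewrite leq_eqVlt => /predU1P[->|js] s t s01 t01 p.
    have [b1 b2 b3] := hK s t s01 t01; split.
    - by rewrite (le_trans b1)// lerDr.
    - by apply: le_trans b2 _; case: (h _ (normr_ge0 (t - s))).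
    - by apply: le_trans b3 _; case: (h _ (sqr_ge0 (t - s))).
  have [b1 b2 b3] := IH j js s t s01 t01; split.
  - by rewrite (le_trans b1)// lerDl.
  - by apply: le_trans b2 _; case: (h _ (normr_ge0 (t - s))).
  - by apply: le_trans b3 _; case: (h _ (sqr_ge0 (t - s))).
have [K K0 hK] := H k.
(* The Taylor error is split in two parts of size at most [K * u ^+ 2]; the added 1 gives
   [1 <= K]. *)
exists (2 * K + 1) => [|j t u jk]; first lra.
have cl := clamp01_lipschitz t (t + u); rewrite addrAC subrr add0r in cl.
have [b1 b2 b3] := hK j jk _ _ (clamp01_itv t) (clamp01_itv (t + u)).
have [b0 _ _] := hK j jk _ _ (clamp01_itv t) (clamp01_itv t).
have u0 := normr_ge0 u.
split.
- rewrite /hbump; lra.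
- rewrite /hbump (le_trans b2)//; apply: (@le_trans _ _ (K * `|u|)).
    by rewrite ler_wpM2l.
  by rewrite ler_wpM2r//; lra.
move=> jk'; rewrite /hbump derivnS.
set p := (bump_poly k)^`(j) in b3 *; set c := clamp01 t; set c' := clamp01 (t + u).
have -> : p.[c'] - p.[c] - p^`().[c] * u =
  (p.[c'] - p.[c] - p^`().[c] * (c' - c)) + p^`().[c] * (c' - c - u) by ring.
apply: le_trans (ler_normD _ _) _.
have u2 : `|u| ^+ 2 = u ^+ 2 by rewrite real_normK// num_real.
have h1 : `|p.[c'] - p.[c] - p^`().[c] * (c' - c)| <= K * u ^+ 2.
  apply: le_trans b3 _; rewrite ler_wpM2l// -u2 -[(_ - _) ^+ 2]real_normK ?num_real//.
  by rewrite lerXn2r ?nnegrE.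
suff h2 : `|p^`().[c] * (c' - c - u)| <= K * u ^+ 2 by rewrite (le_trans (lerD h1 h2))//; nra.
(* The correction vanishes unless [t] lies in [0, 1] and [t + u] does not; then
   [p^`()] is small because it vanishes at the endpoint that was crossed. *)
have sq (e : R) : `|c - e| <= `|u| -> `|c' - c - u| <= `|u| -> e = 0 \/ e = 1 ->
    `|p^`().[c] * (c' - c - u)| <= K * u ^+ 2.
  move=> ce cu e01.
  have e01' : 0 <= e <= 1 by case: e01 => ->; rewrite !lexx ler01.
  have [_ h _] := hK j.+1 jk' _ _ e01' (clamp01_itv t).
  rewrite derivnS (_ : _.[e] = 0) ?subr0 in h; last first.
    by rewrite -derivnS bump_polyn_root.
  rewrite normrM -u2 expr2 mulrA ler_pM//.
  by apply: le_trans h _; rewrite ler_wpM2l.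
rewrite /c in sq *; case: (clamp01P t) sq => [ht|ht|ht] sq.
- have -> : p^`().[0] = 0 by rewrite /p -derivnS; apply: bump_polyn_root => //; left.
  by rewrite mul0r normr0 mulr_ge0// sqr_ge0.
- move: sq; rewrite /c'; case: (clamp01P (t + u)) => [hu|hu|hu] sq.
  + apply: (sq 0); last by left.
    * by rewrite ler_norml; case: (ler0P u) => ?; apply/andP; split; lra.
    * by rewrite ler_norml; case: (ler0P u) => ?; apply/andP; split; lra.
  + have -> : t + u - t - u = 0 by ring.
    by rewrite mulr0 normr0 mulr_ge0// sqr_ge0.
  + apply: (sq 1); last by right.
    * by rewrite ler_norml; case: (ler0P u) => ?; apply/andP; split; lra.
    * by rewrite ler_norml; case: (ler0P u) => ?; apply/andP; split; lra.
- have -> : p^`().[1] = 0 by rewrite /p -derivnS; apply: bump_polyn_root => //; right.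
  by rewrite mul0r normr0 mulr_ge0// sqr_ge0.
Qed.

End bump.

Lemma continuous_sumr (R : realType) (T : topologicalType) I (s : seq I)
    (f : I -> T -> R) :
  (forall i, continuous (f i)) -> continuous (fun v => \sum_(i <- s) f i v).
Proof.
move=> cf; elim: s => [|i s IH] v.
  by under eq_fun do rewrite big_nil; exact: cvg_cst.
under eq_fun do rewrite big_cons.
by apply: cvgD; [exact: cf|exact: IH].
Qed.

(** * Derivatives of functions of finitely many inner products *)

Section cylinder.
Context {R : realType} {X Y : hilbertType R}.
Variables (n : nat) (e : 'I_n -> X).

Definition inc (c : 'I_n -> nat) (i : 'I_n) : 'I_n -> nat :=
  fun l => (c l + (l == i))%N.

Definition total_order (c : 'I_n -> nat) : nat := (\sum_i c i)%N.

(* If [p c] is the partial derivative of multi-index [c] at a point, then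
   [tensor j p c] is the [j]-th derivative of the partial derivative [p c]. *)
Fixpoint tensor j (p : ('I_n -> nat) -> R) (c : 'I_n -> nat) : ('I_j -> X) -> R :=
  if j is j'.+1 return ('I_j -> X) -> R then
    fun v => \sum_i '<v ord0, e i> * tensor p (inc c i) (fun l : 'I_j' => v (lift ord0 l))
  else fun _ => p c.

Lemma incC c i l : inc (inc c i) l = inc (inc c l) i.
Proof. by apply/funext => m; rewrite /inc addnAC. Qed.

Lemma total_order_inc c i : total_order (inc c i) = (total_order c).+1.
Proof.
rewrite /total_order /inc big_split /= -addn1; congr addn.
by rewrite (bigD1 i)//= eqxx big1 ?addn0// => l /negbTE ->.
Qed.

Lemma tensor_inc j p c i (v : 'I_j -> X) :
  tensor p (inc c i) v = tensor (fun c' => p (inc c' i)) c v.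
Proof.
by elim: j c v => //= j IH c v; apply: eq_bigr => l _; rewrite incC IH.
Qed.

Lemma tensorB j p q c (v : 'I_j -> X) :
  tensor p c v - tensor q c v = tensor (fun c' => p c' - q c') c v.
Proof.
elim: j c v => //= j IH c v; rewrite -sumrB; apply: eq_bigr => l _.
by rewrite -mulrBr IH.
Qed.

Lemma tensor_suml j (a : 'I_n -> R) (p : 'I_n -> ('I_n -> nat) -> R) c (v : 'I_j -> X) :
  \sum_i a i * tensor (p i) c v = tensor (fun c' => \sum_i a i * p i c') c v.
Proof.
elim: j c v => //= j IH c v.
under eq_bigr do rewrite mulr_sumr.
rewrite exchange_big /=; apply: eq_bigr => l _; rewrite -IH mulr_sumr.
by apply: eq_bigr => i _; rewrite mulrCA.
Qed.

(** Contracting the first slot replaces [p] by its directional derivative along [h]. Together with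
    [tensorB] this writes the Fréchet remainder as the tensor of the scalar Taylor remainders. *)
Lemma tensor_vcons j p c (h : X) (v : 'I_j -> X) :
  tensor p c (vcons h v) = tensor (fun c' => \sum_i '<h, e i> * p (inc c' i)) c v.
Proof.
rewrite -tensor_suml /=; apply: eq_bigr => i _.
rewrite {1}/vcons unlift_none -tensor_inc; congr (_ * tensor _ _ _).
by apply/funext => l; rewrite /vcons liftK.
Qed.

Lemma tensor_bound j p c (v : 'I_j -> X) (eta H : R) : (forall i, `|e i| <= eta) ->
  (forall i, `|v i| <= 1) -> 0 <= H ->
  (forall c', total_order c' = (total_order c + j)%N -> `|p c'| <= H) ->
  `|tensor p c v| <= (n%:R * eta) ^+ j * H.
Proof.
move=> he hv H0; elim: j c v hv => /= [|j IH] c v hv hp.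
  by rewrite mul1r hp// addn0.
apply: le_trans (ler_norm_sum _ _ _) _.
apply: (@le_trans _ _ (\sum_(i < n) eta * ((n%:R * eta) ^+ j * H))); last first.
  by rewrite big_const_ord iter_addr addr0 exprS -[leLHS]mulr_natl !mulrA.
apply: ler_sum => i _; rewrite normrM ler_pM//.
  apply: le_trans (cauchy_schwarz _ _) _.
  by rewrite (le_trans _ (he i))// ler_piMl.
by apply: IH => // c'; rewrite total_order_inc addSnnS; exact: hp.
Qed.

Lemma tensor_multilinear j p c (v : 'I_j -> X) i (a : R) (x y : X) :
  tensor p c [eta v with i |-> a *: x + y] =
  a * tensor p c [eta v with i |-> x] + tensor p c [eta v with i |-> y].
Proof.
elim: j c v i => [c v []//|j IH c v i] /=.
case: (unliftP ord0 i) => [l ->|->].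
  have vE (z : X) : (fun m : 'I_j => if lift ord0 m == lift ord0 l then z else v (lift ord0 m))
     = [eta (fun m => v (lift ord0 m)) with l |-> z].
    by apply/funext => m /=; rewrite (inj_eq lift_inj).
  rewrite mulr_sumr -big_split /=; apply: eq_bigr => m _.
  by rewrite !vE IH mulrDr mulrCA.
rewrite mulr_sumr -big_split /=; apply: eq_bigr => m _.
by rewrite innerDl innerZl mulrDl mulrA.
Qed.

(** The reindexing [f] strengthens the induction: the recursion drops a slot, while continuity
    always refers to the space of all [m] slots. *)
Lemma tensor_continuous j m p c (f : 'I_j -> 'I_m) :
  continuous ((fun v => tensor p c (v \o f)) : {ptws 'I_m -> X} -> R).
Proof.
elim: j c f => [|j IH] c f.
  exact: (@cst_continuous {ptws 'I_m -> X} R (p c)).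
apply: (@continuous_sumr _ _ _ _ (fun i (v : {ptws 'I_m -> X}) =>
  '<v (f ord0), e i> * tensor p (inc c i) (v \o (f \o lift ord0)))) => i v.
have h1 : '<(w : {ptws 'I_m -> X}) (f ord0), e i> @[w --> v] --> '<v (f ord0), e i>.
  apply: (@continuous_comp _ _ _ (fun w : {ptws 'I_m -> X} => w (f ord0)) (fun x => '<x, e i>)).
    exact: (@proj_continuous _ (fun=> X) (f ord0)).
  exact: inner_continuousl.
have h2 := IH (inc c i) (f \o lift ord0) v.
exact: (@cvgM _ _ (nbhs v) _ _ _ _ _ h1 h2).
Qed.

End cylinder.

Section opnorm.
Context {R : realType} {X Y : hilbertType R}.

Lemma opnorm_le j (T : ('I_j -> X) -> Y) (K : R) :
  (forall v, (forall i, `|v i| <= 1) -> `|T v| <= K) -> (opnorm T <= K%:E)%E.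
Proof. by move=> h; apply: ge_ereal_sup => _ [v hv <-]; rewrite lee_fin h. Qed.

Lemma opnorm_ge0 j (T : ('I_j -> X) -> Y) : (0 <= opnorm T)%E.
Proof.
apply: (@le_trans _ _ (`|T (fun=> 0)|%:E)); first by rewrite lee_fin.
by apply: ereal_sup_ubound; exists (fun=> 0) => // i; rewrite normr0.
Qed.

End opnorm.

Section cylinder_ball.
Context {R : realType} {X Y : hilbertType R}.
Variables (n k : nat) (e : 'I_n -> X) (u : Y) (P : ('I_n -> nat) -> X -> R).
Variables (alpha eta H H' M : R).
Hypotheses (u1 : `|u| = 1) (he : forall i, `|e i| <= eta) (alpha0 : 0 < alpha).
Hypotheses (H0 : 0 <= H) (H'0 : 0 <= H') (M0 : 0 <= M).
Hypothesis Pbound : forall c x, (total_order c <= k)%N -> `|P c x| <= H.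
Hypothesis Pholder : forall c x y, (total_order c <= k)%N ->
  `|P c x - P c y| <= H' * (`|x - y| `^ alpha).
Hypothesis Pderive : forall c x h, (total_order c < k)%N ->
  `|P c (x + h) - P c x - \sum_i '<h, e i> * P (inc c i) x| <= M * `|h| ^+ 2.

Let c0 : 'I_n -> nat := fun=> 0%N.
Let c0E : total_order c0 = 0%N.
Proof. by rewrite /total_order big1. Qed.

Definition cylinder_derivative j (x : X) (v : 'I_j -> X) : Y :=
  tensor e (P ^~ x) c0 v *: u.

Lemma eta_ge0 : (0 < n)%N -> 0 <= eta.
Proof. by move=> n0; exact: le_trans (normr_ge0 _) (he (Ordinal n0)). Qed.

Lemma natM_ge0 : 0 <= n%:R * eta.
Proof.
by have [->|n0] := posnP n; rewrite ?mul0r// mulr_ge0// eta_ge0.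
Qed.

Lemma cylinder_frechet :
  frechet_derivatives (fun x => P c0 x *: u) k cylinder_derivative.
Proof.
split => [x v //|j x _|j jk].
  split => [v|v i a y z]; last first.
    by rewrite /cylinder_derivative tensor_multilinear scalerDl scalerA.
  apply: (@continuous_comp _ _ _ (fun v : {ptws 'I_j -> X} => tensor e (P ^~ x) c0 v)
      (fun t : R => t *: u)).
    exact: (@tensor_continuous _ _ _ _ _ _ _ _ id).
  exact: scalel_continuous.
move=> x eps eps0.
have C0 : 0 < (n%:R * eta) ^+ j * M + 1.
  by rewrite ltr_wpDl// mulr_ge0// exprn_ge0// natM_ge0.
near=> h.
apply: opnorm_le => v hv.
rewrite /cylinder_derivative -!scalerBl normrZ u1 mulr1 tensor_vcons !tensorB.
apply: (@le_trans _ _ ((n%:R * eta) ^+ j * (M * `|h| ^+ 2))).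
  apply: tensor_bound => // [|c cj]; first by rewrite mulr_ge0// exprn_ge0.
  by apply: Pderive; rewrite cj c0E.
rewrite mulrA expr2 mulrA ler_wpM2r//.
apply: (@le_trans _ _ (((n%:R * eta) ^+ j * M + 1) * `|h|)).
  by rewrite ler_wpM2r// lerDl.
rewrite mulrC -ler_pdivlMr//; near: h.
by apply: (cvgr0_norm_le id (@cvg_id _ _)); exact: divr_gt0.
Unshelve. all: by end_near. Qed.

(** Each derivative of order j costs [(n%:R * eta) ^+ j]; since [1 <= n%:R * eta], the power [k]
    dominates them all. *)
Lemma cylinder_C_ball (B : R) : 1 <= n%:R * eta ->
  (k.+1%:R * H + H') * (n%:R * eta) ^+ k <= B ->
  C_ball k alpha B (fun x => P c0 x *: u).
Proof.
move=> ne1 hB; exists cylinder_derivative; first exact: cylinder_frechet.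
rewrite /C_norm.
apply: (@le_trans _ _ ((\sum_(j < k.+1) (H * (n%:R * eta) ^+ k)%:E) +
   (H' * (n%:R * eta) ^+ k)%:E)%E); last first.
  rewrite sumEFin -EFinD lee_fin (le_trans _ hB)//.
  rewrite big_const_ord iter_addr addr0 -[X in X + _]mulr_natl le_eqVlt; apply/orP; left.
  by apply/eqP; ring.
apply: leeD.
  apply: lee_sum => j _; apply: ge_ereal_sup => _ [x _ <-].
  apply: opnorm_le => v hv; rewrite normrZ u1 mulr1.
  have jk : (j <= k)%N by rewrite -ltnS.
  apply: (@le_trans _ _ ((n%:R * eta) ^+ j * H)).
    by apply: tensor_bound => // c cj; apply: Pbound; rewrite cj c0E.
  by rewrite mulrC ler_wpM2l// ler_weXn2l.
apply: ge_ereal_sup => _ [[x y] /= xy <-].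
have a0 : 0 < `|x - y| `^ alpha by rewrite powR_gt0// normr_gt0 subr_eq0.
rewrite lee_pdivrMr// -EFinM.
apply: opnorm_le => v hv; rewrite -scalerBl normrZ u1 mulr1 tensorB mulrAC mulrC.
apply: tensor_bound => // [|c cj]; first by rewrite mulr_ge0// ltW.
by apply: Pholder; rewrite cj c0E.
Qed.

End cylinder_ball.

(** * Bumps as products, and sums of bumps over disjoint cells *)

Section products.
Context {R : realType} {I : eqType}.
Variables (a a' b : I -> R) (K tau : R).
Hypotheses (K1 : 1 <= K) (tau0 : 0 <= tau).
Hypotheses (ha : forall i, `|a i| <= K) (ha' : forall i, `|a' i| <= K).
Hypothesis haa' : forall i, `|a' i - a i| <= K * tau.

Let K0 : 0 <= K. Proof. exact: le_trans K1. Qed.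

Lemma norm_prod_le (s : seq I) (f : I -> R) : (forall i, `|f i| <= K) ->
  `|\prod_(i <- s) f i| <= K ^+ size s.
Proof.
move=> hf; elim: s => [|i s IH]; first by rewrite big_nil normr1.
by rewrite big_cons normrM exprS ler_pM.
Qed.

Lemma prod_lipschitz (s : seq I) :
  `|\prod_(i <- s) a' i - \prod_(i <- s) a i| <= (size s)%:R * K ^+ size s * tau.
Proof.
elim: s => [|i s IH]; first by rewrite !big_nil subrr normr0 !mul0r.
rewrite !big_cons.
have -> : a' i * \prod_(j <- s) a' j - a i * \prod_(j <- s) a j =
  a' i * (\prod_(j <- s) a' j - \prod_(j <- s) a j) + (a' i - a i) * \prod_(j <- s) a j.
  by ring.
apply: le_trans (ler_normD _ _) _; rewrite !normrM.
have h1 := ler_pM (normr_ge0 _) (normr_ge0 _) (ha' i) IH.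
have h2 := ler_pM (normr_ge0 _) (normr_ge0 _) (haa' i) (norm_prod_le s ha).
apply: le_trans (lerD h1 h2) _; rewrite /= exprS -natr1 le_eqVlt; apply/orP; left.
by apply/eqP; ring.
Qed.

Hypothesis hb : forall i, `|b i| <= K * tau.
Hypothesis haba' : forall i, `|a' i - a i - b i| <= K * tau ^+ 2.

(** The differential of the product by the Leibniz rule, [b i] being the first-order increment of
    the factor [a i]. *)
Definition prod_derivative (s : seq I) : R :=
  \sum_(i <- s) \prod_(l <- s) (if l == i then b l else a l).

Lemma prod_derivative_cons i s : i \notin s ->
  prod_derivative (i :: s) = b i * \prod_(l <- s) a l + a i * prod_derivative s.
Proof.
move=> nis; rewrite /prod_derivative big_cons big_cons eqxx; congr (_ * _ + _).
  rewrite big_seq [RHS]big_seq; apply: eq_bigr => l ls.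
  by case: eqP => // li; rewrite li (negbTE nis) in ls.
rewrite mulr_sumr big_seq [RHS]big_seq; apply: eq_bigr => l ls.
by rewrite big_cons; case: eqP => // li; rewrite li ls in nis.
Qed.

Lemma prod_derivative_le s : uniq s ->
  `|prod_derivative s| <= (size s)%:R * K ^+ size s * tau.
Proof.
elim: s => [_|i s IH /= /andP[nis us]].
  by rewrite /prod_derivative big_nil normr0 !mul0r.
rewrite prod_derivative_cons//; apply: le_trans (ler_normD _ _) _; rewrite !normrM.
have h1 := ler_pM (normr_ge0 _) (normr_ge0 _) (ha i) (IH us).
have h2 := ler_pM (normr_ge0 _) (normr_ge0 _) (hb i) (norm_prod_le s ha).
apply: le_trans (lerD h2 h1) _; rewrite exprS -natr1 le_eqVlt; apply/orP; left.
by apply/eqP; ring.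
Qed.

Lemma prod_taylor (s : seq I) : uniq s ->
  `|\prod_(i <- s) a' i - \prod_(i <- s) a i - prod_derivative s| <=
  (size s)%:R ^+ 2 * K ^+ size s * tau ^+ 2.
Proof.
elim: s => [_|i s IH /= /andP[nis us]].
  by rewrite !big_nil /prod_derivative big_nil subrr subr0 normr0 expr0n /= !mul0r.
rewrite prod_derivative_cons// !big_cons.
set p' := \prod_(j <- s) a' j in IH *; set p := \prod_(j <- s) a j in IH *.
set D := prod_derivative s in IH *.
(* Every term on the right is of second order: the remainder of the tail, the increment of [a i]
   times the differential of the tail, and the remainder of [a i]. *)
have -> : a' i * p' - a i * p - (b i * p + a i * D) =
   a' i * (p' - p - D) + (a' i - a i) * D + (a' i - a i - b i) * p by ring.
apply: le_trans (ler_normD _ _) _.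
apply: (le_trans (lerD (ler_normD _ _) (lexx _))); rewrite !normrM.
have h1 := ler_pM (normr_ge0 _) (normr_ge0 _) (ha' i) (IH us).
have h2 := ler_pM (normr_ge0 _) (normr_ge0 _) (haa' i) (prod_derivative_le us).
have h3 := ler_pM (normr_ge0 _) (normr_ge0 _) (haba' i) (norm_prod_le s ha).
apply: le_trans (lerD (lerD h1 h2) h3) _; rewrite (exprS K) -natr1.
set m : R := (size s)%:R; set q := K ^+ size s.
have m0 : 0 <= m by rewrite /m.
have q0 : 0 <= K * q * tau ^+ 2 * m by rewrite !mulr_ge0 ?exprn_ge0.
lra.
Qed.

End products.

Section cells.
Context {R : realType} {X Y : hilbertType R}.
Variables (n k N : nat) (e : 'I_n -> X) (sh : R) (theta : {ffun 'I_n -> 'I_N} -> R).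
Variables (alpha eta A K : R) (u : Y).
Hypotheses (u1 : `|u| = 1) (alpha0 : 0 < alpha) (alpha1 : alpha <= 1).
Hypotheses (n0 : (0 < n)%N) (eta1 : 1 <= eta) (he : forall i, `|e i| <= eta).
Hypotheses (A0 : 0 <= A) (hth : forall J, `|theta J| <= A) (K1 : 1 <= K).
Hypothesis hK : forall j t s, (j <= k)%N ->
  [/\ `|hbump k j t| <= K, `|hbump k j (t + s) - hbump k j t| <= K * `|s| &
      (j < k)%N -> `|hbump k j (t + s) - hbump k j t - hbump k j.+1 t * s| <= K * s ^+ 2].

(** All scaling is in the vectors [e]: in the coordinates ['<x, e i> + sh] the cell [J] is the unit
    cube with lower corner [J]. The multi-index [c] says which partial derivative of the bump is
    meant; [c = 0] is the bump itself. *)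
Definition cell_bump (c : 'I_n -> nat) (J : {ffun 'I_n -> 'I_N}) (x : X) : R :=
  \prod_i hbump k (c i) ('<x, e i> + sh - (J i)%:R).

Definition cell_function (c : 'I_n -> nat) (x : X) : R :=
  \sum_J theta J * cell_bump c J x.

Lemma le_total_order (c : 'I_n -> nat) i : (c i <= total_order c)%N.
Proof. by rewrite /total_order (bigD1 i)//= leq_addr. Qed.

Let K0 : 0 <= K. Proof. exact: le_trans K1. Qed.
Let eta0 : 0 <= eta. Proof. exact: le_trans eta1. Qed.

Lemma size_index_enum_ord : size (index_enum 'I_n) = n.
Proof. by rewrite [index_enum _]unlock -enumT size_enum_ord. Qed.

Lemma cell_bump_le c J x : (total_order c <= k)%N -> `|cell_bump c J x| <= K ^+ n.
Proof.
move=> ck; have h i : `|hbump k (c i) ('<x, e i> + sh - (J i)%:R)| <= K.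
  by have [] := hK ('<x, e i> + sh - (J i)%:R) 0 (leq_trans (le_total_order c i) ck).
by have := norm_prod_le (index_enum 'I_n) h; rewrite size_index_enum_ord.
Qed.

Lemma cell_bump_neq0 c J x : (total_order c <= k)%N -> cell_bump c J x != 0 ->
  forall i, 0 < '<x, e i> + sh - (J i)%:R < 1.
Proof.
move=> ck /prodf_neq0 h i; apply: contraT => hi.
by have := h i isT; rewrite bump_eq0 ?eqxx//; exact: leq_trans (le_total_order c i) ck.
Qed.

Lemma cell_unique (x : X) (J J' : {ffun 'I_n -> 'I_N}) :
  (forall i, 0 < '<x, e i> + sh - (J i)%:R < 1) ->
  (forall i, 0 < '<x, e i> + sh - (J' i)%:R < 1) -> J = J'.
Proof.
move=> h h'; apply/ffunP => i; apply: val_inj => /=.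
have /andP[a1 a2] := h i; have /andP[b1 b2] := h' i.
have h1 : (J i)%:R < (J' i).+1%:R :> R by rewrite -natr1; lra.
have h2 : (J' i)%:R < (J i).+1%:R :> R by rewrite -natr1; lra.
rewrite !ltr_nat !ltnS in h1 h2.
by apply/eqP; rewrite eqn_leq h1 h2.
Qed.

(** The supports are disjoint, so at a given point a sum over all cells has at most one nonzero
    term, and its size does not grow with the number of cells. *)
Lemma cell_bump_support c x : (total_order c <= k)%N ->
  \sum_J (cell_bump c J x != 0)%:R <= 1 :> R.
Proof.
move=> ck.
case: (pselect (exists J, cell_bump c J x != 0)) => [[J0 hJ0]|nex]; last first.
  by rewrite big1// => J _; case: eqP => // /eqP h; case: nex; exists J.
rewrite (bigD1 J0)//= hJ0 big1 ?addr0// => J JJ0.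
case: eqP => // /eqP h; case/negP: JJ0; apply/eqP.
by apply: (@cell_unique x); apply: cell_bump_neq0; eauto.
Qed.

Lemma sum_cells_le c x (f : {ffun 'I_n -> 'I_N} -> R) L : (total_order c <= k)%N -> 0 <= L ->
  (forall J, `|f J| <= (cell_bump c J x != 0)%:R * L) -> `|\sum_J f J| <= L.
Proof.
move=> ck L0 hf; apply: le_trans (ler_norm_sum _ _ _) _.
apply: (@le_trans _ _ (\sum_J (cell_bump c J x != 0)%:R * L)); first exact: ler_sum.
by rewrite -mulr_suml ler_piMl// cell_bump_support.
Qed.

Lemma cell_function_le c x : (total_order c <= k)%N -> `|cell_function c x| <= A * K ^+ n.
Proof.
move=> ck; have AK : 0 <= A * K ^+ n by rewrite mulr_ge0// exprn_ge0.
apply: (sum_cells_le (x := x) ck) => // J; rewrite normrM.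
have [->|_] := eqVneq (cell_bump c J x) 0; first by rewrite normr0 mulr0 mul0r.
by rewrite mul1r ler_pM// cell_bump_le.
Qed.

Lemma norm_inner_e x i : `|'<x, e i>| <= eta * `|x|.
Proof.
by rewrite (le_trans (cauchy_schwarz _ _))// mulrC ler_wpM2r.
Qed.

Lemma shift_arg (x h : X) i J :
  '<x + h, e i> + sh - ((J : {ffun 'I_n -> 'I_N}) i)%:R = '<x, e i> + sh - (J i)%:R + '<h, e i>.
Proof. by rewrite innerDl; ring. Qed.

Lemma cell_bump_lipschitz c J x h : (total_order c <= k)%N ->
  `|cell_bump c J (x + h) - cell_bump c J x| <= n%:R * K ^+ n * (eta * `|h|).
Proof.
move=> ck; have ci i := leq_trans (le_total_order c i) ck.
pose s y i := '<y, e i> + sh - (J i)%:R.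
have h1 y i : `|hbump k (c i) (s y i)| <= K by have [] := hK (s y i) 0 (ci i).
have h2 i : `|hbump k (c i) (s (x + h) i) - hbump k (c i) (s x i)| <= K * (eta * `|h|).
  rewrite /s shift_arg; have [_ + _] := hK (s x i) '<h, e i> (ci i).
  by move=> /le_trans; apply; rewrite ler_wpM2l// norm_inner_e.
by have := prod_lipschitz (h1 x) (h1 (x + h)) h2 (index_enum 'I_n);
  rewrite size_index_enum_ord.
Qed.

Lemma cell_bump_taylor c J x h : (total_order c < k)%N ->
  `|cell_bump c J (x + h) - cell_bump c J x - \sum_i '<h, e i> * cell_bump (inc c i) J x|
  <= n%:R ^+ 2 * K ^+ n * (eta * `|h|) ^+ 2.
Proof.
move=> ck; have ci i : (c i < k)%N by exact: leq_ltn_trans (le_total_order c i) ck.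
pose s y i := '<y, e i> + sh - (J i)%:R.
have -> : \sum_i '<h, e i> * cell_bump (inc c i) J x =
  prod_derivative (fun i => hbump k (c i) (s x i))
    (fun i => hbump k (c i).+1 (s x i) * '<h, e i>) (index_enum 'I_n).
  apply: eq_bigr => i _; rewrite /cell_bump (bigD1 i)//= [RHS](bigD1 i)//= eqxx.
  rewrite mulrA -/(s x i) /inc eqxx addn1; congr (_ * _); first by rewrite mulrC.
  by apply: eq_bigr => l li; rewrite (negbTE li) addn0.
have t0 : 0 <= eta * `|h| by rewrite mulr_ge0.
have h1 y i : `|hbump k (c i) (s y i)| <= K by have [] := hK (s y i) 0 (ltnW (ci i)).
have h2 i : `|hbump k (c i) (s (x + h) i) - hbump k (c i) (s x i)| <= K * (eta * `|h|).
  rewrite /s shift_arg; have [_ + _] := hK (s x i) '<h, e i> (ltnW (ci i)).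
  by move=> /le_trans; apply; rewrite ler_wpM2l// norm_inner_e.
have h3 i : `|hbump k (c i).+1 (s x i) * '<h, e i>| <= K * (eta * `|h|).
  by rewrite normrM ler_pM ?norm_inner_e//; have [] := hK (s x i) 0 (ci i).
have h4 i : `|hbump k (c i) (s (x + h) i) - hbump k (c i) (s x i) -
    hbump k (c i).+1 (s x i) * '<h, e i>| <= K * (eta * `|h|) ^+ 2.
  rewrite /s shift_arg; have [_ _ /(_ (ci i))] := hK (s x i) '<h, e i> (ltnW (ci i)).
  move=> /le_trans; apply; rewrite ler_wpM2l//.
  by rewrite -[X in X <= _]real_normK ?num_real// lerXn2r ?nnegrE// ?norm_inner_e//.
by have := prod_taylor K1 t0 (h1 x) (h1 (x + h)) h2 h3 h4 (index_enum_uniq 'I_n);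
  rewrite size_index_enum_ord.
Qed.

Lemma cell_function_lipschitz c x y : (total_order c <= k)%N ->
  `|cell_function c x - cell_function c y| <= 2 * (A * (n%:R * K ^+ n * (eta * `|x - y|))).
Proof.
move=> ck; set L := n%:R * K ^+ n * (eta * `|x - y|).
have L0 : 0 <= L by rewrite !mulr_ge0// exprn_ge0.
have hL J : `|cell_bump c J x - cell_bump c J y| <= L.
  by have := cell_bump_lipschitz J y (x - y) ck; rewrite (addrC y) subrK.
have hAL J : `|theta J| * `|cell_bump c J x - cell_bump c J y| <= A * L.
  by rewrite ler_pM.
rewrite -sumrB; apply: le_trans (ler_norm_sum _ _ _) _.
(* Only the cell of [x] and the cell of [y] contribute, whence the factor 2. *)
apply: (@le_trans _ _ (\sum_J ((cell_bump c J x != 0)%:R * (A * L) +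
   (cell_bump c J y != 0)%:R * (A * L)))).
  apply: ler_sum => J _; rewrite -mulrBr normrM.
  have [x0|x0] := eqVneq (cell_bump c J x) 0; have [y0|y0] := eqVneq (cell_bump c J y) 0.
  - by rewrite x0 y0 subrr normr0 mulr0 mul0r addr0.
  all: rewrite ?mul1r ?mul0r ?add0r ?addr0.
  1,2: exact: hAL.
  by apply: le_trans (hAL J) _; rewrite lerDl mulr_ge0.
rewrite big_split /= -!mulr_suml -mulrDl ler_wpM2r ?mulr_ge0 ?exprn_ge0//.
have h1 := cell_bump_support x ck; have h2 := cell_bump_support y ck; lra.
Qed.

Lemma cell_function_holder c x y : (total_order c <= k)%N ->
  `|cell_function c x - cell_function c y| <=
  2 * A * n%:R * eta * K ^+ n * (`|x - y| `^ alpha).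
Proof.
move=> ck; have n1 : 1 <= n%:R :> R by rewrite ler1n.
have Kn : 0 <= K ^+ n by rewrite exprn_ge0.
have [xy|xy] := leP `|x - y| 1.
  apply: le_trans (cell_function_lipschitz x y ck) _.
  have h : `|x - y| <= `|x - y| `^ alpha.
    have [->|d0] := eqVneq `|x - y| 0; first by rewrite powR_ge0.
    by rewrite -[leLHS]powRr1//; apply: ger_powR => //; rewrite xy lt_neqAle eq_sym d0 normr_ge0.
  have -> : 2 * (A * (n%:R * K ^+ n * (eta * `|x - y|))) =
     2 * A * n%:R * eta * K ^+ n * `|x - y| by ring.
  by rewrite ler_wpM2l// !mulr_ge0.
have h : 1 <= `|x - y| `^ alpha by rewrite -(powRr0 `|x - y|) ler_powR ?ltW.
apply: (@le_trans _ _ (2 * (A * K ^+ n))).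
  apply: le_trans (ler_normB _ _) _.
  have h1 := cell_function_le x ck; have h2 := cell_function_le y ck; lra.
have h3 : 1 <= n%:R * eta * (`|x - y| `^ alpha).
  by do 2 (rewrite mulr_ege1 //).
have -> : 2 * A * n%:R * eta * K ^+ n * (`|x - y| `^ alpha) =
   2 * (A * K ^+ n) * (n%:R * eta * (`|x - y| `^ alpha)) by ring.
by rewrite ler_peMr// !mulr_ge0.
Qed.

(** The number of cells appears in the constant, which is harmless: this bound yields
    differentiability only and does not enter the norm. *)
Lemma cell_function_taylor c x h : (total_order c < k)%N ->
  `|cell_function c (x + h) - cell_function c x -
    \sum_i '<h, e i> * cell_function (inc c i) x| <=
  #|{ffun 'I_n -> 'I_N}|%:R * A * (n%:R ^+ 2 * K ^+ n * eta ^+ 2) * `|h| ^+ 2.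
Proof.
move=> ck; rewrite /cell_function.
have -> : \sum_i '<h, e i> * (\sum_J theta J * cell_bump (inc c i) J x) =
   \sum_J theta J * \sum_i '<h, e i> * cell_bump (inc c i) J x.
  under eq_bigr do rewrite mulr_sumr.
  rewrite exchange_big /=; apply: eq_bigr => J _; rewrite mulr_sumr.
  by apply: eq_bigr => i _; rewrite mulrCA.
rewrite -!sumrB; apply: le_trans (ler_norm_sum _ _ _) _.
apply: (@le_trans _ _ (\sum_(J : {ffun 'I_n -> 'I_N})
    A * (n%:R ^+ 2 * K ^+ n * (eta * `|h|) ^+ 2))).
  by apply: ler_sum => J _; rewrite -!mulrBr normrM ler_pM// cell_bump_taylor.
rewrite big_const iter_addr addr0 -[leLHS]mulr_natl exprMn.
by rewrite le_eqVlt; apply/orP; left; apply/eqP; ring.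
Qed.

(** [k.+3] collects the [k.+1] sup norms and the factor 2 of the Hölder bound; the latter also
    brings one more factor [n%:R * eta], hence the power [k.+1]. *)
Lemma cell_function_C_ball (B : R) :
  k.+3%:R * A * K ^+ n * (n%:R * eta) ^+ k.+1 <= B ->
  C_ball k alpha B (fun x => cell_function (fun=> 0%N) x *: u).
Proof.
move=> hB; have n1 : 1 <= n%:R :> R by rewrite ler1n.
have ne1 : 1 <= n%:R * eta by rewrite mulr_ege1.
have Kn : 0 <= K ^+ n by rewrite exprn_ge0.
apply: (@cylinder_C_ball _ _ _ _ _ e u cell_function alpha eta (A * K ^+ n)
  (2 * A * n%:R * eta * K ^+ n)
  (#|{ffun 'I_n -> 'I_N}|%:R * A * (n%:R ^+ 2 * K ^+ n * eta ^+ 2))) => //.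
- by rewrite mulr_ge0.
- by rewrite !mulr_ge0.
- by rewrite !mulr_ge0 ?exprn_ge0.
- by move=> c x; exact: cell_function_le.
- by move=> c x y; exact: cell_function_holder.
- by move=> c x h; exact: cell_function_taylor.
apply: le_trans hB; set z := n%:R * eta in ne1 *.
rewrite [z ^+ k.+1]exprS [leRHS]mulrA ler_wpM2r ?exprn_ge0 ?(le_trans _ ne1)//.
rewrite -[k.+3]addn2 natrD -/z.
have -> : k.+1%:R * (A * K ^+ n) + 2 * A * n%:R * eta * K ^+ n =
   A * K ^+ n * (k.+1%:R + 2 * z) by rewrite /z; ring.
have -> : (k.+1%:R + 2) * A * K ^+ n * z = A * K ^+ n * (k.+1%:R * z + 2 * z) by ring.
by rewrite ler_wpM2l ?mulr_ge0// lerD2r ler_peMr.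
Qed.

End cells.

(** * Lower bound *)

Section Lp_tools.
Context {R : realType} {X Y : hilbertType R}.
Variables (mu : probability (borel X) R) (p : R).
Hypotheses (p1 : 1 <= p) (sY : separable Y).

Let p0 : 0 < p. Proof. exact: lt_le_trans p1. Qed.

Lemma Lp_normE (F : X -> Y) :
  Lp_norm mu p F = ((\int[mu]_x (`|F x| `^ p)%:E) `^ p^-1)%E.
Proof.
rewrite /Lp_norm unlock; congr (_ `^ _)%E; apply: eq_integral => x _.
by rewrite abse_EFin normr_id poweR_EFin.
Qed.

Lemma Lp_norm_ge0 (F : X -> Y) : (0 <= Lp_norm mu p F)%E.
Proof. exact: Lnorm_ge0. Qed.

Lemma Lp_norm_le_Lnorm (F : X -> Y) (g : X -> R) : (forall x, `|F x| <= g x) ->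
  (Lp_norm mu p F <= (\int[mu]_x (g x `^ p)%:E) `^ p^-1)%E.
Proof.
move=> Fg; rewrite Lp_normE; apply: gt0_ler_poweR.
- by rewrite invr_ge0 ltW.
- by rewrite in_itv /= leey andbT integral_ge0// => x _; rewrite lee_fin powR_ge0.
- by rewrite in_itv /= leey andbT integral_ge0// => x _; rewrite lee_fin powR_ge0.
apply: ge0_le_integral_nomeas => x; first by rewrite lee_fin powR_ge0.
have gx : 0 <= g x by exact: le_trans (Fg x).
by rewrite lee_fin ge0_ler_powR ?nnegrE// ltW.
Qed.

Lemma Lp_norm_cst_le (F : X -> Y) (c : R) : (forall x, `|F x| <= c) ->
  (Lp_norm mu p F <= c%:E)%E.
Proof.
move=> Fc; have c0 : 0 <= c by exact: le_trans (Fc 0).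
apply: le_trans (Lp_norm_le_Lnorm Fc) _.
by rewrite integral_cst_probability poweR_EFin -powRrM mulfV ?gt_eqF// powRr1.
Qed.

Lemma Lp_norm_ler (F G : X -> Y) : (forall x, `|F x| <= `|G x|) ->
  (Lp_norm mu p F <= Lp_norm mu p G)%E.
Proof. by move=> FG; rewrite (Lp_normE G); exact: Lp_norm_le_Lnorm. Qed.

Lemma Lp_norm_subC (F G : X -> Y) : Lp_norm mu p (F - G)%R = Lp_norm mu p (G - F).
Proof. by apply/eqP; rewrite eq_le !Lp_norm_ler// => x; rewrite !fctE distrC. Qed.

Lemma Lp_norm_triangle (F G H : X -> Y) :
  measurable_fun setT (F : borel X -> borel Y) ->
  measurable_fun setT (G : borel X -> borel Y) ->
  measurable_fun setT (H : borel X -> borel Y) ->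
  (Lp_norm mu p (F - H)%R <= Lp_norm mu p (F - G)%R + Lp_norm mu p (G - H)%R)%E.
Proof.
move=> mF mG mH.
have m1 : measurable_fun setT (fun x : borel X => `|F x - G x|).
  by apply: borel_measurable_norm; exact: borel_measurableB.
have m2 : measurable_fun setT (fun x : borel X => `|G x - H x|).
  by apply: borel_measurable_norm; exact: borel_measurableB.
apply: le_trans (minkowski_EFin mu m1 m2 p1).
apply: le_trans (Lp_norm_le_Lnorm (g := fun x => `|F x - G x| + `|G x - H x|) _) _.
  by move=> x; rewrite !fctE (le_trans _ (ler_normD _ _))// addrA subrK.
rewrite unlock le_eqVlt; apply/orP; left; apply/eqP; congr (_ `^ _)%E.
apply: eq_integral => x _ /=.
by rewrite ger0_norm ?addr_ge0// poweR_EFin.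
Qed.

Lemma Lp_bounded (F : X -> Y) (c : R) : measurable_fun setT (F : borel X -> borel Y) ->
  (forall x, `|F x| <= c) -> Lp mu p F.
Proof. by move=> mF Fc; split=> //; apply: le_lt_trans (Lp_norm_cst_le Fc) (ltry _). Qed.

Lemma Lp_open_ball (F : X -> Y) (c : R) : Lp mu p F ->
  Lp_open mu p [set G | (Lp_norm mu p (F - G)%R < c%:E)%E].
Proof.
move=> [mF _] G [mG _] /= FGc.
have fFG : (Lp_norm mu p (F - G)%R)%E \is a fin_num.
  by rewrite ge0_fin_numE ?Lp_norm_ge0// (lt_trans FGc) ?ltry.
exists (c - fine (Lp_norm mu p (F - G)%R)).
  by rewrite subr_gt0 -lte_fin fineK.
move=> H [mH _] GH /=; apply: le_lt_trans (Lp_norm_triangle mF mG mH) _.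
rewrite (Lp_norm_subC G) -(fineK fFG); move: GH.
by rewrite EFinB lteBrDl.
Qed.

(** The sets where the loss is below a level are preimages of open balls of L^p around [F], to which
    the definition of [estimator] applies. *)
Lemma measurable_Lp_norm_sub d (T : measurableType d) (Fhat : T -> X -> Y) (F : X -> Y) :
  estimator mu p Fhat -> Lp mu p F ->
  measurable_fun setT (fun t => Lp_norm mu p (F - Fhat t)%R).
Proof.
move=> [_ mFhat] LF; apply: (measurability _ (ErealGenCInfty.measurableE R)).
move=> _ [_ [r ->] <-]; rewrite setTI.
rewrite [X in measurable X](_ : _ =
    ~` (Fhat @^-1` [set G | (Lp_norm mu p (F - G)%R < r%:E)%E])).
  by apply: measurableC; apply: mFhat; exact: Lp_open_ball.
apply/seteqP; split => t /=; rewrite in_itv /= andbT.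
  by rewrite leNgt => /negP.
by move=> /negP; rewrite -leNgt.
Qed.

End Lp_tools.

(** * Sign patterns that the data cannot distinguish *)

Section zero_information.
Context {R : realType} {X Y : hilbertType R}.
Variables (mu : probability (borel X) R) (p : R).
Hypotheses (p1 : 1 <= p) (sY : separable Y).
Variables (I : finType) (b : I -> X -> R) (u : Y) (kappa : R) (m : nat).

Let allI : {set I} := [set: I]%SET.

Definition signed_sum (S : {set I}) (theta : {ffun I -> bool}) (x : X) : Y :=
  (\sum_(J in S) (-1) ^+ theta J * b J x) *: u.

Hypothesis Lp_signed : forall theta, Lp mu p (signed_sum allI theta).
Hypothesis b_supp : forall x, (#|[set J | b J x != 0%R]%SET| <= 1)%N.
Hypothesis hI : (2 * m <= #|I|)%N.
Hypothesis hkappa : forall (S : {set I}) theta, (#|I| <= 2 * #|S|)%N ->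
  (kappa%:E <= Lp_norm mu p (signed_sum S theta))%E.

Definition unseen (xs : m.-tuple X) : {set I} :=
  [set J | [forall i, b J (tnth xs i) == 0%R]]%SET.

Lemma card_unseen xs : (#|I| <= 2 * #|unseen xs|)%N.
Proof.
have h : (#|~: unseen xs| <= m)%N.
  apply: (@leq_trans #|(\bigcup_(i < m) [set J | b J (tnth xs i) != 0%R])%SET|).
    apply: subset_leq_card; apply/fintype.subsetP => J; rewrite !inE negb_forall.
    by move=> /existsP[i hi]; apply/bigcupP; exists i => //; rewrite inE.
  apply: (@leq_trans (\sum_(i < m) 1)); last by rewrite sum1_card card_ord.
  elim/big_ind2: _ => [|n1 A1 n2 A2 h1 h2|i _]; first by rewrite cards0.
    by apply: leq_trans (leq_card_setU A1 A2).1 _; exact: leq_add.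
  exact: b_supp.
have := cardsC (unseen xs); move: h hI; lia.
Qed.

Definition flip (S : {set I}) (theta : {ffun I -> bool}) : {ffun I -> bool} :=
  [ffun J => theta J (+) (J \in S)].

Lemma flipK S : involutive (flip S).
Proof. by move=> theta; apply/ffunP => J; rewrite !ffunE -addbA addbb addbF. Qed.

Lemma signed_sum_flip_design xs theta i :
  signed_sum allI theta (tnth xs i) = signed_sum allI (flip (unseen xs) theta) (tnth xs i).
Proof.
rewrite /signed_sum; congr (_ *: _); apply: eq_bigr => J _; rewrite ffunE.
case: (boolP (J \in unseen xs)) => [|_]; last by rewrite addbF.
by rewrite inE => /forallP /(_ i) /eqP ->; rewrite !mulr0.
Qed.

Lemma signed_sum_flip_sub S theta x :
  signed_sum allI theta x - signed_sum allI (flip S theta) x = 2 *: signed_sum S theta x.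
Proof.
rewrite /signed_sum -scalerBl scalerA -sumrB mulr_sumr; congr (_ *: _).
rewrite [RHS]big_mkcond /=; apply: eq_big => [J|J _]; first by rewrite inE.
rewrite ffunE; case: (boolP (J \in S)) => _; last by rewrite addbF subrr.
by case: (theta J); rewrite /= ?expr1 ?expr0; ring.
Qed.

Context d (Omega : measurableType d) (Q : probability Omega R).
Context d' (T : measurableType d').
Variables (xd : Omega -> m.-tuple X) (dat : (X -> Y) -> Omega -> T).
Variable Fhat : T -> X -> Y.
Hypothesis eF : estimator mu p Fhat.
Hypothesis mdat : forall theta, measurable_fun setT (dat (signed_sum allI theta)).
Hypothesis dat_design : forall F F' z,
  (forall i, F (tnth (xd z) i) = F' (tnth (xd z) i)) -> dat F z = dat F' z.

Let loss F z : \bar R := Lp_norm mu p (F - Fhat (dat F z)).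

Let loss_ge0 F z : (0 <= loss F z)%E. Proof. exact: Lp_norm_ge0. Qed.

(* Both sign patterns produce the same data, so the triangle inequality through
   the common estimate bounds the sum of the two losses. *)
Lemma loss_flip theta z :
  (kappa%:E <= loss (signed_sum allI theta) z +
     loss (signed_sum allI (flip (unseen (xd z)) theta)) z)%E.
Proof.
set S := unseen (xd z); set F := signed_sum _ _; set F' := signed_sum allI (flip S theta).
have datE : dat F' z = dat F z.
  by apply: dat_design => i; exact/esym/signed_sum_flip_design.
rewrite /loss datE; set H := Fhat _.
apply: le_trans (hkappa theta (card_unseen (xd z))) _.
rewrite (Lp_norm_subC mu p1 F').
have mH : measurable_fun setT (H : borel X -> borel Y) by case: (eF.1 (dat F z)).
apply: le_trans _ (Lp_norm_triangle mu p1 sY (Lp_signed theta).1 mH (Lp_signed _).1).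
apply: Lp_norm_ler => // x; rewrite !fctE signed_sum_flip_sub (normrZ 2).
by rewrite normr_nat ler_peMl// ler1n.
Qed.

(** The worst pattern is at least as bad as the average over all patterns. The flipped set depends
    on the outcome [z], but for each fixed [z] flipping is a bijection of the patterns; so twice the
    sum of the losses is a sum over flipped pairs, each at least [kappa]. The abstract [Omega], [xd]
    and [dat] serve both designs. *)
Lemma zero_information_bound (class : set (X -> Y)) :
  (forall theta, class (signed_sum allI theta)) ->
  ((kappa / 2)%:E <= ereal_sup [set (\int[Q]_z loss F z)%E | F in class])%E.
Proof.
move=> hclass; set s := ereal_sup _.
set n := #|{ffun I -> bool}|.
have n0 : (0 < n)%N by apply/card_gt0P; exists [ffun=> false].
have mloss theta : measurable_fun setT (loss (signed_sum allI theta)).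
  apply: (@measurableT_comp _ _ _ _ _ _ (fun t => Lp_norm mu p (signed_sum allI theta - Fhat t))%R).
    exact: measurable_Lp_norm_sub.
  exact: mdat.
have ptw z : ((n%:R * kappa)%:E <= 2%:E * \sum_theta loss (signed_sum allI theta) z)%E.
  have -> : (2%:E * \sum_theta loss (signed_sum allI theta) z =
     \sum_theta (loss (signed_sum allI theta) z +
       loss (signed_sum allI (flip (unseen (xd z)) theta)) z))%E.
    have hr : (\sum_theta loss (signed_sum allI theta) z =
        \sum_theta loss (signed_sum allI (flip (unseen (xd z)) theta)) z)%E.
      by rewrite (reindex_inj (inv_inj (flipK (unseen (xd z))))).
    rewrite big_split /= -hr.
    by rewrite -mule2n muleC -mule_natl muleC.
  have -> : (n%:R * kappa)%:E = (\sum_(theta : {ffun I -> bool}) kappa%:E)%E.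
    by rewrite sumEFin big_const iter_addr addr0 mulr_natl.
  by apply: lee_sum => theta _; exact: loss_flip.
have int : ((n%:R * kappa)%:E <=
   2%:E * \sum_(theta : {ffun I -> bool}) \int[Q]_z loss (signed_sum allI theta) z)%E.
  rewrite -ge0_integral_sum// -ge0_integralZl//.
  - rewrite -[leLHS](integral_cst_probability Q).
    have [k0|k0] := leP 0 kappa; last first.
      apply: (@le_trans _ _ 0%E).
        by rewrite integral_cst_probability lee_fin mulr_ge0_le0// ltW.
      by apply: integral_ge0 => z _; rewrite mule_ge0// sume_ge0.
    apply: ge0_le_integral_nomeas => // z.
    by rewrite lee_fin mulr_ge0.
  - exact: emeasurable_sum.
  - by move=> z _; exact: sume_ge0.
have hs theta : (\int[Q]_z loss (signed_sum allI theta) z <= s)%E.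
  by apply: ereal_sup_ubound; exists (signed_sum allI theta).
have s0 : (0 <= s)%E.
  apply: le_trans (hs [ffun=> false]); exact: integral_ge0.
case: s s0 hs => [r r0 hs|_ _|//]; last by rewrite leey.
have : ((n%:R * kappa)%:E <= 2%:E * (n%:R * r)%:E)%E.
  apply: le_trans int _; apply: lee_wpmul2l => //.
  apply: (@le_trans _ _ (\sum_(theta : {ffun I -> bool}) r%:E)%E); first exact: lee_sum.
  by rewrite sumEFin big_const iter_addr addr0 mulr_natl.
rewrite -EFinM !lee_fin; have n0' : 0 < n%:R :> R by rewrite ltr0n.
by rewrite mulrCA ler_pM2l// => h; lra.
Qed.

End zero_information.

Lemma lee_prod_cst (R : realType) I (s : seq I) (f : I -> \bar R) (c : R) :
  0 <= c -> (forall i, (c%:E <= f i)%E) -> ((c ^+ size s)%:E <= \prod_(i <- s) f i)%E.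
Proof.
move=> c0 hf; elim: s => [|i s IH]; first by rewrite big_nil.
by rewrite big_cons exprS EFinM lee_pmul// lee_fin// exprn_ge0.
Qed.

Lemma ler_prod_cst (R : realType) I (s : seq I) (f : I -> R) (c : R) :
  0 <= c -> (forall i, c <= f i) -> c ^+ size s <= \prod_(i <- s) f i.
Proof.
move=> c0 hf; elim: s => [|i s IH]; first by rewrite big_nil.
by rewrite big_cons exprS ler_pM// exprn_ge0.
Qed.

Lemma lipschitz_borel_measurable (R : realType) (X Y : hilbertType R) (F : X -> Y) (L : R) :
  (forall x y, `|F x - F y| <= L * `|x - y|) ->
  measurable_fun setT (F : borel X -> borel Y).
Proof.
move=> hF; apply: measurable_fun_borel => U oU; apply: borel_open.
move: U oU; apply/continuousP => x; apply/cvgrPdist_lt => eps eps0.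
have L0 : 0 < `|L| + 1 by rewrite ltr_wpDl.
near=> t; apply: le_lt_trans (hF x t) _.
apply: (@le_lt_trans _ _ ((`|L| + 1) * `|x - t|)).
  by rewrite ler_wpM2r// (le_trans (ler_norm L))// lerDl.
rewrite mulrC -ltr_pdivlMr//; near: t.
by apply: cvgr_dist_lt; [exact: cvg_id|exact: divr_gt0].
Unshelve. all: by end_near. Qed.

(** * Cells adapted to the measure: their mass and the height of the bumps *)

Section lower_bound.
Context {R : realType} {X Y : hilbertType R}.
Variables (mu : probability (borel X) R) (gamma : probability (borel Y) R).
Variables (lambda : nat -> R) (phi : nat -> X) (a b io p alpha B sigma : R) (k n N m : nat).
Hypotheses (sY : separable Y).
Hypothesis hii : condition_ii mu lambda phi.
Hypothesis hiiiL : condition_iiiL mu lambda phi a b.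
Hypothesis ioE : io = 2 * a * b.
Hypotheses (n0 : (0 < n)%N) (p1 : 1 <= p).
Hypotheses (alpha0 : 0 < alpha) (alpha1 : alpha <= 1).
Hypothesis hN : (2 * m <= N ^ n)%N.
Hypothesis N0 : (0 < N)%N.

Let a0 : 0 < a. Proof. by case: hiiiL. Qed.
Let b0 : 0 < b. Proof. by case: hiiiL. Qed.
Let lambda0 i : 0 < lambda i. Proof. by case: hii. Qed.
Let NR0 : 0 < N%:R :> R. Proof. by rewrite ltr0n. Qed.

(** Scaled so that, after the shift by [N / 2], the range [-a, a] of a normalized coordinate becomes
    [0, N], cut into N unit intervals. On this range the densities are at least [b]. *)
Definition cell_dir (i : 'I_n) : X := (N%:R / (2 * a * Num.sqrt (lambda i))) *: phi i.

Let sh : R := N%:R / 2.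

Lemma inner_cell_dir x i : '<x, cell_dir i> = N%:R / (2 * a) * coordinate lambda phi i x.
Proof.
rewrite /cell_dir /coordinate innerZr; field.
by rewrite !gt_eqF// sqrtr_gt0.
Qed.

(** The eigenvalues decrease, so the last direction is the longest. The maximum with 1 supplies the
    hypothesis [1 <= eta] of the norm bounds. *)
Lemma norm_cell_dir i :
  `|cell_dir i| <= Num.max 1 (N%:R / (2 * a * Num.sqrt (lambda n.-1))).
Proof.
have phi1 : `|phi i| = 1.
  apply/eqP; rewrite -sqrp_eq1// -inner_norm; case: hii => _ _ [+ _] _ _.
  by move=> /(_ i i I I) ->; rewrite eqxx.
rewrite /cell_dir normrZ phi1 mulr1 le_max; apply/orP; right.
have s0 j : 0 < Num.sqrt (lambda j) by rewrite sqrtr_gt0.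
rewrite ger0_norm; last by rewrite divr_ge0// !mulr_ge0// ltW.
rewrite ler_pM2l// lef_pV2 ?posrE ?mulr_gt0// ler_pM2l ?mulr_gt0// ler_sqrt; last exact: ltW.
have : (i <= n.-1)%N by rewrite -ltnS prednK.
case: hii => _ hdec _ _ _.
elim: (n.-1) => [|j IH]; first by rewrite leqn0 => /eqP ->.
rewrite leq_eqVlt => /predU1P[->//|ij]; apply: le_trans (hdec j) _.
exact: IH.
Qed.

(** Independence is stated for families of sets indexed by all naturals, so [J] is extended by 0
    beyond its domain. *)
Definition cell_index (J : {ffun 'I_n -> 'I_N}) (i : nat) : nat :=
  if insub i is Some i' then J i' else 0%N.

Lemma cell_indexE J (i : 'I_n) : cell_index J i = J i.
Proof. by rewrite /cell_index valK. Qed.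

Lemma cell_index_lt J i : (cell_index J i < N)%N.
Proof. by rewrite /cell_index; case: insubP. Qed.

Definition mid_itv J i : set R :=
  `[2 * a / N%:R * ((cell_index J i)%:R + 1 / 4 - sh),
    2 * a / N%:R * ((cell_index J i)%:R + 3 / 4 - sh)]%classic.

Definition mid (J : {ffun 'I_n -> 'I_N}) : set X :=
  \bigcap_(i in [set` seq.iota 0 n]) coordinate lambda phi i @^-1` mid_itv J i.

Lemma mid_in J x i : mid J x ->
  1 / 4 <= '<x, cell_dir i> + sh - (J i)%:R <= 3 / 4.
Proof.
move=> /(_ i); rewrite /= mem_iota ltn_ord /mid_itv /= in_itv/= cell_indexE => /(_ isT).
rewrite inner_cell_dir; set c := coordinate _ _ _ _ => /andP[].
have d0 : 0 < 2 * a / N%:R by rewrite divr_gt0// mulr_gt0.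
have -> : N%:R / (2 * a) * c = c / (2 * a / N%:R) by field; rewrite !gt_eqF.
move=> h1 h2; set q := c / _.
have {}h1 : (J i)%:R + 1 / 4 - sh <= q by rewrite /q ler_pdivlMr// mulrC.
have {}h2 : q <= (J i)%:R + 3 / 4 - sh by rewrite /q ler_pdivrMr// mulrC.
by apply/andP; split; lra.
Qed.

Lemma coordinate_measurable i :
  measurable_fun setT (coordinate lambda phi i : borel X -> R).
Proof.
apply: continuous_borel_measurable => x.
by apply: cvgM; [exact: inner_continuousl|exact: cvg_cst].
Qed.

Lemma mid_measurable J : measurable (mid J : set (borel X)).
Proof.
apply: fin_bigcap_measurable => // i _.
rewrite -[X in measurable X]setTI; apply: coordinate_measurable => //.
exact: measurable_itv.
Qed.

(** The middle half of a side has length a/N and lies in [-a, a], where the density is at least b;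
    and ab/N = io/(2N). *)
Lemma mass_mid_itv J i :
  ((io / (2 * N%:R))%:E <= mu (coordinate lambda phi i @^-1` mid_itv J i))%E.
Proof.
case: hiiiL => _ _ [nu /(_ i)[[mnu nu0 nuE] hnu]].
have mI : measurable (mid_itv J i) by exact: measurable_itv.
rewrite nuE//.
apply: (@le_trans _ _ (\int[lebesgue_measure]_(x in mid_itv J i) b%:E)%E); last first.
  apply: ge0_le_integral => //.
  - by move=> x _; rewrite lee_fin ltW.
  - by apply/measurable_EFinP; exact: measurable_funTS.
  move=> x; rewrite /mid_itv /= in_itv /= lee_fin => /andP[h1 h2]; apply: hnu.
  have d0 : 0 < 2 * a / N%:R by rewrite divr_gt0// mulr_gt0.
  have e1 : 2 * a / N%:R * sh = a by rewrite /sh; field; rewrite gt_eqF.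
  have jN : (cell_index J i)%:R + 1 <= N%:R :> R.
    by rewrite natr1 ler_nat cell_index_lt.
  have j0 : 0 <= (cell_index J i)%:R :> R by [].
  have e2 : 2 * a / N%:R * N%:R = 2 * a by rewrite mulfVK// gt_eqF.
  rewrite ler_norml; apply/andP; split.
    apply: le_trans h1; rewrite mulrBr e1 lerBrDr addrC subrr.
    by rewrite mulr_ge0// ?ltW// addr_ge0.
  apply: le_trans h2 _; rewrite mulrBr e1 lerBlDr.
  apply: (@le_trans _ _ (2 * a / N%:R * N%:R)); last by rewrite e2; lra.
  by rewrite ler_wpM2l ?ltW//; lra.
rewrite /mid_itv integral_cst//= lebesgue_measure_itv/= lte_fin.
have d0 : 0 < 2 * a / N%:R by rewrite divr_gt0// mulr_gt0.
rewrite ltr_pM2l// ifT; last by lra.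
rewrite -EFinB -EFinM lee_fin ioE le_eqVlt; apply/orP; left; apply/eqP; field.
by rewrite gt_eqF.
Qed.

Lemma mass_mid J : (((io / (2 * N%:R)) ^+ n)%:E <= mu (mid J))%E.
Proof.
case: hii => _ _ _ _ hind.
rewrite /mid hind ?iota_uniq//; last by move=> i; exact: measurable_itv.
rewrite -[X in (_ ^+ X)%:E](size_iota 0 n); apply: lee_prod_cst.
  by rewrite ioE divr_ge0// !mulr_ge0// ltW.
by move=> i; exact: mass_mid_itv.
Qed.

Definition cell_fun (A : R) (J : {ffun 'I_n -> 'I_N}) (x : X) : R :=
  A * cell_bump k cell_dir sh (fun=> 0%N) J x.

Let beta : R := ((3 / 16) ^+ k.+1) ^+ n.

Let tot0 : (total_order (fun _ : 'I_n => 0%N) <= k)%N.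
Proof. by rewrite /total_order big1. Qed.

Lemma cell_bump_mid J x : mid J x -> beta <= cell_bump k cell_dir sh (fun=> 0%N) J x.
Proof.
move=> hx; rewrite /beta -[X in _ ^+ X](size_index_enum_ord n); apply: ler_prod_cst.
  by rewrite exprn_ge0// divr_ge0.
by move=> i; apply: bump0_ge; exact: mid_in.
Qed.

Lemma cell_bump_neq0_unique x (J J' : {ffun 'I_n -> 'I_N}) : cell_bump k cell_dir sh (fun=> 0%N) J x != 0 ->
  cell_bump k cell_dir sh (fun=> 0%N) J' x != 0 -> J = J'.
Proof.
by move=> h h'; apply: (@cell_unique _ _ _ _ cell_dir sh x); apply: cell_bump_neq0; eauto.
Qed.

Let beta0 : 0 < beta. Proof. by rewrite /beta !exprn_gt0// divr_gt0. Qed.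

Variables (A : R) (u : Y).
Hypotheses (A0 : 0 < A) (u1 : `|u| = 1).

Lemma signed_sum_mid (S : {set {ffun 'I_n -> 'I_N}}) theta x :
  A * beta * \sum_(J in S) \1_(mid J) x <= `|signed_sum (cell_fun A) u S theta x|.
Proof.
case: (pselect (exists2 J, J \in S & mid J x)) => [[J0 J0S hJ0]|nex]; last first.
  rewrite big1 ?mulr0// => J JS; rewrite indicE; case: (boolP (x \in mid J)) => // /set_mem h.
  by case: nex; exists J.
have cJ0 := cell_bump_mid hJ0.
have cn0 : cell_bump k cell_dir sh (fun=> 0%N) J0 x != 0.
  by rewrite gt_eqF// (lt_le_trans beta0).
have z J : J \in S -> J != J0 -> cell_bump k cell_dir sh (fun=> 0%N) J x = 0.
  move=> JS JJ0; apply/eqP; apply: contraNT JJ0 => h; apply/eqP.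
  exact: cell_bump_neq0_unique h cn0.
rewrite /signed_sum normrZ u1 mulr1 (bigD1 J0)//= big1 => [|J /andP[JS JJ0]]; last first.
  rewrite indicE; case: (boolP (x \in mid J)) => // /set_mem /cell_bump_mid.
  by rewrite z// leNgt beta0.
rewrite (bigD1 J0)//= big1 => [|J /andP[JS JJ0]]; last first.
  by rewrite /cell_fun z// !mulr0.
rewrite indicE mem_set// !addr0 mulr1 normrM normrX normrN1 expr1n mul1r /cell_fun normrM.
by rewrite (gtr0_norm A0) ler_pM2l// (le_trans cJ0)// ler_norm.
Qed.

(** The number of cells cancels: half of the N^n cells, each with a middle of mass at least
    (io/(2N))^n, have total mass at least (io/2)^n / 2, and on these middles the function has norm
    at least [A * beta]. *)
Lemma Lp_norm_signed_sum (S : {set {ffun 'I_n -> 'I_N}}) theta :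
  (#|{ffun 'I_n -> 'I_N}| <= 2 * #|S|)%N ->
  ((A * beta * ((io / 2) ^+ n / 2) `^ p^-1)%:E <=
    Lp_norm mu p (signed_sum (cell_fun A) u S theta))%E.
Proof.
move=> hS; have p0 : 0 < p by exact: lt_le_trans p1.
have Ab0 : 0 <= A * beta by rewrite mulr_ge0// ltW.
have io0 : 0 <= io by rewrite ioE !mulr_ge0// ltW.
have i0 : 0 <= (io / 2) ^+ n / 2 by rewrite divr_ge0// exprn_ge0// divr_ge0.
rewrite Lp_normE//.
have -> : (A * beta * ((io / 2) ^+ n / 2) `^ p^-1)%:E =
    ((((A * beta) `^ p) * ((io / 2) ^+ n / 2))%:E `^ p^-1)%E.
  by rewrite poweR_EFin (@powRM _ ((A * beta) `^ p)) ?powR_ge0// -powRrM mulfV ?gt_eqF// powRr1.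
have int0 (f : X -> R) : (0 <= \int[mu]_x (`|f x| `^ p)%:E)%E.
  by apply: integral_ge0 => x _; rewrite lee_fin powR_ge0.
apply: gt0_ler_poweR.
- by rewrite invr_ge0 ltW.
- by rewrite in_itv /= leey lee_fin mulr_ge0// powR_ge0.
- by rewrite in_itv /= leey andbT integral_ge0// => x _; rewrite lee_fin powR_ge0.
apply: (@le_trans _ _ (\int[mu]_x \sum_(J in S) ((A * beta) `^ p * \1_(mid J) x)%:E)%E).
  under eq_integral do rewrite -big_enum /=.
  rewrite ge0_integral_sum//; last 2 first.
  - move=> J; apply/measurable_EFinP; apply: measurable_funM => //.
    by apply: measurable_indic; exact: mid_measurable.
  - by move=> J x _; rewrite lee_fin mulr_ge0// ?powR_ge0.
  have hJ J : (((A * beta) `^ p * (io / (2 * N%:R)) ^+ n)%:E <=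
      \int[mu]_x ((A * beta) `^ p * \1_(mid J) x)%:E)%E.
    under eq_integral do rewrite EFinM.
    have mi : measurable_fun setT (EFin \o (\1_(mid J : set (borel X)) : borel X -> R)).
      by apply/measurable_EFinP/measurable_indic; exact: mid_measurable.
    have i0' x : setT x -> (0 <= (\1_(mid J) x : R)%:E)%E by rewrite lee_fin.
    have Ap : (0 <= ((A * beta) `^ p)%:E)%E by rewrite lee_fin powR_ge0.
    rewrite (ge0_integralZl _ measurableT mi i0' Ap).
    rewrite integral_indic//; last exact: mid_measurable.
    by rewrite setIT EFinM lee_wpmul2l ?lee_fin ?powR_ge0//; exact: mass_mid.
  apply: (@le_trans _ _ (\sum_(J <- enum S) ((A * beta) `^ p * (io / (2 * N%:R)) ^+ n)%:E)%E); last first.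
    by apply: lee_sum => J _; exact: hJ.
  rewrite sumEFin big_const_seq count_predT -cardE iter_addr addr0 lee_fin -mulrnAr.
  rewrite ler_wpM2l ?powR_ge0//.
  have -> : io / (2 * N%:R) = (io / 2) / N%:R by field; rewrite gt_eqF.
  have : 0 <= io / 2 by rewrite divr_ge0.
  move: (io / 2) => q q0.
  rewrite exprMn -[leRHS]mulr_natr -[leRHS]mulrA ler_wpM2l ?exprn_ge0//.
  rewrite exprVn ler_pdivlMl ?exprn_gt0// ler_pdivrMr// -natrX -natrM ler_nat.
  by move: hS; rewrite card_ffun !card_ord mulnC.
apply: ge0_le_integral_nomeas => x.
  by apply: sume_ge0 => J _; rewrite lee_fin mulr_ge0// powR_ge0.
rewrite sumEFin lee_fin -mulr_sumr.
have h := signed_sum_mid S theta x.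
case: (pselect (exists2 J, J \in S & mid J x)) => [[J0 J0S hJ0]|nex]; last first.
  rewrite big1 ?mulr0 ?powR_ge0// => J JS; rewrite indicE.
  by case: (boolP (x \in mid J)) => // /set_mem ?; case: nex; exists J.
have one : \sum_(J in S) \1_(mid J) x = 1 :> R.
  rewrite (bigD1 J0)//= big1 => [|J /andP[JS JJ0]]; first by rewrite addr0 indicE mem_set.
  rewrite indicE; case: (boolP (x \in mid J)) => // /set_mem hJ.
  have nz J' : mid J' x -> cell_bump k cell_dir sh (fun=> 0%N) J' x != 0.
    by move=> /cell_bump_mid /(lt_le_trans beta0) /gt_eqF ->.
  by rewrite (cell_bump_neq0_unique (nz _ hJ) (nz _ hJ0)) eqxx in JJ0.
rewrite one mulr1 in h; rewrite one mulr1.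
by rewrite ge0_ler_powR ?nnegrE// ltW.
Qed.

Variable K : R.
Hypothesis K1 : 1 <= K.
Hypothesis hK : forall j t s, (j <= k)%N ->
  [/\ `|hbump k j t| <= K, `|hbump k j (t + s) - hbump k j t| <= K * `|s| &
      (j < k)%N -> `|hbump k j (t + s) - hbump k j t - hbump k j.+1 t * s| <= K * s ^+ 2].

Let eta : R := Num.max 1 (N%:R / (2 * a * Num.sqrt (lambda n.-1))).

Hypothesis hA : k.+3%:R * A * K ^+ n * (n%:R * eta) ^+ k.+1 <= B.

Let eta1 : 1 <= eta. Proof. by rewrite /eta le_max lexx. Qed.

Lemma signed_sum_cell_function theta :
  signed_sum (cell_fun A) u [set: {ffun 'I_n -> 'I_N}]%SET theta =
  (fun x => cell_function k cell_dir sh (fun J => (-1) ^+ theta J * A) (fun=> 0%N) x *: u).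
Proof.
apply/funext => x; rewrite /signed_sum; congr (_ *: _).
by apply: eq_big => [J|J _]; rewrite ?inE// /cell_fun mulrA.
Qed.

Let hth theta (J : {ffun 'I_n -> 'I_N}) : `|(-1) ^+ (theta J : bool) * A| <= A.
Proof. by rewrite normrM normrX normrN1 expr1n mul1r gtr0_norm. Qed.

Lemma signed_sum_C_ball theta :
  C_ball k alpha B (signed_sum (cell_fun A) u [set: {ffun 'I_n -> 'I_N}]%SET theta).
Proof.
rewrite signed_sum_cell_function.
apply: (@cell_function_C_ball _ _ _ _ _ _ cell_dir sh _ alpha eta A K u) => //.
- exact: norm_cell_dir.
- exact: ltW.
Qed.

Lemma signed_sum_Lp theta :
  Lp mu p (signed_sum (cell_fun A) u [set: {ffun 'I_n -> 'I_N}]%SET theta).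
Proof.
rewrite signed_sum_cell_function.
apply: (@Lp_bounded _ _ _ _ _ p1 _ (A * K ^+ n)).
  apply: (lipschitz_borel_measurable (L := 2 * (A * (n%:R * K ^+ n * eta)))) => x y.
  rewrite -scalerBl normrZ u1 mulr1 -!mulrA.
  have := cell_function_lipschitz sh eta1 norm_cell_dir (ltW A0) (hth theta) K1 hK x y tot0.
  by rewrite -!mulrA.
move=> x; rewrite normrZ u1 mulr1.
exact: (cell_function_le _ _ (ltW A0) (hth theta) K1 hK).
Qed.

Lemma cell_fun_support x : (#|[set J | cell_fun A J x != 0%R]%SET| <= 1)%N.
Proof.
apply/card_le1_eqP => J J'; rewrite !inE /cell_fun !mulf_eq0 !negb_or => /andP[_ h] /andP[_ h'].
exact: cell_bump_neq0_unique h' h.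
Qed.

Let kappa := A * beta * ((io / 2) ^+ n / 2) `^ p^-1.

Let hcard : (2 * m <= #|{ffun 'I_n -> 'I_N}|)%N.
Proof. by rewrite card_ffun !card_ord. Qed.

Lemma minimax_lower (M : \bar R) :
  M = fixed_design_minimax mu gamma sigma p (C_ball k alpha B) m \/
  M = random_design_minimax mu gamma sigma p (C_ball k alpha B) m ->
  ((kappa / 2)%:E <= M)%E.
Proof.
have obs F d (T : measurableType d) (fx : T -> borel X) (fe : T -> borel Y) : Lp mu p F ->
    measurable_fun setT fx -> measurable_fun setT fe ->
    measurable_fun setT ((fun t => observation sigma F (fx t) (fe t)) : T -> borel Y).
  move=> [mF _] mx me; apply: borel_measurableD => //; last exact: borel_measurableZ.
  exact: (measurableT_comp mF mx).
case=> ->; apply: le_ereal_inf_tmp => _ [D _ <-]; apply: le_ereal_inf_tmp => _ [Fhat eF <-].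
- pose dat F (E : m.-tuple (borel Y)) : m.-tuple (borel Y) :=
    [tuple observation sigma F (tnth D i) (tnth E i) | i < m].
  have mdat theta : measurable_fun setT
      (dat (signed_sum (cell_fun A) u [set: {ffun 'I_n -> 'I_N}]%SET theta)).
    apply/measurable_fun_tnthP => i.
    rewrite (_ : _ \o _ = (fun E => observation sigma
        (signed_sum (cell_fun A) u [set: {ffun 'I_n -> 'I_N}]%SET theta) (tnth D i) (tnth E i))).
      by apply: obs; [exact: signed_sum_Lp|exact: measurable_cst|exact: measurable_tnth].
    by apply/funext => E; rewrite /= tnth_mktuple.
  have hdat F F' E : (forall i, F (tnth D i) = F' (tnth D i)) -> dat F E = dat F' E.
    by move=> hF; apply: eq_from_tnth => i; rewrite !tnth_mktuple /observation hF.
  exact: (zero_information_bound p1 sY signed_sum_Lp cell_fun_support hcard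
    Lp_norm_signed_sum (iid_law gamma m) eF mdat hdat signed_sum_C_ball).
- pose dat F (z : m.-tuple (borel X) * m.-tuple (borel Y)) : m.-tuple (borel X * borel Y)%type :=
    [tuple (tnth z.1 i, observation sigma F (tnth z.1 i) (tnth z.2 i)) | i < m].
  have mdat theta : measurable_fun setT
      (dat (signed_sum (cell_fun A) u [set: {ffun 'I_n -> 'I_N}]%SET theta)).
    apply/measurable_fun_tnthP => i.
    rewrite (_ : _ \o _ = (fun z => (tnth z.1 i, observation sigma
        (signed_sum (cell_fun A) u [set: {ffun 'I_n -> 'I_N}]%SET theta) (tnth z.1 i) (tnth z.2 i)))); last first.
      by apply/funext => E; rewrite /= tnth_mktuple.
    have m1 : measurable_fun setT (fun z : m.-tuple (borel X) * m.-tuple (borel Y) => tnth z.1 i).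
      by apply: (measurableT_comp (measurable_tnth i)); exact: measurable_fst.
    have m2 : measurable_fun setT (fun z : m.-tuple (borel X) * m.-tuple (borel Y) => tnth z.2 i).
      by apply: (measurableT_comp (measurable_tnth i)); exact: measurable_snd.
    apply: measurable_fun_pair => //.
    by apply: obs; [exact: signed_sum_Lp|exact: m1|exact: m2].
  have hdat F F' z : (forall i, F (tnth z.1 i) = F' (tnth z.1 i)) -> dat F z = dat F' z.
    by move=> hF; apply: eq_from_tnth => i; rewrite !tnth_mktuple /observation hF.
  exact: (zero_information_bound p1 sY signed_sum_Lp cell_fun_support hcard
    Lp_norm_signed_sum (iid_law D m \x iid_law gamma m)%E eF mdat hdat signed_sum_C_ball).
Qed.

End lower_bound.

(** * Upper bound *)

Section C_ball_facts.
Context {R : realType} {X Y : hilbertType R}.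
Variables (k : nat) (alpha B : R).
Hypotheses (alpha0 : 0 < alpha) (alpha1 : alpha <= 1).
Variable x1 : X.
Hypothesis x1_neq0 : x1 != 0.

Lemma opnorm_ler j (T : ('I_j -> X) -> Y) (K : R) v : (opnorm T <= K%:E)%E ->
  (forall i, `|v i| <= 1) -> `|T v| <= K.
Proof.
by move=> hT hv; rewrite -lee_fin; apply: le_trans hT; apply: ereal_sup_ubound; exists v.
Qed.

(** The nonzero vector [x1] matters: over a trivial space the Hölder seminorm is the supremum of the
    empty set, that is -oo, and a bound on [C_norm] would say nothing about the other terms. *)
Lemma C_norm_terms (D : forall j, X -> ('I_j -> X) -> Y) : (C_norm k alpha D <= B%:E)%E ->
  (forall j x, (j <= k)%N -> (opnorm (D j x) <= B%:E)%E) /\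
  (holder_seminorm alpha (D k) <= B%:E)%E.
Proof.
rewrite /C_norm => hB.
have s0 j : (0 <= ereal_sup [set opnorm (D j x) | x in setT])%E.
  apply: le_trans (opnorm_ge0 (D j 0)) _; apply: ereal_sup_ubound; by exists 0.
have hs0 : (0 <= holder_seminorm alpha (D k))%E.
  apply: (@le_trans _ _ (opnorm (fun v => (D k x1 v - D k 0 v)%R)
                   * ((`|x1 - 0| `^ alpha)^-1)%:E)%E).
    by rewrite mule_ge0 ?opnorm_ge0// lee_fin invr_ge0 powR_ge0.
  by apply: ereal_sup_ubound; exists (x1, 0).
split; last by apply: le_trans hB; rewrite leeDr// sume_ge0.
move=> j x; rewrite -ltnS => jk; apply: le_trans hB.
apply: (@le_trans _ _ (\sum_(j < k.+1) ereal_sup [set opnorm (D j x) | x in setT])%E).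
  rewrite (bigD1 (Ordinal jk))//=.
  apply: (@le_trans _ _ (ereal_sup [set opnorm (D j x) | x in setT])).
    by apply: ereal_sup_ubound; exists x.
  by rewrite leeDl// sume_ge0.
by rewrite leeDl.
Qed.

Lemma le_of_sqr_le_mul (w c : R) : 0 <= w -> w ^+ 2 <= c * w -> 0 <= c -> w <= c.
Proof.
rewrite le_eqVlt => /predU1P[<-//|w0]; rewrite expr2 => h _.
by rewrite -(ler_pM2r w0).
Qed.

(** Pairing with [w = F y - F x] reduces the claim to the scalar mean value theorem on the segment;
    it gives |w|^2 <= C |h| |w|, from which one factor |w| cancels. *)
Lemma mean_value_lipschitz (F : X -> Y) (L : X -> X -> Y) (C : R) : 0 <= C ->
  (forall x (e : R), 0 < e -> \forall h \near (0 : X), `|F (x + h) - F x - L x h| <= e * `|h|) ->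
  (forall x h, `|L x h| <= C * `|h|) -> (forall x h (t : R), L x (t *: h) = t *: L x h) ->
  forall x y, `|F y - F x| <= C * `|y - x|.
Proof.
move=> C0 hF hL hLZ x y; set h := y - x; set w := F y - F x.
pose g (t : R) := '<F (x + t *: h), w>.
pose dg (t : R) := '<L (x + t *: h) h, w>.
have gd (t : R) : is_derive t 1 g (dg t).
  have cv : (fun s : R => s^-1 *: (g (s *: 1 + t) - g t)) @ 0^' --> dg t.
    apply/cvgrPdist_le => eps eps0.
    have M0 : 0 < `|h| * `|w| + 1 by rewrite ltr_wpDl// mulr_ge0.
    have e0 : 0 < eps / (`|h| * `|w| + 1) by exact: divr_gt0.
    have := hF (x + t *: h) _ e0 => hn.
    have zh : (fun s : R => s *: h) @ 0^' --> (0 : X).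
      rewrite -(scale0r h); apply: cvg_within_filter.
      exact: (@scalel_continuous _ _ h).
    have {}hn := zh _ hn.
    near=> s.
    have s0 : s != 0 by near: s; exact: nbhs_dnbhs_neq.
    have hs : `|F (x + t *: h + s *: h) - F (x + t *: h) - L (x + t *: h) (s *: h)| <=
        eps / (`|h| * `|w| + 1) * `|s *: h| by near: s.
    have -> : dg t - s^-1 *: (g (s *: 1 + t) - g t) =
        - (s^-1 * '<F (x + t *: h + s *: h) - F (x + t *: h) - L (x + t *: h) (s *: h), w>).
      rewrite /dg /g hLZ !innerBl innerZl.
      have -> : x + (s *: 1 + t) *: h = x + t *: h + s *: h.
        by rewrite scalerDl -addrA (addrC (t *: h)) [s *: 1]mulr1.
      rewrite /GRing.scale /=; field; exact: s0.
    rewrite normrN normrM normfV.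
    apply: (@le_trans _ _ (`|s|^-1 * (eps / (`|h| * `|w| + 1) * `|s *: h| * `|w|))).
      rewrite ler_wpM2l ?invr_ge0//; apply: le_trans (cauchy_schwarz _ _) _.
      by rewrite ler_wpM2r.
    have ns0 : `|s| != 0 by rewrite normr_eq0.
    rewrite normrZ.
    have -> : `|s|^-1 * (eps / (`|h| * `|w| + 1) * (`|s| * `|h|) * `|w|) =
       eps * ((`|h| * `|w|) / (`|h| * `|w| + 1)).
      by field; rewrite ns0 gt_eqF.
    by rewrite ler_piMr ?(ltW eps0)// ler_pdivrMr// mul1r lerDl.
  split; first by apply/cvg_ex; exists (dg t).
  exact: (cvg_lim _ cv).
have [c _ hc] := @MVT_segment R g dg 0 1 ler01 (fun t _ => gd t)
  (derivable_within_continuous (fun t _ => @ex_derive _ _ _ _ _ _ _ (gd t))).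
have xh : x + h = y by rewrite /h addrC subrK.
move: hc; rewrite subr0 mulr1 /g scale0r addr0 scale1r xh -innerBl -/w inner_norm.
move=> wE; apply: le_of_sqr_le_mul => //; last by rewrite mulr_ge0.
rewrite wE; apply: le_trans (ler_norm _) _; apply: le_trans (cauchy_schwarz _ _) _.
by rewrite ler_wpM2r.
Unshelve. all: by end_near. Qed.

Lemma C_ball_bounded F x : C_ball (X := X) (Y := Y) k alpha B F -> `|F x| <= B.
Proof.
move=> [D [D0 _ _] /C_norm_terms[hD _]].
by rewrite -(D0 x (fun=> 0)); apply: (opnorm_ler (hD 0%N x _)) => // -[].
Qed.

(** For [k = 0] this is the seminorm. For [k > 0] the first derivative is bounded by [B], which
    gives a Lipschitz bound for points at distance at most 1, and the sup norm serves the others.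
    The upper bound uses no further smoothness: its rate has the same form for every [k]. *)
Lemma C_ball_holder F x y : C_ball (X := X) (Y := Y) k alpha B F ->
  `|F x - F y| <= 2 * B * (`|x - y| `^ alpha).
Proof.
move=> hF; have [D [D0 Dm Dd] /C_norm_terms[hD hH]] := hF.
have B0 : 0 <= B by exact: le_trans (normr_ge0 _) (C_ball_bounded 0 hF).
have [->|xy] := eqVneq x y; first by rewrite subrr normr0 mulr_ge0 ?powR_ge0// mulr_ge0.
have d0 : 0 < `|x - y| by rewrite normr_gt0 subr_eq0.
have [k0|k0] := posnP k.
  have : (opnorm (fun v => (D k x v - D k y v)%R) * ((`|x - y| `^ alpha)^-1)%:E <= B%:E)%E.
    by apply: le_trans hH; apply: ereal_sup_ubound; exists (x, y).
  rewrite muleC lee_pdivrMl ?powR_gt0// -EFinM => hop.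
  move: hop; rewrite k0 => /(@opnorm_ler 0%N _ _ (fun=> 0)); rewrite !D0 => hop.
  apply: (@le_trans _ _ (`|x - y| `^ alpha * B)); first by apply: hop => -[].
  by rewrite mulrC ler_wpM2r ?powR_ge0// mulrDl mul1r lerDl.
pose L z h := D 1%N z (vcons h (fun=> 0)).
have LE z h : L z h = D 1%N z [eta (fun=> 0) with ord0 |-> h].
  by congr (D 1%N z _); apply/funext => i; rewrite /vcons (ord1 i) unlift_none /=.
have L0 z : L z 0 = 0.
  have [_ ml] := Dm 1%N z k0; have := ml (fun=> 0) ord0 1 0 0.
  by rewrite scaler0 addr0 scale1r -!LE => /eqP; rewrite -subr_eq0 opprD addrA subrr sub0r oppr_eq0 => /eqP.
have LZ z h t : L z (t *: h) = t *: L z h.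
  have [_ ml] := Dm 1%N z k0; have := ml (fun=> 0) ord0 t h 0.
  by rewrite addr0 -!LE L0 addr0.
have Lb z h : `|L z h| <= B * `|h|.
  have [->|h0] := eqVneq h 0; first by rewrite L0 !normr0 mulr0.
  have nh : 0 < `|h| by rewrite normr_gt0.
  have -> : h = `|h| *: (`|h|^-1 *: h) by rewrite scalerA divff ?gt_eqF// scale1r.
  rewrite LZ !normrZ normr_id normfV normr_id mulVf ?gt_eqF// mulr1 mulrC ler_wpM2r//.
  apply: (opnorm_ler (hD 1%N z k0)) => i.
  by rewrite /vcons (ord1 i) unlift_none /= normrZ normfV normr_id mulVf ?gt_eqF.
have lip : `|F x - F y| <= B * `|x - y|.
  apply: (@mean_value_lipschitz F L) => // z e e0.
  have := Dd 0%N k0 z e e0; apply: filterS => h /opnorm_ler hop.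
  by have := hop (fun=> 0); rewrite !D0; apply => -[].
have [xy1|xy1] := leP `|x - y| 1.
  apply: le_trans lip _; apply: (@le_trans _ _ (B * (`|x - y| `^ alpha))).
    by rewrite ler_wpM2l// -[leLHS]powRr1//; apply: ger_powR => //; rewrite d0.
  by rewrite ler_wpM2r ?powR_ge0// mulrDl mul1r lerDl.
apply: (@le_trans _ _ (2 * B)).
  apply: le_trans (ler_normB _ _) _.
  have h1 := C_ball_bounded x hF; have h2 := C_ball_bounded y hF; lra.
by rewrite ler_peMr ?mulr_ge0// -(powRr0 `|x - y|) ler_powR ?ltW.
Qed.

End C_ball_facts.

Lemma uniform_probability_exists (R : realType) (X : hilbertType R) (I : finType)
    (c : I -> X) : (0 < #|I|)%N -> injective c ->
  exists nu : probability (borel X) R,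
    forall J, (nu [set c J] = (#|I|%:R^-1)%:E)%E.
Proof.
move=> I0 cI; have [J0 _] : exists J0, J0 \in I by move/card_gt0P: I0 => [J0 ?]; exists J0.
pose m_ (i : nat) : {measure set (borel X) -> \bar R} := \d_(c (nth J0 (enum I) i) : borel X).
exists (mnormalize (msum m_ #|I|) (\d_(0 : borel X))) => J.
have mT : (msum m_ #|I| setT = #|I|%:R%:E)%E.
  rewrite /msum; under eq_bigr do rewrite /m_ /= diracT.
  by rewrite sumEFin big_const_ord iter_addr addr0.
(* [mnormalize] falls back on the Dirac mass at 0 when the total mass is 0 or infinite; here it is
   [#|I|]. *)
have mnE (ev : \bar R) (f g : set X -> \bar R) : ev = #|I|%:R%:E ->
    (if (ev == 0%E) || (ev == +oo%E) then f else fun U => (g U * ((fine ev)^-1)%:E)%E) [set c J]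
    = (g [set c J] * (#|I|%:R^-1)%:E)%E.
  move=> ->; rewrite ifF//.
  by rewrite orbF eqe pnatr_eq0 -leqn0 leqNgt I0.
apply: (eq_trans (mnE _ _ _ mT)).
rewrite -[RHS]mul1e; congr (_ * _)%E.
change (\sum_(i < #|I|) m_ i [set c J] = 1)%E.
have hJ : (index J (enum I) < #|I|)%N by rewrite cardE index_mem mem_enum.
rewrite (bigD1 (Ordinal hJ))//= big1 => [|i iJ].
  by rewrite adde0 /m_ /= nth_index ?mem_enum// diracE mem_set.
rewrite /m_ /= diracE memNset//= => /cI iE.
case/eqP: iJ; apply: val_inj => /=; rewrite -iE index_uniq ?enum_uniq//.
by rewrite -cardE.
Qed.

(** * The sampling estimator and its risk *)

Section sampling.
Context {R : realType} {X Y : hilbertType R}.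
Variables (mu : probability (borel X) R) (p : R).
Hypotheses (p1 : 1 <= p) (sY : separable Y).
Variables (I : finType) (c : I -> X) (q : X -> option I) (d : nat -> Y) (eps w : R) (m : nat).
Hypothesis cI : injective c.
Hypothesis mq : forall o, measurable (q @^-1` [set o] : set (borel X)).
Hypothesis eps0 : 0 < eps.
Hypothesis hd : forall (y : Y) (e : R), 0 < e -> exists n, `|y - d n| < e.

Definition label (x : X) : option I := [pick J | c J == x].

Lemma labelE x J : (label x == Some J) = (c J == x).
Proof.
rewrite /label; case: pickP => [J' /eqP <-|/(_ J) -> //].
by rewrite (inj_eq cI) eq_sym; apply/eqP/eqP => [[->]|->].
Qed.

Lemma set1_borel_measurable (x : X) : measurable ([set x] : set (borel X)).
Proof.
rewrite -[X in measurable X]setCK; apply: measurableC; apply: borel_open.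
exact/closed_openC/(@accessible_closed_set1 X (hausdorff_accessible (@norm_hausdorff R X))).
Qed.

Lemma label_measurable o : measurable (label @^-1` [set o] : set (borel X)).
Proof.
have mS J : measurable (label @^-1` [set Some J] : set (borel X)).
  rewrite (_ : _ @^-1` _ = [set c J]); first exact: set1_borel_measurable.
  apply/seteqP; split=> x /=; first by move/eqP; rewrite labelE => /eqP.
  by move=> ->; apply/eqP; rewrite labelE.
case: o => [J|]; first exact: mS.
rewrite (_ : _ @^-1` _ = ~` \bigcup_(J in [set: I]) (label @^-1` [set Some J])).
  by apply: measurableC; apply: fin_bigcup_measurable.
apply/seteqP; split=> x /=; first by move=> h [J _ /=]; rewrite h.
by move=> h; case E : (label x) => [J|//]; case: h; exists J.
Qed.

(* Responses are rounded to a countable dense set, so that the estimator factors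
   through a countable type and is measurable for any sigma-algebra on L^p. *)
Definition ridx (y : Y) : nat := ex_minn (hd y eps0).

Lemma ridxP y : `|y - d (ridx y)| < eps.
Proof. by rewrite /ridx; case: ex_minnP. Qed.

Lemma ridx_measurable n : measurable (ridx @^-1` [set n] : set (borel Y)).
Proof.
have mB i : measurable ([set y | `|y - d i| < eps] : set (borel Y)).
  apply: borel_open; rewrite (_ : [set y | _] = ball (d i) eps); first exact: ball_open.
  by apply/seteqP; split=> y /=; rewrite -ball_normE /= distrC.
rewrite (_ : _ @^-1` _ = [set y | `|y - d n| < eps] `&`
    \bigcap_(i in `I_n) ~` [set y | `|y - d i| < eps]).
  apply: measurableI => //; apply: fin_bigcap_measurable; first exact: finite_II.
  by move=> i _; exact: measurableC.
apply/seteqP; split=> y /=.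
  rewrite /ridx; case: ex_minnP => j hj hmin <-; split => // i /= ij hi.
  by have := hmin _ hi; rewrite leqNgt ij.
rewrite /ridx; case: ex_minnP => j hj hmin [hn hlt]; apply/eqP.
rewrite eqn_leq hmin//= leqNgt; apply/negP => jn.
exact: (hlt _ jn hj).
Qed.

Definition sample_code (xy : borel X * borel Y) : option I * nat := (label xy.1, ridx xy.2).

Lemma sample_code_measurable o : measurable (sample_code @^-1` [set o]).
Proof.
case: o => o n; rewrite (_ : _ @^-1` _ =
  (label @^-1` [set o] : set (borel X)) `*` (ridx @^-1` [set n] : set (borel Y))).
  by apply: measurableX; [exact: label_measurable|exact: ridx_measurable].
by apply/seteqP; split=> -[x y] /=; rewrite /sample_code /= => -[-> ->].
Qed.

(** In the application [w] is #|I| / m, the inverse of the expected number of samples at a center.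
    Dividing by the expected count, not the observed one, keeps the estimator linear in the rounded
    responses and defined at centers that were never sampled. *)
Definition cell_estimator (s : m.-tuple (option I * nat)) (x : X) : Y :=
  if q x is Some J
  then w *: \sum_(i < m) (if (tnth s i).1 == Some J then d (tnth s i).2 else 0)
  else 0.

Lemma cell_estimator_Lp s : Lp mu p (cell_estimator s).
Proof.
pose f (o : option I) : Y := if o is Some J
  then w *: \sum_(i < m) (if (tnth s i).1 == Some J then d (tnth s i).2 else 0)
  else 0.
have fE : cell_estimator s = f \o q by [].
apply: (@Lp_bounded _ _ _ _ _ p1 _ (\sum_o `|f o|)) => [|x].
  apply: measurable_fun_borel => U _; rewrite fE.
  exact: (@measurable_countable_factor _ (borel X) (option I) Y q f U mq).
rewrite fE /= (bigD1 (q x))//= lerDl; exact: sumr_ge0.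
Qed.

Lemma cell_estimator_estimator dd (T : measurableType dd) (h : 'I_m -> T -> borel X * borel Y) :
  (forall i, measurable_fun setT (h i)) ->
  estimator mu p (fun t : T => cell_estimator [tuple sample_code (h i t) | i < m]).
Proof.
move=> mh; split=> [t|U _]; first exact: cell_estimator_Lp.
apply: (@measurable_countable_factor _ T (m.-tuple (option I * nat)) _
  (fun t => [tuple sample_code (h i t) | i < m]) cell_estimator U) => s.
rewrite (_ : _ @^-1` _ = \bigcap_(i in [set: 'I_m]) (h i @^-1` (sample_code @^-1` [set tnth s i]))).
  apply: fin_bigcap_measurable => // i _.
  by rewrite -[X in measurable X]setTI; apply: mh => //; exact: sample_code_measurable.
apply/seteqP; split=> t /=.
  by move=> <- i _ /=; rewrite tnth_mktuple.
by move=> ht; apply: eq_from_tnth => i; rewrite tnth_mktuple; exact: ht.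
Qed.

End sampling.

Lemma integral_if d (T : measurableType d) (R : realType) (P : probability T R)
    (f : T -> bool) (r s t : R) :
  measurable (f @^-1` [set true]) -> (P (f @^-1` [set true]) = r%:E)%E ->
  P.-integrable setT (fun x => (if f x then s else t)%:E) /\
  (\int[P]_x (if f x then s else t)%:E = (t + (s - t) * r)%:E)%E.
Proof.
move=> mA PA; set A := f @^-1` [set true] in mA PA.
have fE x : (if f x then s else t)%:E = (t%:E + (s - t)%:E * (\1_A x)%:E)%E.
  rewrite indicE -EFinM -EFinD; congr EFin.
  case: (boolP (f x)) => fx; first by rewrite mem_set//= mulr1 addrC subrK.
  by rewrite memNset ?mulr0 ?addr0//= /A /=; apply/negP.
have i1 : P.-integrable setT (fun x => (\1_A x)%:E).
  by apply: integrable_indic => //; rewrite PA ltry.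
have i2 : P.-integrable setT (fun x => ((s - t)%:E * (\1_A x)%:E)%E).
  exact: integrableZl.
have i3 : P.-integrable setT (cst t%:E) by exact: finite_measure_integrable_cst.
have -> : (fun x => (if f x then s else t)%:E) =
    (fun x => t%:E + (s - t)%:E * (\1_A x)%:E)%E by apply/funext.
split; first by apply: (@integrableD _ _ _ P _ measurableT _ _ i3 i2).
rewrite (integralD measurableT i3 i2) integral_cst_probability integralZl//.
rewrite integral_indic// setIT; have /= -> := PA.
by rewrite -EFinM -EFinD.
Qed.

Lemma Lnorm_nonneg d (T : measurableType d) (R : realType) (P : probability T R)
    (p : R) (f : T -> R) : (forall x, 0 <= f x) ->
  (Lnorm P p%:E (EFin \o f) = (\int[P]_x (f x `^ p)%:E) `^ p^-1)%E.
Proof.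
move=> f0; rewrite unlock; congr (_ `^ _)%E; apply: eq_integral => x _.
by rewrite /= ger0_norm// poweR_EFin.
Qed.

Section risk.
Context {R : realType} {X Y : hilbertType R}.
Variables (mu : probability (borel X) R) (gamma : probability (borel Y) R) (p sigma B : R).
Hypotheses (p1 : 1 <= p) (sY : separable Y).
Hypotheses (sigma0 : 0 < sigma) (B0 : 0 < B) (hg : gaussian_noise gamma).
Variables (I : finType) (c : I -> X) (q : X -> option I) (d : nat -> Y) (eps : R) (m : nat).
Hypothesis cI : injective c.
Hypothesis mq : forall o, measurable (q @^-1` [set o] : set (borel X)).
Hypothesis eps0 : 0 < eps.
Hypothesis hd : forall (y : Y) (e : R), 0 < e -> exists n, `|y - d n| < e.
Hypotheses (m0 : (0 < m)%N) (I0 : (0 < #|I|)%N).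

Let N : R := #|I|%:R.
Let s : R := Num.sqrt m%:R.
Let w : R := N / m%:R.

Let N1 : 1 <= N. Proof. by rewrite /N ler1n. Qed.
Let N0 : 0 < N. Proof. exact: lt_le_trans N1. Qed.
Let mR : 0 < m%:R :> R. Proof. by rewrite ltr0n. Qed.
Let s0 : 0 < s. Proof. by rewrite sqrtr_gt0. Qed.
Let w0 : 0 < w. Proof. exact: divr_gt0. Qed.
Let s2 : s ^+ 2 = m%:R. Proof. by rewrite sqr_sqrtr// ltW. Qed.

Let lab := label c.

(* [m^-1 * count_dev xs J] is the relative deviation of the number of design
   points at [c J] from its expectation [m / N] under the uniform design. *)
Definition count_dev (xs : m.-tuple X) (J : I) : R :=
  \sum_(i < m) (if lab (tnth xs i) == Some J then N - 1 else - 1).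

Definition noise_sum (xs : m.-tuple X) (E : m.-tuple Y) (J : I) : Y :=
  \sum_(i < m) (if lab (tnth xs i) == Some J then tnth E i else 0).

Definition est (F : X -> Y) (xs : m.-tuple X) (E : m.-tuple Y) : X -> Y :=
  cell_estimator q d w
    [tuple sample_code c eps0 hd (tnth xs i, observation sigma F (tnth xs i) (tnth E i)) | i < m].

Variable g : X -> R.
Hypothesis mg : measurable_fun setT (g : borel X -> R).
Hypothesis g0 : forall x, 0 <= g x.
Variable class : set (X -> Y).
Hypothesis class_bounded : forall F x, class F -> `|F x| <= B.
Hypothesis class_cell : forall F x J, class F -> q x = Some J -> `|F x - F (c J)| <= g x.
Hypothesis class_out : forall F x, class F -> q x = None -> `|F x| <= g x.

Definition cell_error xs E J : R :=
  B / m%:R * `|count_dev xs J| + w * sigma * `|noise_sum xs E J|.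

(** A response at [c J] is [F (c J)] plus scaled noise, up to rounding. The error is thus the
    fluctuation of the count times [F (c J)], plus the weighted noise, plus at most m roundings of
    size [eps] with weight N/m. *)
Lemma est_cell_error F xs E x J : class F -> q x = Some J ->
  `|F (c J) - est F xs E x| <= cell_error xs E J + N * eps.
Proof.
move=> cF qx; rewrite /est /cell_estimator qx.
pose b i := lab (tnth xs i) == Some J.
pose y i := observation sigma F (tnth xs i) (tnth E i).
under eq_bigr do rewrite tnth_mktuple.
have yE i : b i -> y i = F (c J) + sigma *: tnth E i.
  by rewrite /b /y /observation labelE// => /eqP ->.
have -> : F (c J) - w *: \sum_(i < m) (if (sample_code c eps0 hd (tnth xs i, y i)).1 == Some J
     then d (sample_code c eps0 hd (tnth xs i, y i)).2 else 0) =
  - ((count_dev xs J / m%:R) *: F (c J)) - (w * sigma) *: noise_sum xs E J +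
   w *: \sum_(i < m) (if b i then y i - d (ridx eps0 hd (y i)) else 0).
  have cE : count_dev xs J / m%:R = w * (\sum_(i < m) (if b i then 1 else 0)) - 1.
    have -> : count_dev xs J = \sum_(i < m) (N * (if b i then 1 else 0) - 1).
      by apply: eq_bigr => i _; rewrite /b; case: ifP => _; rewrite ?mulr1 ?mulr0 ?sub0r.
    rewrite sumrB -mulr_sumr big_const_ord iter_addr addr0 /w.
    by rewrite mulrBl divff ?gt_eqF// mulrAC.
  have -> : \sum_(i < m) (if (sample_code c eps0 hd (tnth xs i, y i)).1 == Some J
     then d (sample_code c eps0 hd (tnth xs i, y i)).2 else 0) =
    (\sum_(i < m) (if b i then 1 else 0)) *: F (c J) + sigma *: noise_sum xs E J -
    \sum_(i < m) (if b i then y i - d (ridx eps0 hd (y i)) else 0).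
    rewrite /noise_sum scaler_suml scaler_sumr -sumrN -!big_split /=.
    apply: eq_bigr => i _; rewrite -/lab -/(b i); case: ifP => [bi|_].
      by rewrite scale1r -yE// opprB addrC subrK.
    by rewrite scale0r scaler0 oppr0 !addr0.
  rewrite cE scalerBl scale1r opprB scalerBr scalerDr !scalerA.
  by rewrite opprB opprD (addrC (w *: _)) !addrA.
rewrite /cell_error; apply: le_trans (ler_normD _ _) _.
apply: lerD.
  apply: le_trans (ler_normB _ _) _; rewrite normrN !normrZ; apply: lerD.
    rewrite normfV (gtr0_norm mR) mulrAC [leRHS]mulrAC ler_wpM2r ?invr_ge0 ?(ltW mR)//.
    by rewrite mulrC ler_wpM2r// class_bounded.
  by rewrite normfV (gtr0_norm mR) (gtr0_norm N0) (gtr0_norm sigma0).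
rewrite normrZ gtr0_norm// /w -mulrA ler_pM2l// mulrC ler_pdivrMr//.
apply: le_trans (ler_norm_sum _ _ _) _.
apply: (@le_trans _ _ (\sum_(i < m) eps)).
  by apply: ler_sum => i _; case: ifP => _; [exact/ltW/ridxP|rewrite normr0 ltW].
by rewrite big_const_ord iter_addr addr0 mulr_natr.
Qed.

Lemma cell_error_ge0 xs E J : 0 <= cell_error xs E J.
Proof. by rewrite addr_ge0// !mulr_ge0// ?invr_ge0 ltW. Qed.

(** Summing over all cells makes the stochastic part independent of [x], so it leaves the L^p norm
    as a constant; the price is one more factor N. *)
Lemma est_error F xs E x : class F ->
  `|F x - est F xs E x| <= g x + (N * eps + \sum_J cell_error xs E J).
Proof.
move=> cF; case qx : (q x) => [J|]; last first.
  rewrite /est /cell_estimator qx subr0 (le_trans (class_out cF qx))// lerDl addr_ge0//.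
    by rewrite mulr_ge0// ltW.
  by apply: sumr_ge0 => J _; exact: cell_error_ge0.
rewrite -[F x](subrK (F (c J))) -addrA (le_trans (ler_normD _ _))// lerD//.
  exact: class_cell.
apply: le_trans (est_cell_error xs E cF qx) _; rewrite addrC lerD2l (bigD1 J)//= lerDl.
by apply: sumr_ge0 => J' _; exact: cell_error_ge0.
Qed.

(** The bound |t| <= s + t^2 / s, with s = sqrt m, converts second moments proportional to m into
    first-moment bounds proportional to sqrt m. The same is done in [noise_term]. *)
Definition design_term (xs : m.-tuple X) : R :=
  \sum_J B / m%:R * (s + count_dev xs J ^+ 2 / s).

Definition noise_term (xs : m.-tuple X) (E : m.-tuple Y) : R :=
  \sum_J w * sigma * (s + `|noise_sum xs E J| ^+ 2 / s).

Lemma le_add_sqr_div (t : R) : `|t| <= s + `|t| ^+ 2 / s.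
Proof.
have [ts|ts] := leP `|t| s; first by rewrite (le_trans ts)// lerDl divr_ge0 ?sqr_ge0// ltW.
rewrite (@le_trans _ _ (`|t| ^+ 2 / s))//; last by rewrite lerDr ltW.
by rewrite ler_pdivlMr// expr2 ler_wpM2l// ltW.
Qed.

Lemma sum_cell_error_le xs E : \sum_J cell_error xs E J <= design_term xs + noise_term xs E.
Proof.
rewrite -big_split /=; apply: ler_sum => J _; apply: lerD.
  have Bm : 0 <= B / m%:R by rewrite divr_ge0// ltW.
  rewrite ler_wpM2l//.
  by have := le_add_sqr_div (count_dev xs J); rewrite real_normK ?num_real.
have ws : 0 <= w * sigma by rewrite mulr_ge0// ltW.
rewrite ler_wpM2l//.
by have := le_add_sqr_div `|noise_sum xs E J|; rewrite normr_id.
Qed.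

Variable G : R.
Hypothesis hG : ((\int[mu]_x (g x `^ p)%:E) `^ p^-1 <= G%:E)%E.

Lemma loss_le F xs E : class F ->
  (Lp_norm mu p (F - est F xs E)%R <=
   (G + N * eps + design_term xs + noise_term xs E)%:E)%E.
Proof.
move=> cF; set C := N * eps + \sum_J cell_error xs E J.
have C0 : 0 <= C.
  rewrite addr_ge0//; first by rewrite mulr_ge0// ltW.
  by apply: sumr_ge0 => J _; exact: cell_error_ge0.
apply: (@le_trans _ _ (G%:E + C%:E)%E); last first.
  by rewrite -EFinD lee_fin -!addrA !lerD2l sum_cell_error_le.
apply: le_trans (Lp_norm_le_Lnorm mu p1 (fun x => est_error xs E x cF)) _.
have hm := @minkowski_EFin _ _ _ mu g (cst C) p mg (measurable_cst C) p1.
have gC x : 0 <= (g \+ cst C) x by rewrite /= addr_ge0.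
rewrite -(Lnorm_nonneg mu p gC); apply: le_trans hm _; apply: leeD.
  by rewrite Lnorm_nonneg.
rewrite (Lnorm_nonneg mu p (fun=> C0)) integral_cst_probability poweR_EFin -powRrM.
by rewrite mulfV ?powRr1// gt_eqF// (lt_le_trans _ p1).
Qed.

Lemma label_eq_measurable J : measurable_fun setT (fun x : borel X => lab x == Some J).
Proof.
apply: (measurable_fun_bool true); rewrite setTI.
rewrite (_ : _ @^-1` _ = lab @^-1` [set Some J]); first exact: label_measurable.
by apply/seteqP; split=> x /=; [move/eqP|move/eqP].
Qed.

Lemma count_dev_measurable J :
  measurable_fun setT (fun xs : m.-tuple (borel X) => count_dev xs J).
Proof.
apply: measurable_sum => i; apply: measurable_fun_ifT => //.
by apply: (measurableT_comp (label_eq_measurable J)); exact: measurable_tnth.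
Qed.

Lemma noise_sum_measurable dd (T : measurableType dd) (fx : T -> m.-tuple (borel X))
    (fe : T -> m.-tuple (borel Y)) J : measurable_fun setT fx -> measurable_fun setT fe ->
  measurable_fun setT ((fun t => noise_sum (fx t) (fe t) J) : T -> borel Y).
Proof.
move=> mx me; apply: (@borel_measurable_sum _ _ _ _ _ _ (fun (i : 'I_m) t =>
  if lab (tnth (fx t) i) == Some J then tnth (fe t) i else (0 : borel Y))) => // i.
apply: measurable_fun_ifT => //; last first.
  exact: (measurableT_comp (measurable_tnth i) me).
apply: (measurableT_comp (label_eq_measurable J)).
exact: (measurableT_comp (measurable_tnth i) mx).
Qed.

Lemma noise_sum_moment xs J :
  (\int[iid_law gamma m]_E (`|noise_sum xs E J| ^+ 2)%:E <= m%:R%:E)%E.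
Proof.
pose b i := if insub i is Some i' then lab (tnth xs i') == Some J else false.
pose h i (e : borel Y) : borel Y := if b i then e else 0.
have := @iid_second_moment _ _ sY _ _ gamma m h 1.
rewrite mulr1; under eq_integral => E _.
  rewrite (_ : \sum_(i < m) _ = noise_sum xs E J); last first.
    by apply: eq_bigr => i _; rewrite /h /b valK.
  over.
apply.
- by move=> i; rewrite /h; case: (b i) => //; exact: measurable_cst.
- move=> i; rewrite /h; case: (b i); first by rewrite (noise_second_moment sY hg).
  under eq_integral do rewrite normr0 expr0n.
  by rewrite integral0 lee_fin.
- move=> i y; rewrite /h; case: (b i); first exact: noise_mean0.
  split; last by under eq_integral do rewrite inner0l; rewrite integral0.
  by under eq_fun do rewrite inner0l; exact: integrable0.
Qed.

Let ms : m%:R / s = s. Proof. by rewrite -s2 expr2 mulfK// gt_eqF. Qed.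

Lemma noise_term_measurable dd (T : measurableType dd) (fx : T -> m.-tuple (borel X))
    (fe : T -> m.-tuple (borel Y)) : measurable_fun setT fx -> measurable_fun setT fe ->
  measurable_fun setT (fun t => noise_term (fx t) (fe t)).
Proof.
move=> mx me; apply: measurable_sum => J; apply: measurable_funM => //.
apply: measurable_funD => //; apply: measurable_funM => //; apply: measurable_funX.
by apply: borel_measurable_norm; exact: noise_sum_measurable.
Qed.

Lemma design_term_measurable :
  measurable_fun setT (fun xs : m.-tuple (borel X) => design_term xs).
Proof.
apply: measurable_sum => J; apply: measurable_funM => //.
apply: measurable_funD => //; apply: measurable_funM => //; apply: measurable_funX.
exact: count_dev_measurable.
Qed.

Lemma integral_AMGM dd (T : measurableType dd) (Q : probability T R) (a b : R) (f : T -> R) :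
  0 <= a -> measurable_fun setT f -> (forall t, 0 <= f t) ->
  (\int[Q]_t (f t)%:E <= b%:E)%E ->
  (\int[Q]_t (a * (s + f t / s))%:E <= (a * (s + b / s))%:E)%E.
Proof.
move=> a0 mf f0 fb.
have si : 0 <= s^-1 by rewrite invr_ge0 ltW.
under eq_integral do rewrite EFinM EFinD (mulrC (f _)) (EFinM s^-1).
have m1 : measurable_fun setT (fun t => (s^-1%:E * (f t)%:E)%E).
  by apply: emeasurable_funM => //; exact/measurable_EFinP.
rewrite ge0_integralZl//; last first.
- by move=> t _; rewrite adde_ge0 ?mule_ge0 ?lee_fin// ltW.
- exact: emeasurable_funD.
rewrite ge0_integralD//; last 2 first.
- by move=> t _; rewrite lee_fin ltW.
- by move=> t _; rewrite mule_ge0 ?lee_fin.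
rewrite integral_cst_probability ge0_integralZl//; last 2 first.
- exact/measurable_EFinP.
- by move=> t _; rewrite lee_fin.
rewrite EFinM lee_wpmul2l ?lee_fin// EFinD leeD2l// mulrC EFinM lee_wpmul2l//.
Qed.

Lemma noise_term_integral xs :
  (\int[iid_law gamma m]_E (noise_term xs E)%:E <= (N * (2 * (w * sigma * s)))%:E)%E.
Proof.
have ws : 0 <= w * sigma by rewrite mulr_ge0// ltW.
have mJ J : measurable_fun setT (fun E : m.-tuple (borel Y) => `|noise_sum xs E J| ^+ 2).
  apply: measurable_funX; apply: borel_measurable_norm.
  by apply: noise_sum_measurable => //; exact: measurable_cst.
under eq_integral do rewrite /noise_term -sumEFin.
rewrite ge0_integral_sum//; last 2 first.
- move=> J; apply/measurable_EFinP; apply: measurable_funM => //.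
  by apply: measurable_funD => //; exact: measurable_funM.
- by move=> J E _; rewrite lee_fin mulr_ge0// addr_ge0 ?divr_ge0 ?sqr_ge0// ltW.
apply: (@le_trans _ _ (\sum_(J : I) (w * sigma * (s + m%:R / s))%:E)%E).
  apply: lee_sum => J _; apply: integral_AMGM => //.
  exact: noise_sum_moment.
rewrite sumEFin big_const iter_addr addr0 ms lee_fin -/N -[leLHS]mulr_natl -/N.
by rewrite le_eqVlt; apply/orP; left; apply/eqP; ring.
Qed.

Variable nu : probability (borel X) R.
Hypothesis hnu : forall J, (nu [set c J] = (N^-1)%:E)%E.

Let nulab J : (nu ((fun x => lab x == Some J) @^-1` [set true]) = (N^-1)%:E)%E.
Proof.
rewrite -(hnu J); congr (nu _); apply/seteqP; split=> x /=.
  by rewrite /lab labelE// => /eqP.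
by move=> ->; rewrite /lab labelE// eqxx.
Qed.

Let mlab J : measurable ((fun x => lab x == Some J) @^-1` [set true] : set (borel X)).
Proof. by rewrite -[X in measurable X]setTI; exact: label_eq_measurable. Qed.

(** Each summand is N times the indicator of an event of probability 1/N, minus 1: it has mean 0 and
    variance N - 1. Multiplying by a unit vector of [Y] makes [iid_second_moment] applicable. *)
Lemma count_dev_moment J :
  (\int[iid_law nu m]_xs (count_dev xs J ^+ 2)%:E <= (m%:R * N)%:E)%E.
Proof.
have [u u1] := noise_unit_vector hg.
pose h (_ : nat) (x : borel X) : borel Y := (if lab x == Some J then N - 1 else - 1) *: u.
have := @iid_second_moment _ _ sY _ _ nu m h N.
under eq_integral => xs _.
  rewrite -scaler_suml normrZ u1 mulr1 real_normK ?num_real// -/(count_dev xs J); over.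
apply => i.
- rewrite /h; apply: measurable_fun_borel => U oU.
  have -> : (fun x : borel X => (if lab x == Some J then N - 1 else - 1) *: u) =
      (fun x => if lab x == Some J then ((N - 1) *: u : borel Y) else - 1 *: u).
    by apply/funext => x; case: ifP.
  apply: measurable_fun_borel_open => //; apply: measurable_fun_ifT => //.
  exact: label_eq_measurable.
- rewrite /h; under eq_integral => x _.
    rewrite normrZ u1 mulr1 real_normK ?num_real//.
    rewrite (_ : _ ^+ 2 = if lab x == Some J then (N - 1) ^+ 2 else 1); last first.
      by case: ifP => _; rewrite ?sqrrN ?expr1n.
    over.
  have [_ ->] := @integral_if _ _ _ nu (fun x => lab x == Some J) _ ((N - 1) ^+ 2) 1 (mlab J) (nulab J).
  rewrite lee_fin; have -> : 1 + ((N - 1) ^+ 2 - 1) / N = N - 1 by field; rewrite gt_eqF.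
  by rewrite lerBlDr lerDl.
- move=> y.
  have fE : (fun x : borel X => '<h i x, y>%:E) =
      (fun x => (if lab x == Some J then (N - 1) * '<u, y> else - '<u, y>)%:E).
    by apply/funext => x; rewrite /h innerZl; case: ifP => _; rewrite ?mulN1r.
  rewrite fE.
  have [? ->] := @integral_if _ _ _ nu (fun x => lab x == Some J) _ ((N - 1) * '<u, y>) (- '<u, y>)
    (mlab J) (nulab J).
  split=> //; congr EFin; field; by rewrite gt_eqF.
Qed.

Let Dbound : R := N * (B / m%:R * (s + N * s)).

Lemma design_term_integral :
  (\int[iid_law nu m]_xs (design_term xs)%:E <= Dbound%:E)%E.
Proof.
have Bm : 0 <= B / m%:R by rewrite divr_ge0// ltW.
have mJ J : measurable_fun setT (fun xs : m.-tuple (borel X) => count_dev xs J ^+ 2).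
  by apply: measurable_funX; exact: count_dev_measurable.
under eq_integral do rewrite /design_term -sumEFin.
rewrite ge0_integral_sum//; last 2 first.
- move=> J; apply/measurable_EFinP; apply: measurable_funM => //.
  by apply: measurable_funD => //; exact: measurable_funM.
- by move=> J E _; rewrite lee_fin mulr_ge0// addr_ge0 ?divr_ge0 ?sqr_ge0// ltW.
apply: (@le_trans _ _ (\sum_(J : I) (B / m%:R * (s + m%:R * N / s))%:E)%E).
  apply: lee_sum => J _; apply: integral_AMGM => //.
    by move=> xs; exact: sqr_ge0.
  exact: count_dev_moment.
rewrite sumEFin big_const iter_addr addr0 (mulrAC m%:R) ms lee_fin -[leLHS]mulr_natl -/N.
by rewrite /Dbound (mulrC s).
Qed.

Lemma design_term_ge0 xs : 0 <= design_term xs.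
Proof.
apply: sumr_ge0 => J _; rewrite mulr_ge0//; first by rewrite divr_ge0// ltW.
by rewrite addr_ge0 ?divr_ge0 ?sqr_ge0// ltW.
Qed.

Lemma noise_term_ge0 xs E : 0 <= noise_term xs E.
Proof.
apply: sumr_ge0 => J _; rewrite mulr_ge0//; first by rewrite mulr_ge0// ltW.
by rewrite addr_ge0 ?divr_ge0 ?sqr_ge0// ltW.
Qed.

Lemma G_ge0 : 0 <= G.
Proof. by rewrite -lee_fin; apply: le_trans hG; exact: poweR_ge0. Qed.

Let Nbound : R := N * (2 * (w * sigma * s)).

Let Neps0 : 0 <= N * eps. Proof. by rewrite mulr_ge0// ltW. Qed.

Lemma conditional_risk F xs : class F ->
  (\int[iid_law gamma m]_E Lp_norm mu p (F - est F xs E)%R <=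
   (G + N * eps + design_term xs + Nbound)%:E)%E.
Proof.
move=> cF.
have c0 : 0 <= G + N * eps + design_term xs.
  by rewrite !addr_ge0 ?G_ge0 ?design_term_ge0.
apply: (@le_trans _ _ (\int[iid_law gamma m]_E
    ((G + N * eps + design_term xs)%:E + (noise_term xs E)%:E))%E).
  apply: ge0_le_integral_nomeas => E; first exact: Lp_norm_ge0.
  by rewrite -EFinD; exact: loss_le.
rewrite ge0_integralD//; last 2 first.
- by move=> E _; rewrite lee_fin noise_term_ge0.
- by apply/measurable_EFinP; apply: noise_term_measurable => //; exact: measurable_cst.
by rewrite integral_cst_probability [leRHS]EFinD leeD2l// noise_term_integral.
Qed.

Let D0 : 0 < Dbound.
Proof.
apply: mulr_gt0 => //; apply: mulr_gt0; first exact: divr_gt0.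
by rewrite addr_gt0// mulr_gt0.
Qed.

(** Derandomization: the mean of [design_term] under the random design is at most [Dbound], which is
    positive, so some deterministic design stays below [2 * Dbound]. *)
Lemma fixed_design_upper :
  (fixed_design_minimax mu gamma sigma p class m <=
   (G + N * eps + 2 * Dbound + Nbound)%:E)%E.
Proof.
have [xs hxs] : exists xs : m.-tuple X, design_term xs <= 2 * Dbound.
  apply: contrapT => /forallNP h.
  have : ((2 * Dbound)%:E <= Dbound%:E)%E.
    apply: le_trans design_term_integral.
    rewrite -[leLHS](integral_cst_probability (iid_law nu m)).
    apply: ge0_le_integral_nomeas => xs; first by rewrite lee_fin mulr_ge0// ltW.
    by rewrite lee_fin ltW// ltNge; apply/negP.
  by rewrite lee_fin leNgt ltr_pMl ?ltr1n// D0.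
apply: (@le_trans _ _ (ereal_sup [set fixed_design_risk mu gamma sigma p xs
    (fun t => cell_estimator q d w [tuple sample_code c eps0 hd (tnth xs i, tnth t i) | i < m]) F
    | F in class])).
  apply: (@le_trans _ _ (ereal_inf [set ereal_sup [set fixed_design_risk mu gamma sigma p xs Fhat F
     | F in class] | Fhat in @estimator R X Y mu p _ (m.-tuple (borel Y))])).
    by apply: ereal_inf_lbound; exists xs.
  apply: ereal_inf_lbound.
  exists (fun t => cell_estimator q d w [tuple sample_code c eps0 hd (tnth xs i, tnth t i) | i < m]) => //.
  apply: (@cell_estimator_estimator R X Y mu p p1 I c q d eps w m cI mq eps0 hd _ _
    (fun (i : 'I_m) (t : m.-tuple (borel Y)) => (tnth xs i : borel X, tnth t i))) => i.
  by apply: measurable_fun_pair => //; exact: measurable_tnth.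
apply: ge_ereal_sup => _ [F cF <-]; rewrite /fixed_design_risk.
apply: (@le_trans _ _ (G + N * eps + design_term xs + Nbound)%:E); last first.
  by rewrite lee_fin lerD2r lerD2l.
apply: le_trans (conditional_risk xs cF); rewrite le_eqVlt; apply/orP; left; apply/eqP.
apply: eq_integral => E _; congr (Lp_norm _ _ (_ - _)); rewrite /est; congr (cell_estimator _ _ _ _).
by apply: eq_from_tnth => i; rewrite !tnth_mktuple.
Qed.

Lemma random_design_upper :
  (random_design_minimax mu gamma sigma p class m <=
   (G + N * eps + 2 * Dbound + Nbound)%:E)%E.
Proof.
pose Fh (t : m.-tuple (borel X * borel Y)%type) : X -> Y :=
  cell_estimator q d w [tuple sample_code c eps0 hd (tnth t i) | i < m].
have c0 xs : 0 <= G + N * eps + design_term xs.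
  by rewrite !addr_ge0 ?G_ge0 ?design_term_ge0.
apply: (@le_trans _ _ (ereal_sup [set random_design_risk mu gamma sigma p nu Fh F | F in class])).
  apply: (@le_trans _ _ (ereal_inf [set ereal_sup [set random_design_risk mu gamma sigma p nu Fhat F
     | F in class] | Fhat in @estimator R X Y mu p _ (m.-tuple (borel X * borel Y)%type)])).
    by apply: ereal_inf_lbound; exists nu.
  apply: ereal_inf_lbound; exists Fh => //.
  apply: (@cell_estimator_estimator R X Y mu p p1 I c q d eps w m cI mq eps0 hd _ _
    (fun (i : 'I_m) (t : m.-tuple (borel X * borel Y)%type) => tnth t i)) => i.
  exact: measurable_tnth.
apply: ge_ereal_sup => _ [F cF <-]; rewrite /random_design_risk.
pose U (z : m.-tuple (borel X) * m.-tuple (borel Y)) : R :=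
  G + N * eps + design_term z.1 + noise_term z.1 z.2.
apply: (@le_trans _ _ (\int[iid_law nu m \x iid_law gamma m]_z (U z)%:E)%E).
  apply: ge0_le_integral_nomeas => z; first exact: Lp_norm_ge0.
  apply: le_trans (loss_le z.1 z.2 cF); rewrite le_eqVlt; apply/orP; left; apply/eqP.
  congr (Lp_norm _ _ (_ - _)); rewrite /est /Fh; congr (cell_estimator _ _ _ _).
  by apply: eq_from_tnth => i; rewrite !tnth_mktuple.
have mU : measurable_fun setT U.
  apply: measurable_funD; last by apply: noise_term_measurable.
  apply: measurable_funD => //; apply: (measurableT_comp design_term_measurable).
  exact: measurable_fst.
rewrite fubini_tonelli1//; last 2 first.
- exact/measurable_EFinP.
- by move=> z; rewrite lee_fin addr_ge0 ?noise_term_ge0.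
apply: (@le_trans _ _ (\int[iid_law nu m]_xs
    ((G + N * eps + Nbound)%:E + (design_term xs)%:E))%E).
  apply: ge0_le_integral_nomeas => xs.
    by apply: integral_ge0 => E _; rewrite lee_fin addr_ge0 ?noise_term_ge0.
  rewrite /fubini_F /U /=; under eq_integral do rewrite EFinD.
  rewrite ge0_integralD//; last 3 first.
  - by move=> E _; rewrite lee_fin.
  - by move=> E _; rewrite lee_fin noise_term_ge0.
  - by apply/measurable_EFinP; apply: noise_term_measurable => //; exact: measurable_cst.
  rewrite integral_cst_probability.
  apply: (@le_trans _ _ ((G + N * eps + design_term xs)%:E + Nbound%:E)%E).
    by rewrite leeD2l// noise_term_integral.
  by rewrite -!EFinD lee_fin addrAC.
rewrite ge0_integralD//; last 3 first.
- by move=> xs _; rewrite lee_fin !addr_ge0 ?G_ge0// !mulr_ge0// ltW.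
- by move=> xs _; rewrite lee_fin design_term_ge0.
- by apply/measurable_EFinP; exact: design_term_measurable.
rewrite integral_cst_probability.
apply: (@le_trans _ _ ((G + N * eps + Nbound)%:E + Dbound%:E)%E).
  by rewrite leeD2l// design_term_integral.
rewrite -EFinD lee_fin -!addrA !lerD2l addrC lerD2r.
by rewrite ler_peMl ?(ltW D0)// ler1n.
Qed.

End risk.

(** * The cubic grid and the bias *)

Section grid.
Context {R : realType} {X : hilbertType R}.
Variables (mu : probability (borel X) R) (lambda : nat -> R) (phi : nat -> X).
Hypotheses (hii : condition_ii mu lambda phi).
Variables (n K : nat) (h : R).
Hypotheses (h0 : 0 < h) (K0 : (0 < K)%N).

Let phi_orth i j : '<phi i, phi j> = (i == j)%:R.
Proof. by case: hii => _ _ [+ _] _ _; apply. Qed.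

Lemma phi_orthonormal_or_zero : orthonormal_or_zero phi.
Proof.
move=> i j; rewrite phi_orth; suff -> : phi i != 0 by rewrite andbT.
by apply/eqP => pi0; have /eqP := phi_orth i i; rewrite pi0 inner0l eqxx eq_sym oner_eq0.
Qed.

Lemma phi_complete x : partial_proj phi j x @[j --> \oo] --> x.
Proof.
case: hii => _ _ [_ /(_ x)] + _ _; rewrite /partial_proj.
rewrite (_ : (fun j => \sum_(i < j | (i : nat) \in setT) '<x, phi i> *: phi i) =
  fun j => \sum_(i < j) '<x, phi i> *: phi i)//.
by apply/funext => j; apply: eq_bigl => i; rewrite in_setT.
Qed.

Lemma sqr_norm_sub_lincomb (t : 'I_n -> R) x :
  `|x - \sum_(i < n) t i *: phi i| ^+ 2 =
  `|x - partial_proj phi n x| ^+ 2 + \sum_(i < n) ('<x, phi i> - t i) ^+ 2.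
Proof.
have h1 (i : 'I_n) : '<\sum_(j < n) t j *: phi j, phi i> = t i.
  rewrite inner_suml (bigD1 i)//= innerZl phi_orth eqxx mulr1 big1 ?addr0// => j ji.
  by rewrite innerZl phi_orth; move: ji; rewrite -val_eqE => /negbTE ->; rewrite mulr0.
have eT : '<\sum_(i < n) t i *: phi i, \sum_(i < n) t i *: phi i> = \sum_(i < n) t i ^+ 2.
  by rewrite inner_sumr; apply: eq_bigr => i _; rewrite innerZr h1 expr2.
have eR : '<x, \sum_(i < n) t i *: phi i> = \sum_(i < n) t i * '<x, phi i>.
  by rewrite inner_sumr; apply: eq_bigr => i _; rewrite innerZr.
have -> : \sum_(i < n) ('<x, phi i> - t i) ^+ 2 = \sum_(i < n) '<x, phi i> ^+ 2 +
    (-2 * \sum_(i < n) t i * '<x, phi i> + \sum_(i < n) t i ^+ 2).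
  by rewrite mulr_sumr -!big_split; apply: eq_bigr => i _ /=; ring.
rewrite (sqr_norm_sub_partial_proj phi_orthonormal_or_zero).
rewrite -eT (inner_norm (\sum_(i < n) _)) -(scaleN1r (\sum_(i < n) _)) sqr_normD.
rewrite innerZr eR normrZ normrN1 mul1r.
ring.
Qed.

Definition grid_coord (J : {ffun 'I_n -> 'I_(2 * K)}) (i : 'I_n) : R := h * ((J i)%:R - K%:R).

(** In the first n coordinates this is the lowest corner of the cell. Cells are half open, so the
    corner belongs to its own cell, which makes the map injective; each coordinate of a point of the
    cell is within [h] of it. The 2K intervals per side cover [-Kh, Kh). *)
Definition grid_center (J : {ffun 'I_n -> 'I_(2 * K)}) : X := \sum_(i < n) grid_coord J i *: phi i.

Definition in_cell (J : {ffun 'I_n -> 'I_(2 * K)}) (x : X) : bool :=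
  [forall i, (grid_coord J i <= '<x, phi i>) && ('<x, phi i> < grid_coord J i + h)].

Definition cell_of (x : X) : option {ffun 'I_n -> 'I_(2 * K)} := [pick J | in_cell J x].

Lemma in_cell_unique J J' x : in_cell J x -> in_cell J' x -> J = J'.
Proof.
move=> /forallP h1 /forallP h2; apply/ffunP => i; apply: val_inj => /=.
have /andP[a1 a2] := h1 i; have /andP[b1 b2] := h2 i.
have e1 : (J i)%:R < (J' i).+1%:R :> R.
  rewrite -natr1 -(ltr_pM2l h0); move: a1 b2; rewrite /grid_coord => a1 b2; lra.
have e2 : (J' i)%:R < (J i).+1%:R :> R.
  rewrite -natr1 -(ltr_pM2l h0); move: b1 a2; rewrite /grid_coord => a1' b2'; lra.
rewrite !ltr_nat !ltnS in e1 e2.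
by apply/eqP; rewrite eqn_leq e1 e2.
Qed.

Lemma cell_of_Some x J : (cell_of x == Some J) = in_cell J x.
Proof.
rewrite /cell_of; case: pickP => [J' hJ'|/(_ J) ->//].
apply/eqP/idP => [[<-//]|hJ]; congr Some; exact: in_cell_unique hJ' hJ.
Qed.

Lemma grid_center_inj : injective grid_center.
Proof.
move=> J J' e; apply: (@in_cell_unique _ _ (grid_center J)); last rewrite e;
  by apply/forallP => i; rewrite /grid_center inner_suml (bigD1 i)//= innerZl phi_orth eqxx
    mulr1 big1 ?addr0 ?lexx ?ltrDl// => j ji; rewrite innerZl phi_orth;
    move: ji; rewrite -val_eqE => /negbTE ->; rewrite mulr0.
Qed.

Lemma cell_of_measurable o : measurable (cell_of @^-1` [set o] : set (borel X)).
Proof.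
have mS J : measurable (cell_of @^-1` [set Some J] : set (borel X)).
  rewrite (_ : _ @^-1` _ = \bigcap_(i in [set: 'I_n]) ((fun x => '<x, phi i>) @^-1`
      `[grid_coord J i, grid_coord J i + h[%classic)).
    apply: fin_bigcap_measurable => // i _; rewrite -[X in measurable X]setTI.
    by apply: continuous_borel_measurable => //; exact: inner_continuousl.
  apply/seteqP; split=> x /=.
    move=> /eqP; rewrite cell_of_Some => /forallP hx i _ /=; rewrite in_itv /=; exact: hx.
  move=> hx; apply/eqP; rewrite cell_of_Some; apply/forallP => i.
  by have := hx i I; rewrite /= in_itv.
case: o => [J|]; first exact: mS.
rewrite (_ : _ @^-1` _ = ~` \bigcup_(J in [set: {ffun 'I_n -> 'I_(2 * K)}]) (cell_of @^-1` [set Some J])).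
  by apply: measurableC; apply: fin_bigcup_measurable.
apply/seteqP; split=> x /=; first by move=> hx [J _ /=]; rewrite hx.
by move=> hx; case E : (cell_of x) => [J|//]; case: hx; exists J.
Qed.

Lemma norm_phi i : `|phi i| = 1.
Proof. by apply/eqP; rewrite -sqrp_eq1// -inner_norm phi_orth eqxx. Qed.

Lemma cell_of_None x : cell_of x = None -> K%:R * h <= `|x|.
Proof.
move=> qx; rewrite leNgt; apply/negP => xK.
have hx i : `|'<x, phi i>| < K%:R * h.
  by apply: le_lt_trans xK; rewrite (le_trans (cauchy_schwarz _ _))// norm_phi mulr1.
pose v (i : 'I_n) : R := '<x, phi i> / h + K%:R.
have v0 i : 0 <= v i.
  have := hx i; rewrite ltr_norml => /andP[+ _] => hxi.
  rewrite /v -lerBlDr sub0r ler_pdivlMr// mulNr; exact: ltW.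
have v1 i : v i < (2 * K)%:R.
  have := hx i; rewrite ltr_norml => /andP[_ hxi].
  by rewrite /v -ltrBrDr mulSn mul1n natrD addrK ltr_pdivrMr.
have vt i : (Num.trunc (v i) < 2 * K)%N.
  rewrite -(ltr_nat R); apply: le_lt_trans (v1 i); by have /andP[] := truncn_itv (v0 i).
pose J : {ffun 'I_n -> 'I_(2 * K)} := [ffun i => Ordinal (vt i)].
have : in_cell J x.
  apply/forallP => i; rewrite /grid_coord ffunE /=.
  have e : '<x, phi i> = h * (v i - K%:R) by rewrite /v addrK mulrC divfK// gt_eqF.
  have /andP[t1 t2] := truncn_itv (v0 i).
  have -> : h * ((Num.trunc (v i))%:R - K%:R) + h = h * ((Num.trunc (v i)).+1%:R - K%:R).
    by rewrite -natr1; ring.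
  by rewrite e ler_pM2l// ltr_pM2l// lerD2r ltrD2r t1 t2.
by rewrite -cell_of_Some qx.
Qed.

Lemma cell_of_dist x J : cell_of x = Some J ->
  `|x - grid_center J| ^+ 2 <= `|x - partial_proj phi n x| ^+ 2 + n%:R * h ^+ 2.
Proof.
move=> /eqP; rewrite cell_of_Some => /forallP hx.
rewrite sqr_norm_sub_lincomb lerD2l.
apply: (@le_trans _ _ (\sum_(i < n) h ^+ 2)); last first.
  by rewrite big_const_ord iter_addr addr0 mulr_natl.
apply: ler_sum => i _; have /andP[a1 a2] := hx i.
rewrite lerXn2r ?nnegrE ?subr_ge0//; first exact: ltW.
by rewrite lerBlDr addrC ltW.
Qed.

Variables (alpha B p s : R) (k : nat).
Context {Y : hilbertType R}.
Hypotheses (alpha0 : 0 < alpha) (alpha1 : alpha <= 1) (B0 : 0 < B) (p1 : 1 <= p) (s0 : 0 < s).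

(* The power |x - c_J|^alpha is replaced by a quadratic majorant at scale [s], so
   that only second moments enter; the last term is at least 1 outside the grid. *)
Definition bias (x : X) : R :=
  Num.min 1 (s `^ alpha * (1 + (`|x - partial_proj phi n x| ^+ 2 + n%:R * h ^+ 2) / s ^+ 2) +
             `|x| ^+ 2 / (K%:R * h) ^+ 2).

Let Kh0 : 0 < K%:R * h. Proof. by rewrite mulr_gt0// ltr0n. Qed.

Let bias_arg_ge0 x : 0 <= s `^ alpha * (1 + (`|x - partial_proj phi n x| ^+ 2 + n%:R * h ^+ 2) / s ^+ 2) +
             `|x| ^+ 2 / (K%:R * h) ^+ 2.
Proof.
apply: addr_ge0; last by rewrite divr_ge0// sqr_ge0.
apply: mulr_ge0; first exact: powR_ge0.
apply: addr_ge0 => //; apply: divr_ge0; last exact: sqr_ge0.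
by apply: addr_ge0; [exact: sqr_ge0|rewrite mulr_ge0// sqr_ge0].
Qed.

Lemma bias_itv x : 0 <= bias x <= 1.
Proof. by rewrite /bias le_min ler01 ge_min lexx bias_arg_ge0. Qed.

Lemma sqr_dist_proj_continuous : continuous (fun x => `|x - partial_proj phi n x| ^+ 2).
Proof.
rewrite (_ : (fun x => _) = fun x => `|x| ^+ 2 - \sum_(i < n) '<x, phi i> ^+ 2); last first.
  by apply/funext => x; rewrite (sqr_norm_sub_partial_proj phi_orthonormal_or_zero).
move=> x; apply: cvgB; first by apply: cvgM; exact: norm_continuous.
apply: (@continuous_sumr _ _ _ _ (fun (i : 'I_n) x => '<x, phi i> ^+ 2)) => i y.
by apply: cvgM; exact: inner_continuousl.
Qed.

Let m_dist : measurable_fun setT (fun x : borel X => `|x - partial_proj phi n x| ^+ 2).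
Proof. by apply: continuous_borel_measurable; exact: sqr_dist_proj_continuous. Qed.

Let m_norm2 : measurable_fun setT (fun x : borel X => `|x : X| ^+ 2).
Proof.
by apply: measurable_funX; apply: continuous_borel_measurable; exact: norm_continuous.
Qed.

Let m_arg : measurable_fun setT (fun x : borel X =>
   s `^ alpha * (1 + (`|x - partial_proj phi n x| ^+ 2 + n%:R * h ^+ 2) / s ^+ 2) +
             `|x : X| ^+ 2 / (K%:R * h) ^+ 2).
Proof.
apply: measurable_funD; last exact: measurable_funM.
apply: measurable_funM => //; apply: measurable_funD => //; apply: measurable_funM => //.
exact: measurable_funD.
Qed.

Lemma bias_measurable : measurable_fun setT (bias : borel X -> R).
Proof. by apply: measurable_minr. Qed.

(** Up to the scale [s] the constant term dominates; beyond it [y / s >= 1], and raising the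
    exponent from [alpha] to 2 only increases the power. *)
Lemma powR_le_quadratic (y : R) : 0 <= y -> y `^ alpha <= s `^ alpha * (1 + y ^+ 2 / s ^+ 2).
Proof.
move=> y0; have [ys|sy] := leP y s.
  apply: (@le_trans _ _ (s `^ alpha)); first by rewrite ge0_ler_powR ?nnegrE// ltW.
  by rewrite ler_peMr ?powR_ge0// lerDl divr_ge0 ?sqr_ge0.
have z1 : 1 <= y / s by rewrite ler_pdivlMr// mul1r ltW.
have -> : y `^ alpha = s `^ alpha * (y / s) `^ alpha.
  rewrite -powRM ?divr_ge0 ?(ltW s0)// mulrC divfK// gt_eqF//.
rewrite ler_wpM2l ?powR_ge0//; apply: (@le_trans _ _ ((y / s) `^ 1)).
  exact: ler_powR.
rewrite powRr1 ?(le_trans _ z1)// -expr_div_n.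
apply: (@le_trans _ _ ((y / s) ^+ 2)); last by rewrite lerDr.
by rewrite expr2 ler_peMr// (le_trans _ z1).
Qed.

Lemma bias_cell (F : X -> Y) x J : C_ball k alpha B F -> cell_of x = Some J ->
  `|F x - F (grid_center J)| <= 2 * B * bias x.
Proof.
move=> cF qx; have B2 : 0 <= 2 * B by rewrite mulr_ge0// ltW.
have phi0 : phi 0%N != 0 by rewrite -normr_eq0 norm_phi oner_eq0.
rewrite /bias; set z := (X in Num.min 1 X); have [z1|z1] := leP 1 z.
  rewrite mulr1; apply: le_trans (ler_normB _ _) _.
  have := C_ball_bounded phi0 x cF; have := C_ball_bounded phi0 (grid_center J) cF; lra.
apply: le_trans (C_ball_holder alpha0 alpha1 phi0 x (grid_center J) cF) _.
rewrite ler_wpM2l//; apply: le_trans (powR_le_quadratic (normr_ge0 _)) _.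
rewrite /z -[leLHS]addr0 lerD ?divr_ge0 ?sqr_ge0//.
rewrite ler_wpM2l ?powR_ge0// lerD2l ler_wpM2r ?invr_ge0 ?sqr_ge0//.
exact: cell_of_dist.
Qed.

Lemma bias_out (F : X -> Y) x : C_ball k alpha B F -> cell_of x = None ->
  `|F x| <= 2 * B * bias x.
Proof.
move=> cF qx; have phi0 : phi 0%N != 0 by rewrite -normr_eq0 norm_phi oner_eq0.
have -> : bias x = 1.
  rewrite /bias min_l//; apply: (@le_trans _ _ (0 + 1)); first by rewrite add0r.
  apply: lerD.
    apply: mulr_ge0; first exact: powR_ge0.
    apply: addr_ge0 => //; apply: divr_ge0; last exact: sqr_ge0.
    by apply: addr_ge0; [exact: sqr_ge0|rewrite mulr_ge0// sqr_ge0].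
  rewrite ler_pdivlMr ?exprn_gt0// mul1r lerXn2r ?nnegrE ?(ltW Kh0)//.
  exact: cell_of_None.
rewrite mulr1; apply: le_trans (C_ball_bounded phi0 x cF) _.
by rewrite ler_peMl ?(ltW B0)// ler1n.
Qed.

Variables (S T : R).
Hypothesis hS : (\int[mu]_x (`|x : X| ^+ 2)%:E <= S%:E)%E.
Hypothesis hT : (\int[mu]_x (`|x - partial_proj phi n x| ^+ 2)%:E <= T%:E)%E.

Definition bias_bound : R :=
  s `^ alpha * (1 + (T + n%:R * h ^+ 2) / s ^+ 2) + S / (K%:R * h) ^+ 2.

Lemma bias_integral : (\int[mu]_x (bias x)%:E <= bias_bound%:E)%E.
Proof.
set a := s `^ alpha * (1 + n%:R * h ^+ 2 / s ^+ 2); set b := s `^ alpha / s ^+ 2.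
set c := ((K%:R * h) ^+ 2)^-1.
have a0 : 0 <= a.
  apply: mulr_ge0; first exact: powR_ge0.
  by apply: addr_ge0 => //; apply: divr_ge0; [apply: mulr_ge0 => //|]; exact: sqr_ge0.
have b0 : 0 <= b by rewrite divr_ge0 ?powR_ge0 ?sqr_ge0.
have c0 : 0 <= c by rewrite invr_ge0 sqr_ge0.
have -> : bias_bound%:E = (a%:E + (b%:E * T%:E + c%:E * S%:E))%E.
  by rewrite -!EFinM -!EFinD; congr EFin; rewrite /bias_bound /a /b /c; ring.
apply: (@le_trans _ _ (\int[mu]_x (a%:E + (b%:E * (`|x - partial_proj phi n x| ^+ 2)%:E +
    c%:E * (`|x : X| ^+ 2)%:E)))%E).
  apply: ge0_le_integral_nomeas => x; first by rewrite lee_fin; case/andP: (bias_itv x).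
  rewrite -!EFinM -!EFinD lee_fin /bias ge_min; apply/orP; right.
  by rewrite le_eqVlt; apply/orP; left; apply/eqP; rewrite /a /b /c; ring.
have i1 x : setT x -> (0 <= (`|x - partial_proj phi n x| ^+ 2)%:E)%E by rewrite lee_fin sqr_ge0.
have i2 x : setT x -> (0 <= (`|x : X| ^+ 2)%:E)%E by rewrite lee_fin sqr_ge0.
have e1 : measurable_fun setT (fun x : borel X => (`|x - partial_proj phi n x| ^+ 2)%:E).
  exact/measurable_EFinP.
have e2 : measurable_fun setT (fun x : borel X => (`|x : X| ^+ 2)%:E) by exact/measurable_EFinP.
have e3 : measurable_fun setT (fun x : borel X => (b%:E * (`|x - partial_proj phi n x| ^+ 2)%:E)%E).
  by apply: emeasurable_funM.
have e4 : measurable_fun setT (fun x : borel X => (c%:E * (`|x : X| ^+ 2)%:E)%E).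
  by apply: emeasurable_funM.
rewrite ge0_integralD//; last 2 first.
- by move=> x _; rewrite adde_ge0// mule_ge0// lee_fin sqr_ge0.
- exact: emeasurable_funD.
rewrite integral_cst_probability leeD2l//.
rewrite ge0_integralD//; last 2 first.
- by move=> x _; rewrite mule_ge0// lee_fin sqr_ge0.
- by move=> x _; rewrite mule_ge0// lee_fin sqr_ge0.
rewrite !ge0_integralZl//.
by apply: leeD; rewrite lee_wpmul2l.
Qed.

(** The truncation of [bias] at 1 pays off here: [bias x] lies in [0, 1], so its p-th power is at
    most [bias x], and second moments of [mu] suffice for every [p]. *)
Lemma bias_Lp : ((\int[mu]_x ((2 * B * bias x) `^ p)%:E) `^ p^-1 <=
  (2 * B * bias_bound `^ p^-1)%:E)%E.
Proof.
have p0 : 0 < p by exact: lt_le_trans p1.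
have B2 : 0 <= 2 * B by rewrite mulr_ge0// ltW.
have bb0 : 0 <= bias_bound.
  rewrite -lee_fin; apply: le_trans bias_integral; apply: integral_ge0 => x _.
  by rewrite lee_fin; case/andP: (bias_itv x).
have -> : (2 * B * bias_bound `^ p^-1)%:E = (((2 * B) `^ p * bias_bound)%:E `^ p^-1)%E.
  by rewrite poweR_EFin (@powRM _ ((2 * B) `^ p)) ?powR_ge0// -powRrM mulfV ?gt_eqF// powRr1.
apply: gt0_ler_poweR.
- by rewrite invr_ge0 ltW.
- by rewrite in_itv /= leey andbT integral_ge0// => x _; rewrite lee_fin powR_ge0.
- by rewrite in_itv /= leey lee_fin mulr_ge0// powR_ge0.
have ib x : setT x -> (0 <= (bias x)%:E)%E by rewrite lee_fin; case/andP: (bias_itv x).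
apply: (@le_trans _ _ (\int[mu]_x (((2 * B) `^ p)%:E * (bias x)%:E))%E).
  apply: ge0_le_integral_nomeas => x; first by rewrite lee_fin powR_ge0.
  have /andP[b0 b1] := bias_itv x.
  rewrite -EFinM lee_fin powRM// ler_wpM2l ?powR_ge0//.
  have [->|bn0] := eqVneq (bias x) 0; first by rewrite powR0// gt_eqF.
  by rewrite -[leRHS]powRr1//; apply: ger_powR => //; rewrite b1 lt_neqAle eq_sym bn0 b0.
have mb : measurable_fun setT (EFin \o (bias : borel X -> R)).
  by apply/measurable_EFinP; exact: bias_measurable.
have Bp : (0 <= ((2 * B) `^ p)%:E)%E by rewrite lee_fin powR_ge0.
rewrite (ge0_integralZl _ measurableT mb ib Bp).
by rewrite EFinM lee_wpmul2l ?lee_fin ?powR_ge0// bias_integral.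
Qed.

End grid.

(** * Discarded variance and the assembled upper bound *)

Section upper_bound.
Context {R : realType} {X Y : hilbertType R}.
Variables (mu : probability (borel X) R) (gamma : probability (borel Y) R).
Variables (lambda : nat -> R) (phi : nat -> X) (tau omega alpha B sigma p : R) (k : nat).
Hypotheses (hii : condition_ii mu lambda phi).
Hypotheses (tau0 : 0 < tau) (omega1 : 1 <= omega).
Hypothesis lambdaE : forall i, lambda i = expR (- tau * i.+1%:R `^ omega).

Let r : R := expR (- (tau / 2)).

Let r0 : 0 < r. Proof. exact: expR_gt0. Qed.
Let r1 : r < 1. Proof. by rewrite /r expR_lt1 oppr_lt0 divr_gt0. Qed.

(** The exponent is split in halves: one keeps the decay in [n], the other, by i <= (i+1)^omega,
    makes the tail summable. *)
Lemma lambda_le_geometric n i : (n <= i)%N ->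
  lambda i <= expR (- (tau / 2 * n%:R `^ omega)) * r ^+ i.
Proof.
move=> ni; rewrite lambdaE /r -expRM_natl -expRD ler_expR.
have h1 : n%:R `^ omega <= i.+1%:R `^ omega :> R.
  by rewrite ge0_ler_powR ?nnegrE ?ler_nat ?(leq_trans ni)// (le_trans _ omega1).
have h2 : i%:R <= i.+1%:R `^ omega :> R.
  apply: (@le_trans _ _ (i.+1%:R `^ 1)); first by rewrite powRr1// ler_nat.
  by rewrite ler_powR// ler1n.
have t2 : 0 < tau / 2 by rewrite divr_gt0.
have : tau / 2 * n%:R `^ omega + tau / 2 * i%:R <= tau * i.+1%:R `^ omega.
  have -> : tau * i.+1%:R `^ omega = tau / 2 * i.+1%:R `^ omega + tau / 2 * i.+1%:R `^ omega.
    by field.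
  by rewrite lerD// ler_pM2l.
lra.
Qed.

Lemma second_moment_coordinate i :
  (\int[mu]_x ('<x, phi i> ^+ 2)%:E = (lambda i)%:E)%E.
Proof.
case: hii => _ _ [po _] [C cC cE] _.
have := cC (phi i) (phi i); rewrite cE innerZl po// eqxx mulr1 => <-.
by apply: eq_integral => x _; rewrite expr2.
Qed.

Lemma tail_second_moment n :
  (\int[mu]_x (`|x - partial_proj phi n x| ^+ 2)%:E <=
   (expR (- (tau / 2 * n%:R `^ omega)) / (1 - r))%:E)%E.
Proof.
have po := phi_orthonormal_or_zero hii; have pc := phi_complete hii.
have iE x i : '<x - partial_proj phi n x, phi i> = if (i < n)%N then 0 else '<x, phi i>.
  rewrite innerBl; case: ltnP => ni; first by rewrite inner_partial_proj// subrr.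
  rewrite /partial_proj inner_suml big1 ?subr0// => j _.
  by rewrite innerZl po ltn_eqF ?mulr0// (leq_trans (ltn_ord j)).
under eq_integral => x _ do rewrite -(parseval_eseries po pc).
rewrite integral_nneseries//; last 2 first.
- move=> i; apply/measurable_EFinP; apply: measurable_funX.
  under eq_fun do rewrite iE.
  have mi := continuous_borel_measurable (@inner_continuousl _ X (phi i)).
  by case: (i < n)%N; [exact: measurable_cst|exact: mi].
- by move=> i x _; rewrite lee_fin sqr_ge0.
have fE i : (\int[mu]_x ('<x - partial_proj phi n x, phi i> ^+ 2)%:E =
    (if (i < n)%N then 0 else lambda i)%:E)%E.
  under eq_integral do rewrite iE.
  case: (i < n)%N; last exact: second_moment_coordinate.
  by under eq_integral do rewrite expr0n; rewrite integral0.
under eq_eseriesr do rewrite fE.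
have l0 i : 0 <= (if (i < n)%N then 0 else lambda i).
  by case: ifP => // _; rewrite lambdaE expR_ge0.
apply: lime_le; first by apply: is_cvg_nneseries => i _ _; rewrite lee_fin.
apply: nearW => j; rewrite sumEFin lee_fin.
apply: (@le_trans _ _ (series (geometric (expR (- (tau / 2 * n%:R `^ omega))) r) j)).
  rewrite /series /=; apply: ler_sum => i _; case: ltnP => ni.
    by rewrite mulr_ge0 ?expR_ge0// exprn_ge0// ltW.
  exact: lambda_le_geometric.
by apply: geometric_le_lim; [exact: expR_ge0|exact: r0|rewrite gtr0_norm].
Qed.

Hypotheses (sY : separable Y) (hg : gaussian_noise gamma).
Hypotheses (alpha0 : 0 < alpha) (alpha1 : alpha <= 1) (B0 : 0 < B) (sigma0 : 0 < sigma).
Hypothesis p1 : 1 <= p.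

(** In [4 * B + 2 * sigma + 1] the terms stand for the sampling fluctuation, the noise and the
    rounding. Rounding at [1 / sqrt m] keeps its total error [N * eps] below N^2 / sqrt m. *)
Lemma minimax_upper (S : R) (n K m : nat) (h s : R) (M : \bar R) :
  (\int[mu]_x (`|x : X| ^+ 2)%:E <= S%:E)%E ->
  (0 < K)%N -> (0 < m)%N -> 0 < h -> 0 < s ->
  M = fixed_design_minimax mu gamma sigma p (C_ball k alpha B) m \/
  M = random_design_minimax mu gamma sigma p (C_ball k alpha B) m ->
  (M <= (2 * B * bias_bound n K h alpha s S
            (expR (- (tau / 2 * n%:R `^ omega)) / (1 - r)) `^ p^-1 +
         (4 * B + 2 * sigma + 1) * ((2 * K) ^ n)%:R ^+ 2 / Num.sqrt m%:R)%:E)%E.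
Proof.
move=> hS K0 m0 h0 s0 hM; set T := _ / (1 - r).
have [d hd] := separable_dense_seq sY.
have mR : 0 < m%:R :> R by rewrite ltr0n.
pose sm : R := Num.sqrt m%:R.
have sm0 : 0 < sm by rewrite sqrtr_gt0.
have sm2 : sm ^+ 2 = m%:R by rewrite sqr_sqrtr// ltW.
pose eps : R := sm^-1; have eps0 : 0 < eps by rewrite invr_gt0.
pose I : finType := {ffun 'I_n -> 'I_(2 * K)}.
pose N : R := #|I|%:R.
have NE : N = ((2 * K) ^ n)%:R by rewrite /N card_ffun !card_ord.
have I0 : (0 < #|I|)%N by rewrite card_ffun !card_ord expn_gt0 muln_gt0 K0.
have cI : injective (@grid_center R X phi n K h) := grid_center_inj hii h0 (n := n) (K := K).
have [nu hnu] := uniform_probability_exists I0 cI.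
pose G : R := 2 * B * bias_bound n K h alpha s S T `^ p^-1.
have g0 x : 0 <= 2 * B * bias phi n K h alpha s x.
  by rewrite mulr_ge0 ?mulr_ge0 ?(ltW B0)//; case/andP: (bias_itv phi n K h alpha s x).
have mg : measurable_fun setT ((fun x => 2 * B * bias phi n K h alpha s x) : borel X -> R).
  by apply: measurable_funM => //; exact: (bias_measurable hii).
have phi0 : phi 0%N != 0 by rewrite -normr_eq0 (norm_phi hii) oner_eq0.
have bnd (F : X -> Y) (x : X) : C_ball k alpha B F -> `|F x| <= B.
  by move=> cF; exact: (C_ball_bounded phi0 x cF).
have cell (F : X -> Y) (x : X) (J : I) : C_ball k alpha B F -> @cell_of R X phi n K h x = Some J ->
    `|F x - F (grid_center phi h J)| <= 2 * B * bias phi n K h alpha s x.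
  exact: (bias_cell hii h0 alpha0 alpha1 B0 s0).
have out (F : X -> Y) (x : X) : C_ball k alpha B F -> @cell_of R X phi n K h x = None ->
    `|F x| <= 2 * B * bias phi n K h alpha s x.
  exact: (bias_out hii h0 K0 s B0).
have hG : ((\int[mu]_x ((2 * B * bias phi n K h alpha s x) `^ p)%:E) `^ p^-1 <= G%:E)%E.
  exact: (bias_Lp hii K h alpha s B0 p1 hS (tail_second_moment n)).
have mq := @cell_of_measurable _ _ phi n K h h0.
pose Dbound : R := N * (B / m%:R * (sm + N * sm)).
pose Nbound : R := N * (2 * (N / m%:R * sigma * sm)).
have MB : (M <= (G + N * eps + 2 * Dbound + Nbound)%:E)%E.
  case: hM => ->.
    exact: (fixed_design_upper p1 sY sigma0 B0 hg cI mq eps0 hd m0 I0 mg g0 bnd cell out hG hnu).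
  exact: (random_design_upper p1 sY sigma0 B0 hg cI mq eps0 hd m0 I0 mg g0 bnd cell out hG hnu).
apply: le_trans MB _; rewrite lee_fin -/G -addrA -addrA lerD2l -NE.
have N1 : 1 <= N by rewrite /N ler1n.
have N0 : 0 < N by exact: lt_le_trans N1.
have e1 : N * eps <= N ^+ 2 / sm.
  by rewrite ler_wpM2r ?invr_ge0 ?(ltW sm0)// expr2 ler_peMr// ltW.
have e2 : Dbound <= 2 * B * N ^+ 2 / sm.
  rewrite /Dbound -sm2.
  have -> : N * (B / sm ^+ 2 * (sm + N * sm)) = B / sm * (N * (1 + N)).
    by field; rewrite gt_eqF.
  have -> : 2 * B * N ^+ 2 / sm = B / sm * (N * (2 * N)) by field; rewrite gt_eqF.
  rewrite ler_wpM2l ?divr_ge0 ?(ltW B0) ?(ltW sm0)// ler_wpM2l ?(ltW N0)//.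
  lra.
have e3 : Nbound = 2 * sigma * N ^+ 2 / sm.
  by rewrite /Nbound -sm2; field; rewrite gt_eqF.
have -> : (4 * B + 2 * sigma + 1) * N ^+ 2 / sm =
   N ^+ 2 / sm + (2 * (2 * B * N ^+ 2 / sm) + 2 * sigma * N ^+ 2 / sm) by ring.
by rewrite e3 lerD// lerD2r ler_pM2l.
Qed.

End upper_bound.

(** * Asymptotics *)

Section rates.
Context {R : realType}.
Variable omega : R.
Hypothesis omega1 : 1 <= omega.

Let w1 : 0 < omega + 1. Proof. by rewrite ltr_wpDl// (le_trans _ omega1). Qed.

(** With [log_rate], the solution of two balance equations: l D = L, so that l coordinates cut into
    e^D pieces each give e^L cells, and l^omega = D, so that an eigenvalue exp(-tau l^omega) equals
    exp(-tau D). *)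
Definition dim_scale (L : R) : R := L `^ (omega + 1)^-1.
Definition log_rate (L : R) : R := L `^ (omega / (omega + 1)).

Variable L : R.
Hypothesis L1 : 1 <= L.

Let L0 : 0 < L. Proof. exact: lt_le_trans L1. Qed.

Lemma dim_scale_ge1 : 1 <= dim_scale L.
Proof. by rewrite -(powRr0 L) /dim_scale ler_powR// invr_ge0 ltW. Qed.

Lemma dim_scale_mul_log_rate : dim_scale L * log_rate L = L.
Proof.
rewrite /dim_scale /log_rate -powRD; last by rewrite (gt_eqF L0) implybT.
rewrite (_ : _ + _ = 1) ?powRr1 ?ltW//.
by field; rewrite gt_eqF.
Qed.

Lemma dim_scale_le_log_rate : dim_scale L <= log_rate L.
Proof. by rewrite ler_powR// ler_peMl// invr_ge0 ltW. Qed.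

Lemma log_rate_ge1 : 1 <= log_rate L.
Proof. exact: le_trans dim_scale_ge1 dim_scale_le_log_rate. Qed.

Lemma log_rate_le : log_rate L <= L.
Proof.
rewrite -{2}dim_scale_mul_log_rate ler_peMl ?dim_scale_ge1//.
exact: le_trans log_rate_ge1.
Qed.

Lemma dim_scale_powR : dim_scale L `^ omega = log_rate L.
Proof. by rewrite /dim_scale -powRrM mulrC. Qed.

(** From l <= D and l D = L follows L <= D^2. This turns thresholds on ln m into thresholds on the
    rate. *)
Lemma log_rate_ge (x : R) : 0 <= x -> x ^+ 2 <= L -> x <= log_rate L.
Proof.
move=> x0 xL; have D0 : 0 <= log_rate L by exact: le_trans log_rate_ge1.
rewrite -ler_sqr ?nnegrE// (le_trans xL)// -{1}dim_scale_mul_log_rate expr2.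
by rewrite ler_wpM2r// dim_scale_le_log_rate.
Qed.

Lemma dim_scale_ge (x : R) : 0 <= x -> x `^ (omega + 1) <= L -> x <= dim_scale L.
Proof.
move=> x0 xL; have -> : x = (x `^ (omega + 1)) `^ (omega + 1)^-1.
  by rewrite -powRrM mulfV ?gt_eqF// powRr1.
by rewrite ge0_ler_powR ?nnegrE ?powR_ge0 ?invr_ge0// ltW.
Qed.

Lemma log_rate_double : log_rate (2 * L) <= 2 * log_rate L.
Proof.
rewrite /log_rate powRM ?(ltW L0)// ler_wpM2r ?powR_ge0//.
rewrite -[leRHS]powRr1// ler_powR ?ler1n//.
by rewrite ler_pdivrMr// mul1r lerDl.
Qed.

Lemma log_rate_half : log_rate L <= 2 * log_rate (L / 2).
Proof.
have -> : log_rate L = 2 `^ (omega / (omega + 1)) * log_rate (L / 2).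
  by rewrite /log_rate -powRM ?divr_ge0 ?(ltW L0)// (mulrC 2) divfK.
rewrite ler_wpM2r ?powR_ge0//.
rewrite -[leRHS]powRr1// ler_powR ?ler1n//.
by rewrite ler_pdivrMr// mul1r lerDl.
Qed.

End rates.

Lemma le_expR (R : realType) (x : R) : x <= expR x.
Proof. by apply: le_trans (expR_ge1Dx x); rewrite lerDr. Qed.

(** * Choice of the parameters as functions of ln m *)

Section upper_rate.
Context {R : realType}.
Variables (tau omega alpha p : R).
Hypotheses (tau0 : 0 < tau) (omega1 : 1 <= omega) (alpha0 : 0 < alpha) (p1 : 1 <= p)
  (alpha1 : alpha <= 1).

Let omega0 : 0 < omega. Proof. exact: lt_le_trans omega1. Qed.
Let p0 : 0 < p. Proof. exact: lt_le_trans p1. Qed.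

(** The first term comes from n >= l/64, which gives (tau/2) n^omega >= (tau/2) 64^(-omega) D. The
    cap at 1 keeps the mesh error n h^2 <= e^(-D) below s^2 = e^(-decay D). *)
Definition decay : R := Num.min (tau / 2 * 64 `^ (- omega)) 1.

(** The bias has size s^alpha = exp(-alpha decay D / 2) before the p-th root is taken; 1/4 is the
    exponent left to the stochastic error. *)
Definition upper_exponent : R := Num.min (alpha * decay / 2 / p) (1 / 4).

Lemma decay_gt0 : 0 < decay.
Proof. by rewrite /decay lt_min ltr01 andbT mulr_gt0 ?powR_gt0// divr_gt0. Qed.

Lemma upper_exponent_gt0 : 0 < upper_exponent.
Proof. by rewrite /upper_exponent lt_min !divr_gt0// mulr_gt0// decay_gt0. Qed.

(* With l = (ln m)^(1/(omega+1)) and D = (ln m)^(omega/(omega+1)) one has l D = ln m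
   and l^omega = D; the choice n ~ l/32, K ~ e^(2D), h = e^(-D), s = e^(-decay D/2)
   makes the number (2K)^n of cells at most m^(1/8). *)
Lemma upper_rate (Ct S Q0 B : R) : 0 <= Ct -> 0 <= S -> 0 <= B -> 0 <= Q0 ->
  exists L0 : R, forall m : nat, (0 < m)%N -> L0 <= ln m%:R ->
  exists n K (h s : R), [/\ (0 < K)%N, 0 < h, 0 < s &
    2 * B * bias_bound n K h alpha s S (expR (- (tau / 2 * n%:R `^ omega)) * Ct) `^ p^-1 +
    Q0 * ((2 * K) ^ n)%:R ^+ 2 / Num.sqrt m%:R <=
    expR (- (upper_exponent / 2 * log_rate omega (ln m%:R)))].
Proof.
move=> Ct0 S0 B0 Q00.
have c10 := upper_exponent_gt0; set c1 := upper_exponent in c10 *.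
pose Q : R := 2 * B * (Ct + 2 + S) `^ p^-1 + Q0.
have Qge0 : 0 <= Q by rewrite addr_ge0// !mulr_ge0// powR_ge0.
(* The second term forces l >= 64, so that truncating l/32 leaves at least l/64. The third forces Q
   <= (c1/2) D <= exp((c1/2) D): the prefactor costs half of the exponent. *)
exists (1 + 64 `^ (omega + 1) + (2 * Q / c1) ^+ 2) => m m0 hL.
set L := ln m%:R in hL *.
have a1 : 0 <= (64 : R) `^ (omega + 1) by exact: powR_ge0.
have a2 : 0 <= (2 * Q / c1) ^+ 2 by exact: sqr_ge0.
have L1 : 1 <= L by lra.
have ell64 : 64 <= dim_scale omega L by apply: dim_scale_ge => //; lra.
have DQ : 2 * Q / c1 <= log_rate omega L.
  apply: log_rate_ge => //; last lra.
  by rewrite divr_ge0 ?mulr_ge0// ltW.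
have lD := dim_scale_mul_log_rate omega1 L1; have D1 := log_rate_ge1 omega1 L1.
have DL := log_rate_le omega1 L1; have lw := dim_scale_powR omega L.
have lleD := dim_scale_le_log_rate omega1 L1.
set D := log_rate omega L in lD D1 DL lw lleD DQ *.
set l := dim_scale omega L in lD lw lleD ell64.
have D0 : 0 < D by exact: lt_le_trans D1.
have g0 := decay_gt0; set g := decay in g0.
have g1 : g <= 1 by rewrite /g /decay ge_min lexx orbT.
have gt : g <= tau / 2 * 64 `^ (- omega) by rewrite /g /decay ge_min lexx.
have [nl ln] : (Num.trunc (l / 32))%:R <= l / 32 /\ l / 64 <= (Num.trunc (l / 32))%:R.
  have l0 : 0 <= l / 32 by rewrite divr_ge0//; lra.
  have /andP[t1 t2] := truncn_itv l0; split => //.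
  by move: t2; rewrite -[(Num.trunc _).+1%:R]natr1; lra.
set n := Num.trunc (l / 32) in nl ln *.
have [Kl Ku] : expR (2 * D) <= (Num.trunc (expR (2 * D))).+1%:R /\
    (Num.trunc (expR (2 * D))).+1%:R <= 2 * expR (2 * D).
  have /andP[t1 t2] := truncn_itv (expR_ge0 (2 * D)); split; first exact: ltW.
  have e1 : 1 <= expR (2 * D) by apply: le_trans (expR_ge1Dx _); lra.
  by rewrite -[(Num.trunc _).+1%:R]natr1; lra.
set K := (Num.trunc (expR (2 * D))).+1 in Kl Ku *.
exists n, K, (expR (- D)), (expR (- (g * D / 2))); split => //; [exact: expR_gt0|exact: expR_gt0|].
set h := expR (- D); set s := expR (- (g * D / 2)).
pose E := expR (- (alpha * g * D / 2)).
have E0 : 0 <= E by exact: expR_ge0.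
have s2 : s ^+ 2 = expR (- (g * D)).
  by rewrite /s -expRM_natl; congr expR; field.
have sa : s `^ alpha = E.
  by rewrite /s -expRM /E; congr expR; field.
have hn : n%:R * h ^+ 2 <= s ^+ 2.
  rewrite s2; apply: (@le_trans _ _ (expR D * expR (- (2 * D)))).
    have -> : h ^+ 2 = expR (- (2 * D)) by rewrite /h -expRM_natl; congr expR; ring.
    rewrite ler_wpM2r ?expR_ge0//; apply: le_trans (le_expR D); lra.
  rewrite -expRD ler_expR.
  have : g * D <= 1 * D by rewrite ler_wpM2r// ltW.
  lra.
have T1 : expR (- (tau / 2 * n%:R `^ omega)) * Ct <= Ct * s ^+ 2.
  rewrite mulrC ler_wpM2l// s2 ler_expR lerN2.
  apply: (@le_trans _ _ (tau / 2 * 64 `^ (- omega) * D)); first by rewrite ler_wpM2r// ltW.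
  rewrite -mulrA ler_wpM2l ?divr_ge0 ?(ltW tau0)//.
  have -> : 64 `^ (- omega) * D = (l / 64) `^ omega.
    rewrite -lw powRM//; last by rewrite (le_trans _ ell64).
    by rewrite mulrC -[64^-1]powR_inv1// -powRrM mulN1r.
  by rewrite ge0_ler_powR ?nnegrE ?(ltW omega0)// divr_ge0// (le_trans _ ell64).
set T := expR (- (tau / 2 * n%:R `^ omega)) * Ct in T1 *.
have s20 : 0 < s ^+ 2 by rewrite exprn_gt0// expR_gt0.
have bb1 : s `^ alpha * (1 + (T + n%:R * h ^+ 2) / s ^+ 2) <= (Ct + 2) * E.
  rewrite sa mulrC ler_wpM2r//.
  have : (T + n%:R * h ^+ 2) / s ^+ 2 <= Ct + 1.
    by rewrite ler_pdivrMr// mulrDl mul1r lerD.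
  lra.
(* The grid reaches the radius K h >= e^D, so the mass outside costs at most S e^(-2D). *)
have bb2 : S / (K%:R * h) ^+ 2 <= S * E.
  rewrite ler_wpM2l//.
  have Kh : expR D <= K%:R * h.
    apply: (@le_trans _ _ (expR (2 * D) * h)); last by rewrite ler_wpM2r// expR_ge0.
    by rewrite /h -expRD ler_expR; lra.
  rewrite /E expRN lef_pV2 ?posrE ?expR_gt0//; last first.
    by rewrite exprn_gt0// (lt_le_trans _ Kh)// expR_gt0.
  apply: (@le_trans _ _ (expR D ^+ 2)); last first.
    by rewrite lerXn2r ?nnegrE ?expR_ge0// (le_trans _ Kh)// expR_ge0.
  rewrite -expRM_natl ler_expR.
  have : alpha * g * D <= 1 * D.
    by rewrite ler_wpM2r ?(ltW D0)// mulr_ile1// ltW.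
  lra.
have bb : bias_bound n K h alpha s S T <= (Ct + 2 + S) * E.
  by rewrite /bias_bound (mulrDl (Ct + 2) S E) lerD.
have bb0 : 0 <= bias_bound n K h alpha s S T.
  rewrite /bias_bound; apply: addr_ge0; last by rewrite divr_ge0// sqr_ge0.
  rewrite mulr_ge0 ?powR_ge0//; apply: addr_ge0 => //; apply: divr_ge0; last exact: ltW.
  by apply: addr_ge0; [rewrite mulr_ge0// expR_ge0|rewrite mulr_ge0// sqr_ge0].
have CS : 0 <= Ct + 2 + S by rewrite !addr_ge0.
have first : 2 * B * bias_bound n K h alpha s S T `^ p^-1 <=
    2 * B * (Ct + 2 + S) `^ p^-1 * expR (- (c1 * D)).
  rewrite -[leRHS]mulrA ler_wpM2l ?mulr_ge0//.
  apply: (@le_trans _ _ (((Ct + 2 + S) * E) `^ p^-1)).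
    by rewrite ge0_ler_powR ?nnegrE ?invr_ge0 ?(ltW p0)// mulr_ge0.
  rewrite powRM// ler_wpM2l ?powR_ge0// /E -expRM ler_expR mulNr lerN2.
  have : c1 <= alpha * g / 2 / p by rewrite /c1 /upper_exponent ge_min lexx.
  move=> h1; apply: (@le_trans _ _ (alpha * g / 2 / p * D)); first by rewrite ler_wpM2r// ltW.
  by rewrite le_eqVlt; apply/orP; left; apply/eqP; field; rewrite gt_eqF.
have second : Q0 * ((2 * K) ^ n)%:R ^+ 2 / Num.sqrt m%:R <= Q0 * expR (- (c1 * D)).
  rewrite -[leLHS]mulrA ler_wpM2l//.
  have mE : m%:R = expR L by rewrite /L lnK// posrE ltr0n.
  have -> : Num.sqrt m%:R = expR (L / 2).
    rewrite mE -[RHS](ger0_norm (expR_ge0 _)) -sqrtr_sqr -expRM_natl; congr (Num.sqrt (expR _)).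
    by field.
  have K2 : (2 * K)%:R <= expR (4 * D).
    apply: (@le_trans _ _ (4 * expR (2 * D))); first by rewrite natrM; lra.
    have e2 : 4 <= expR 2 :> R.
      have -> : expR 2 = expR 1 * expR 1 :> R by rewrite -expRD.
      have : 2 <= expR 1 :> R by have := expR_ge1Dx (1 : R); lra.
      nra.
    apply: (@le_trans _ _ (expR 2 * expR (2 * D))); first by rewrite ler_wpM2r ?expR_ge0.
    by rewrite -expRD ler_expR; lra.
  (* This is n <= l/32 together with l D = L. The squared count divided by sqrt m is then at most
     e^(-L/4), and D <= L. *)
  have N1 : ((2 * K) ^ n)%:R <= expR (L / 8).
    rewrite natrX; apply: (@le_trans _ _ (expR (4 * D) ^+ n)).
      by rewrite lerXn2r ?nnegrE ?expR_ge0.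
    rewrite -expRM_natl ler_expR -lD.
    have : n%:R * D <= l / 32 * D by rewrite ler_wpM2r// ltW.
    lra.
  rewrite ler_pdivrMr ?expR_gt0//; apply: (@le_trans _ _ (expR (L / 8) ^+ 2)).
    by rewrite lerXn2r ?nnegrE ?expR_ge0.
  rewrite -expRM_natl -expRD ler_expR.
  have h5 : c1 * D <= 1 / 4 * D by rewrite ler_wpM2r ?(ltW D0)// /c1 /upper_exponent ge_min lexx orbT.
  clear first K2 N1 bb bb1 bb2 bb0 T1 hn Kl Ku lD; lra.
apply: le_trans (lerD first second) _; rewrite -mulrDl -/Q.
apply: (@le_trans _ _ (expR (c1 / 2 * D) * expR (- (c1 * D)))); last first.
  by rewrite -expRD ler_expR le_eqVlt; apply/orP; left; apply/eqP; field.
rewrite ler_wpM2r ?expR_ge0//; apply: le_trans (le_expR _).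
by rewrite mulrAC ler_pdivlMr// mulrC [c1 * D]mulrC -ler_pdivrMr.
Qed.

End upper_rate.

Section lower_rate.
Context {R : realType}.
Variables (tau omega p io K : R) (k : nat).
Hypotheses (tau0 : 0 < tau) (omega1 : 1 <= omega) (p1 : 1 <= p) (io0 : 0 < io) (K1 : 1 <= K).

Let omega0 : 0 < omega. Proof. exact: lt_le_trans omega1. Qed.
Let p0 : 0 < p. Proof. exact: lt_le_trans p1. Qed.

(** The exponent of the scaling [eta]: 2 comes from N / 2 <= e^(2D), and tau/2 times 2^omega from
    the square root of the n-th eigenvalue with n <= 2l. *)
Definition width_exponent : R := 2 + tau / 2 * 2 `^ omega.

(** In order: the prefactor depending on [B] and [a]; K^n with n <= 2D; (n eta)^(k+1), where n <=
    e^(2D); the minimum of the bump on the middles; and the p-th root of the mass, whose factor 1/2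
    is the inner [+ 1]. *)
Definition lower_exponent : R :=
  1 + 2 * `|ln K| + k.+1%:R * (2 + width_exponent) + 2 * (k.+1%:R * `|ln (3 / 16 : R)|) +
  (2 * `|ln (io / 2)| + 1) / p.

Lemma exprn_ge_expR (x t : R) n : 0 < x -> n%:R <= t -> expR (- (`|ln x| * t)) <= x ^+ n.
Proof.
move=> x0 nt; rewrite -{2}(lnK x0) -expRM_natl ler_expR.
have h1 := ler_norm (- ln x); rewrite normrN in h1.
have n0 : 0 <= n%:R :> R by [].
apply: (@le_trans _ _ (- (`|ln x| * n%:R))).
  by rewrite lerN2 ler_wpM2l.
rewrite mulrC; nra.
Qed.

(** With n >= l and N >= e^(2D), the number of cells is at least e^(2L) = m^2, which exceeds 2m for
    large m; the rate [D] in place of [2 D] would only give m. [A] is the largest height that the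
    norm condition allows. [B] and [a] enter only through [q0], which is at least e^(-D) as soon as
    D >= 1/q0. *)
Lemma lower_rate (B a : R) : 0 < B -> 0 < a ->
  exists L0 : R, forall m : nat, (0 < m)%N -> L0 <= ln m%:R ->
  exists n N, [/\ (0 < n)%N, (0 < N)%N, (2 * m <= N ^ n)%N &
    let eta := Num.max 1 (N%:R / (2 * a * Num.sqrt (expR (- tau * n%:R `^ omega)))) in
    let A := B / (k.+3%:R * K ^+ n * (n%:R * eta) ^+ k.+1) in
    expR (- (lower_exponent * log_rate omega (ln m%:R))) <=
    A * ((3 / 16) ^+ k.+1) ^+ n * ((io / 2) ^+ n / 2) `^ p^-1 / 2].
Proof.
move=> B0 a0.
pose q0 : R := B / (2 * k.+3%:R * (1 + a^-1) ^+ k.+1).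
have ai : 0 < 1 + a^-1 by rewrite addr_gt0// invr_gt0.
have q00 : 0 < q0 by rewrite divr_gt0// mulr_gt0 ?exprn_gt0// mulr_gt0.
exists (1 + q0^-1 ^+ 2) => m m0 hL; set L := ln m%:R in hL *.
have qi : 0 <= q0^-1 ^+ 2 by exact: sqr_ge0.
have L1 : 1 <= L by lra.
have Dq : q0^-1 <= log_rate omega L.
  by apply: log_rate_ge => //; [rewrite invr_ge0 ltW|lra].
have lD := dim_scale_mul_log_rate omega1 L1; have D1 := log_rate_ge1 omega1 L1.
have lw := dim_scale_powR omega L; have l1 := dim_scale_ge1 omega1 L1.
have lleD := dim_scale_le_log_rate omega1 L1.
set D := log_rate omega L in lD D1 lw lleD Dq *.
set l := dim_scale omega L in lD lw lleD l1.
have D0 : 0 < D by exact: lt_le_trans D1.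
have l0 : 0 <= l by exact: le_trans l1.
have [nl nu] : l <= (Num.trunc l).+1%:R /\ (Num.trunc l).+1%:R <= 2 * l.
  have /andP[t1 t2] := truncn_itv l0; split; first exact: ltW.
  by rewrite -[(Num.trunc _).+1%:R]natr1; lra.
set n := (Num.trunc l).+1 in nl nu *.
have [Nl Nu] : expR (2 * D) <= (Num.trunc (expR (2 * D))).+1%:R /\
    (Num.trunc (expR (2 * D))).+1%:R <= 2 * expR (2 * D).
  have /andP[t1 t2] := truncn_itv (expR_ge0 (2 * D)); split; first exact: ltW.
  have e1 : 1 <= expR (2 * D) by apply: le_trans (expR_ge1Dx _); lra.
  by rewrite -[(Num.trunc _).+1%:R]natr1; lra.
set N := (Num.trunc (expR (2 * D))).+1 in Nl Nu *.
have mE : m%:R = expR L by rewrite /L lnK// posrE ltr0n.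
exists n, N; split => //.
  rewrite -(ler_nat R) natrM natrX; apply: (@le_trans _ _ (expR (2 * D) ^+ n)); last first.
    by rewrite lerXn2r ?nnegrE ?expR_ge0.
  rewrite -expRM_natl; apply: (@le_trans _ _ (expR (L + L))).
    rewrite mE expRD ler_wpM2r ?expR_ge0//.
    by apply: le_trans (expR_ge1Dx L); lra.
  rewrite ler_expR -lD.
  have : l * D <= n%:R * D by rewrite ler_wpM2r// ltW.
  lra.
move=> eta A.
have nD : n%:R <= 2 * D by lra.
have n0 : 0 < n%:R :> R by rewrite ltr0n.
pose c2 := width_exponent.
have w0 : 0 <= tau / 2 * 2 `^ omega by rewrite mulr_ge0 ?powR_ge0// divr_ge0// ltW.
have etaE : eta <= (1 + a^-1) * expR (c2 * D).
  rewrite /eta ge_max; apply/andP; split.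
    rewrite -[leLHS]mulr1 ler_pM//; first by rewrite lerDl invr_ge0 ltW.
    by apply: le_trans (expR_ge1Dx _); rewrite lerDl mulr_ge0 ?(ltW D0)// addr_ge0.
  have -> : Num.sqrt (expR (- tau * n%:R `^ omega)) = expR (- (tau / 2 * n%:R `^ omega)).
    rewrite -[RHS](ger0_norm (expR_ge0 _)) -sqrtr_sqr -expRM_natl; congr (Num.sqrt (expR _)).
    by field.
  have -> : N%:R / (2 * a * expR (- (tau / 2 * n%:R `^ omega))) =
      a^-1 * (N%:R / 2 * expR (tau / 2 * n%:R `^ omega)).
    by rewrite expRN; field; rewrite !gt_eqF ?expR_gt0.
  apply: ler_pM; rewrite ?mulr_ge0 ?invr_ge0 ?expR_ge0 ?(ltW a0) ?lerDr//.
  apply: (@le_trans _ _ (expR (2 * D) * expR (tau / 2 * n%:R `^ omega))).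
    by rewrite ler_wpM2r ?expR_ge0//; lra.
  rewrite -expRD ler_expR /c2 /width_exponent (mulrDl 2 (tau / 2 * 2 `^ omega) D) lerD2l -[leRHS]mulrA ler_wpM2l ?divr_ge0 ?(ltW tau0)//.
  rewrite -lw -powRM// ge0_ler_powR ?nnegrE ?(ltW omega0)//.
  by rewrite mulr_ge0.
have eta1 : 1 <= eta by rewrite /eta le_max lexx.
have eta0 : 0 < eta by exact: lt_le_trans eta1.
have neta : (n%:R * eta) ^+ k.+1 <= (1 + a^-1) ^+ k.+1 * expR (k.+1%:R * (2 + c2) * D).
  have -> : expR (k.+1%:R * (2 + c2) * D) = expR ((2 + c2) * D) ^+ k.+1.
    by rewrite -expRM_natl; congr expR; rewrite mulrA.
  rewrite -exprMn lerXn2r ?nnegrE ?mulr_ge0 ?expR_ge0 ?(ltW eta0) ?(ltW ai)//.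
  have -> : (2 + c2) * D = 2 * D + c2 * D by ring.
  rewrite expRD mulrCA ler_pM ?(ltW eta0)//.
  by apply: le_trans (le_expR _).
have Kn : K ^+ n <= expR (2 * `|ln K| * D).
  have K0 : 0 < K by exact: lt_le_trans K1.
  rewrite -{1}(lnK K0) -expRM_natl ler_expR.
  have k1 := ler_norm (ln K).
  apply: (@le_trans _ _ (n%:R * `|ln K|)); first by rewrite ler_wpM2l.
  have : n%:R * `|ln K| <= 2 * D * `|ln K| by rewrite ler_wpM2r.
  lra.
have hA : 2 * q0 * expR (- ((2 * `|ln K| + k.+1%:R * (2 + c2)) * D)) <= A.
  have k3 : 0 < k.+3%:R :> R by rewrite ltr0n.
  have den : 0 < k.+3%:R * K ^+ n * (n%:R * eta) ^+ k.+1.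
    by rewrite !mulr_gt0 ?exprn_gt0 ?mulr_gt0// (lt_le_trans _ K1).
  rewrite /A ler_pdivlMr//.
  apply: (@le_trans _ _ (2 * q0 * expR (- ((2 * `|ln K| + k.+1%:R * (2 + c2)) * D)) *
     (k.+3%:R * expR (2 * `|ln K| * D) * ((1 + a^-1) ^+ k.+1 * expR (k.+1%:R * (2 + c2) * D))))).
    apply: ler_wpM2l; first by apply: mulr_ge0; [apply: mulr_ge0 => //; exact: ltW|exact: expR_ge0].
    rewrite ler_pM ?mulr_ge0 ?exprn_ge0 ?mulr_ge0 ?(ltW eta0) ?(le_trans _ K1)//.
    by rewrite ler_wpM2l.
  have eE : expR (- ((2 * `|ln K| + k.+1%:R * (2 + c2)) * D)) * expR (2 * `|ln K| * D) *
      expR (k.+1%:R * (2 + c2) * D) = 1.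
    by rewrite -!expRD -expR0; congr expR; ring.
  set e1 := expR (- _) in eE *; set e2 := expR (2 * _ * _) in eE *; set e3 := expR (_ * D) in eE *.
  set ak := (1 + a^-1) ^+ k.+1.
  have -> : 2 * q0 * e1 * (k.+3%:R * e2 * (ak * e3)) = 2 * q0 * k.+3%:R * ak * (e1 * e2 * e3).
    by ring.
  rewrite eE mulr1 /q0 -/ak le_eqVlt; apply/orP; left; apply/eqP; field.
  by rewrite !gt_eqF ?exprn_gt0.
have h3 : expR (- (2 * (k.+1%:R * `|ln (3 / 16 : R)|) * D)) <= ((3 / 16) ^+ k.+1) ^+ n.
  have t0 : 0 < 3 / 16 :> R by rewrite divr_gt0.
  have nk : (k.+1 * n)%:R <= k.+1%:R * (2 * D) by rewrite natrM ler_wpM2l.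
  rewrite -exprM; apply: le_trans (exprn_ge_expR t0 nk).
  by rewrite ler_expR lerN2 le_eqVlt; apply/orP; left; apply/eqP; ring.
have h4 : expR (- ((2 * `|ln (io / 2)| + 1) / p * D)) <= ((io / 2) ^+ n / 2) `^ p^-1.
  have t0 : 0 < io / 2 by rewrite divr_gt0.
  have -> : expR (- ((2 * `|ln (io / 2)| + 1) / p * D)) =
      expR (- ((2 * `|ln (io / 2)| + 1) * D)) `^ p^-1.
    by rewrite -expRM; congr expR; ring.
  rewrite ge0_ler_powR ?nnegrE ?invr_ge0 ?(ltW p0) ?expR_ge0//.
    by rewrite divr_ge0// exprn_ge0// ltW.
  have := exprn_ge_expR t0 nD => h.
  have -> : - ((2 * `|ln (io / 2)| + 1) * D) = - (`|ln (io / 2)| * (2 * D)) + - D by ring.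
  rewrite expRD ler_pM ?expR_ge0//.
  rewrite expRN lef_pV2 ?posrE ?expR_gt0//; apply: le_trans (expR_ge1Dx D); by rewrite -[leLHS]/(1 + 1) lerD2l.
have q0D : expR (- D) <= q0.
  rewrite expRN -[leRHS]invrK lef_pV2 ?posrE ?invr_gt0 ?expR_gt0//.
  by apply: le_trans Dq _; exact: le_expR.
have -> : expR (- (lower_exponent * D)) =
  expR (- D) * expR (- ((2 * `|ln K| + k.+1%:R * (2 + c2)) * D)) *
  expR (- (2 * (k.+1%:R * `|ln (3 / 16 : R)|) * D)) *
  expR (- ((2 * `|ln (io / 2)| + 1) / p * D)).
  by rewrite -!expRD; congr expR; rewrite /lower_exponent -/c2; ring.
rewrite [leRHS]mulrAC ler_pM ?mulr_ge0 ?expR_ge0// [leRHS]mulrAC ler_pM ?mulr_ge0 ?expR_ge0//.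
rewrite ler_pdivlMr//; apply: le_trans hA.
by rewrite [leLHS]mulrC -[leRHS]mulrA ler_pM2l// ler_wpM2r ?expR_ge0.
Qed.

End lower_rate.

(** The exponent omega/(omega+1) is below 1, so changing the argument by a factor at most 2 changes
    the rate by a factor at most 2. This replaces ln m by ln(m/sigma^2). *)
Lemma log_rate_equiv (R : realType) (omega L x : R) : 1 <= omega -> 1 <= L ->
  L / 2 <= x -> x <= 2 * L ->
  log_rate omega L <= 2 * log_rate omega x /\ log_rate omega x <= 2 * log_rate omega L.
Proof.
move=> omega1 L1 xl xu; have w0 : 0 <= omega / (omega + 1).
  by rewrite divr_ge0 ?addr_ge0 ?(le_trans _ omega1).
have L20 : 0 <= L / 2 by rewrite divr_ge0// (le_trans _ L1).
have x0 : 0 <= x by exact: le_trans xl.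
split.
  apply: le_trans (log_rate_half omega1 L1) _; rewrite ler_pM2l//.
  by rewrite /log_rate ge0_ler_powR.
apply: le_trans (log_rate_double omega1 L1).
by rewrite /log_rate ge0_ler_powR ?nnegrE// mulr_ge0// (le_trans _ L1).
Qed.

Lemma lne_between (R : realType) (x y : R) (M : \bar R) :
  ((expR x)%:E <= M)%E -> (M <= (expR y)%:E)%E ->
  ((- y)%:E <= - lne M <= (- x)%:E)%E.
Proof.
case: M => [r| |]//; rewrite !lee_fin => xr ry.
have r0 : 0 < r by exact: lt_le_trans (expR_gt0 x) xr.
rewrite lne_EFin// -EFinN !lee_fin !lerN2; apply/andP; split.
  by rewrite -[leRHS]expRK ler_ln ?posrE ?expR_gt0.
by rewrite -[leLHS]expRK ler_ln ?posrE ?expR_gt0.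
Qed.

Lemma near_infty_ln_ge (R : realType) (L : R) :
  \forall m \near \oo, (0 < m)%N /\ L <= ln m%:R.
Proof.
exists (Num.trunc (expR L)).+1 => // m /= hm; have m0 : (0 < m)%N by exact: leq_trans hm.
split=> //; rewrite -[leLHS]expRK ler_ln ?posrE ?expR_gt0 ?ltr0n//.
have /andP[_ /ltW h] := truncn_itv (expR_ge0 L).
by apply: le_trans h _; rewrite ler_nat.
Qed.

Theorem theorem6p6 (R : realType) (k : nat) (alpha tau omega iota p : R)
    (alpha_gt0 : 0 < alpha) (alpha_le1 : alpha <= 1)
    (tau_gt0 : 0 < tau) (omega_ge1 : 1 <= omega) (p_ge1 : 1 <= p) :
  exists c C : R, [/\ 0 < c, 0 < C &
    forall (X Y : hilbertType R) (B sigma : R)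
      (mu : probability (borel X) R) (gamma : probability (borel Y) R)
      (lambda : nat -> R) (phi : nat -> X) (a b : R),
    separable X -> separable Y -> 0 < B -> 0 < sigma ->
    condition_i mu ->
    condition_ii mu lambda phi ->
    condition_iiiL mu lambda phi a b -> iota = 2 * a * b ->
    condition_iiiU mu lambda phi p ->
    gaussian_noise gamma ->
    (forall i, lambda i = expR (- tau * i.+1%:R `^ omega)) ->
    \forall m \near \oo,
      forall M : \bar R,
        M = fixed_design_minimax mu gamma sigma p (C_ball k alpha B) m \/
        M = random_design_minimax mu gamma sigma p (C_ball k alpha B) m ->
        let rate := ln (m%:R / sigma ^+ 2) `^ (omega / (omega + 1)) in
        ((c * rate)%:E <= - lne M <= (C * rate)%:E)%E].
Proof.
have [K K1 hK] := @bump_bounds R k.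
have cu0 : 0 < upper_exponent tau omega alpha p by exact: upper_exponent_gt0.
set cu := upper_exponent tau omega alpha p in cu0.
pose cl := lower_exponent tau omega p iota K k.
(* Of [cu / 4], one half was spent on the prefactor and the other on passing from ln m to
   ln(m/sigma^2); the same passage gives the 2 before [cl]. The added 1 ensures positivity. *)
exists (cu / 4), (2 * `|cl| + 1); split; first by rewrite divr_gt0.
  by rewrite ltr_wpDl// mulr_ge0.
move=> X Y B sigma mu gamma lambda phi a b sX sY B0 sigma0 hi hii hiiiL ioE _ hg lambdaE.
have [a0 b0 _] := hiiiL.
have io0 : 0 < iota by rewrite ioE !mulr_gt0.
have [S S0 hS] : exists2 S : R, 0 <= S & (\int[mu]_x (`|x : X| ^+ 2)%:E <= S%:E)%E.
  have [_ hfin] := hi.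
  have i0 : (0 <= \int[mu]_x (`|x : X| ^+ 2)%:E)%E.
    by apply: integral_ge0 => x _; rewrite lee_fin sqr_ge0.
  exists (fine (\int[mu]_x (`|x : X| ^+ 2)%:E)%E); first exact: fine_ge0.
  by rewrite fineK// ge0_fin_numE.
have Ct0 : 0 <= (1 - expR (- (tau / 2)))^-1.
  by rewrite invr_ge0 subr_ge0 -[leRHS]expR0 ler_expR oppr_le0 divr_ge0// ltW.
have Q0 : 0 <= 4 * B + 2 * sigma + 1.
  by rewrite !addr_ge0// mulr_ge0// ltW.
have [u u1] := noise_unit_vector hg.
have [L1 hL1] := upper_rate tau_gt0 omega_ge1 alpha_gt0 p_ge1 alpha_le1 Ct0 S0 (ltW B0) Q0.
have [L2 hL2] := lower_rate k tau_gt0 omega_ge1 p_ge1 io0 K1 B0 a0.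
(* The last threshold makes |ln(sigma^2)| at most half of ln m, so that ln(m/sigma^2) lies between
   half and twice ln m. *)
near=> m; have [] : (0 < m)%N /\ Num.max (Num.max L1 L2) (Num.max 1 (2 * `|ln (sigma ^+ 2)|)) <= ln m%:R.
  by near: m; exact: near_infty_ln_ge.
move=> m0; rewrite !ge_max => /andP[/andP[L1m L2m] /andP[m1 ms]] M hM.
set L := ln m%:R in L1m L2m m1 ms; set rate := (X in (_ * X)%:E); rewrite -/rate.
have s20 : 0 < sigma ^+ 2 by rewrite exprn_gt0.
have xE : ln (m%:R / sigma ^+ 2) = L - ln (sigma ^+ 2).
  by rewrite lnM ?posrE ?invr_gt0 ?ltr0n// lnV ?posrE.
have [hle hge] : log_rate omega L <= 2 * rate /\ rate <= 2 * log_rate omega L.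
  have := ler_norm (ln (sigma ^+ 2)); have := ler_norm (- ln (sigma ^+ 2)); rewrite normrN.
  by move=> n1 n2; apply: log_rate_equiv; rewrite ?xE //; lra.
have up : (M <= (expR (- (cu / 2 * log_rate omega L)))%:E)%E.
  have [n [K' [h [s [K0 h0 s0 hb]]]]] := hL1 _ m0 L1m.
  apply: le_trans (minimax_upper hii tau_gt0 omega_ge1 lambdaE sY hg alpha_gt0 alpha_le1 B0
    sigma0 p_ge1 n hS K0 m0 h0 s0 hM) _.
  by rewrite lee_fin.
have low : ((expR (- (cl * log_rate omega L)))%:E <= M)%E.
  have [n [N [n0 N0 hN hb]]] := hL2 _ m0 L2m.
  move: hb => /=; set eta := Num.max 1 _; set A := B / _ => hb.
  have eta0 : 0 < eta by rewrite lt_max ltr01.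
  have den : 0 < k.+3%:R * K ^+ n * (n%:R * eta) ^+ k.+1.
    by rewrite !mulr_gt0 ?exprn_gt0 ?mulr_gt0 ?ltr0n// (lt_le_trans _ K1).
  have A0 : 0 < A by rewrite divr_gt0.
  apply: le_trans (minimax_lower sY hii hiiiL ioE n0 p_ge1 alpha_gt0 alpha_le1 hN N0 A0 u1 K1
    hK _ hM); first by rewrite lee_fin.
  rewrite lambdaE prednK// -/eta.
  have -> : k.+3%:R * A * K ^+ n * (n%:R * eta) ^+ k.+1 =
      A * (k.+3%:R * K ^+ n * (n%:R * eta) ^+ k.+1) by ring.
  by rewrite divfK ?gt_eqF.
have /andP[lo hi'] := lne_between low up.
rewrite !opprK in lo hi'.
apply/andP; split; [apply: le_trans lo|apply: le_trans hi' _]; rewrite lee_fin.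
  have : cu / 4 * rate <= cu / 4 * (2 * log_rate omega L) by rewrite ler_wpM2l// divr_ge0// ltW.
  lra.
have r0 : 0 <= rate by exact: powR_ge0.
have D0 : 0 <= log_rate omega L by exact: powR_ge0.
apply: (@le_trans _ _ (`|cl| * (2 * rate))).
  by apply: (@le_trans _ _ (`|cl| * log_rate omega L)); [rewrite ler_wpM2r// ler_norm|rewrite ler_wpM2l].
by rewrite mulrA [`|cl| * 2]mulrC ler_wpM2r// lerDl.
Unshelve. all: by end_near.
Qed.
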